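(* Let $G$ be a finite simple planar graph that contains no cycle of length $3$ and has maximum degree $\Delta \geq 6$. Then $G$ has an equitable $\Delta$-coloring.
   Context: An equitable $k$-coloring of a graph is a proper vertex coloring with $k$ colors such that the sizes of every two color classes differ by at most $1$. *)

(* Defs.v *)
From HB Require Import structures.
From mathcomp Require Import all_boot all_order all_algebra.
From mathcomp Require Import all_classical all_reals all_analysis.
Import Order.TTheory GRing.Theory Num.Theory.
Import numFieldNormedType.Exports.

Set Implicit Arguments.
Unset Strict Implicit.
Unset Printing Implicit Defensive.

Local Open Scope ring_scope.
Local Open Scope classical_set_scope.

Definition simple_graph (T : finType) (e : rel T) : Prop :=
  symmetric e /\ irreflexive e.

Definition degree (T : finType) (e : rel T) (x : T) : nat := #|[set y | e x y]%SET|.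

Definition max_degree (T : finType) (e : rel T) : nat := (\max_(x : T) degree e x)%N.

Definition proper_coloring (T : finType) (e : rel T) (k : nat) (f : T -> 'I_k) : Prop :=
  forall x y : T, e x y -> f x != f y.

Definition color_class (T : finType) (k : nat) (f : T -> 'I_k) (i : 'I_k) : {set T} :=
  [set x | f x == i]%SET.

(* A color class is allowed to be empty. *)
Definition equitable_coloring (T : finType) (e : rel T) (k : nat) (f : T -> 'I_k) : Prop :=
  proper_coloring e f /\
  forall i j : 'I_k, (#|color_class f i| <= #|color_class f j| + 1)%N.

Definition is_arc (R : realType) (A : set (R * R)) (p q : R * R) : Prop :=
  exists g : R -> R * R,
    [/\ {within `[0, 1], continuous g},
        {in `[0, 1] &, injective g},
        g 0 = p, g 1 = q & g @` `[0, 1] = A].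

(* [edge x y] is only constrained when x and y are adjacent; the inner points of
   a drawn edge are its points other than its two ends. *)
Definition plane_drawing (R : realType) (T : finType) (e : rel T)
    (pt : T -> R * R) (edge : T -> T -> set (R * R)) : Prop :=
  [/\ injective pt,
      forall x y, e x y -> is_arc (edge x y) (pt x) (pt y),
      forall x y, e x y -> edge x y = edge y x,
      forall x y z, e x y -> ~ (edge x y `\` [set pt x; pt y]) (pt z) &
      forall x y x' y', e x y -> e x' y' -> [set x; y]%SET <> [set x'; y']%SET ->
        (edge x y `\` [set pt x; pt y]) `&` edge x' y' = set0].

Definition planar (R : realType) (T : finType) (e : rel T) : Prop :=
  exists (pt : T -> R * R) (edge : T -> T -> set (R * R)), plane_drawing e pt edge.

(* Main.v *)
(* Only two properties of triangle-free planar graphs are used: a set of s > 2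
   vertices spans at most 2s - 4 edges, and neighbors of a vertex are not adjacent.

   Coloring.  It suffices to treat kt vertices, k >= 6 bounding the maximum
   degree.  In an edge-minimal counterexample, delete an edge at a vertex x of
   degree at most 3 and color the rest: x is left over and one class N lacks a
   vertex.  The classes from which vertices can be moved along into N are all
   seen by x, so there are a <= 3 of them, and every vertex of the set B of all
   vertices outside them sees all of them too, which makes at least a|B| edges.
   By the bound on the number of edges, many vertices of B have only one
   neighbor in a given accessible class W, and some w in W is this neighbor for
   two of them, y1 and y2.  These are not adjacent, so w can be exchanged for
   them, and it remains to color B - y1 - y2 + w with k - a colors, where few
   edges are left; the same argument is repeated there.

   Edges.  Rounding the arcs of a drawing to a fine square grid exhibits the graph
   as a minor of the grid.  On the grid, a set of edges that is even at every
   point is the boundary of a set of squares.  Hence the cycle space of the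
   graph is spanned by boundaries of faces, and Euler's inequality follows by
   linear algebra over the field with two elements. *)
Require Import Defs.
From HB Require Import structures.
From mathcomp Require Import all_boot all_order all_algebra.
From mathcomp Require Import zify ring lra.
From mathcomp Require boolp.

Set Implicit Arguments.
Unset Strict Implicit.
Unset Printing Implicit Defensive.

Import Order.TTheory GRing.Theory Num.Theory.

(** * Balanced colorings *)

Section BalancedColorings.
Variables (T : finType).
Implicit Types (e : rel T) (A B S U V : {set T}) (f g : T -> nat).

(** The recursion ends with a count: a b-colorable graph on bt vertices with at most (b - 1)t edges
    can always be rebalanced, because classes that cannot pass vertices on to the small ones would
    force more edges than that. The obstacle lies before that point. The exchanged vertex [w] enters
    the remaining graph with several neighbors, so degrees there may exceed the number of colors
    left, and the statement being proved is not the one needed next. Each later stage therefore has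
    hypotheses of its own: an edge bound computed from the stage before, and bounds on the degrees
    or on their total excess over the number of colors. All of them survive the deletion of an edge,
    so the choice of an edge-minimal counterexample can be repeated at every stage. The reduction to
    kt vertices rests on two facts. If one or two vertices are missing, they can be added as a
    clique without creating a triangle. If more are missing, at least four classes are small, and a
    vertex of degree at most 3 fits into one of them. *)

Definition deg e x S : nat := \sum_(y in S) e x y.
(** Ordered pairs are counted, so [nE e S S] is twice the number of edges inside [S]; the edge
    bounds below carry this factor 2. *)
Definition nE e A B : nat := \sum_(x in A) deg e x B.

Definition proper e f S := forall x y, x \in S -> y \in S -> e x y -> f x != f y.
Definition cls f S i : {set T} := [set x in S | f x == i].
(** Colorings are total functions to [nat] that matter only on [S], so restricting and gluing them
    involves no change of type. *)
Definition colorable e S n := exists f, (forall x, x \in S -> f x < n) /\ proper e f S.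
Definition balanced e S n t := exists f,
  [/\ forall x, x \in S -> f x < n, proper e f S & forall i, i < n -> #|cls f S i| = t].
Definition indep e S := forall x y, x \in S -> y \in S -> ~~ e x y.

Lemma degE e x S : deg e x S = #|[set y in S | e x y]|.
Proof.
rewrite /deg -sum1_card big_mkcond [RHS]big_mkcond /=; apply: eq_bigr => y _.
by rewrite !inE; case: (y \in S); case: (e x y).
Qed.

Lemma deg0P e x S : reflect (forall y, y \in S -> ~~ e x y) (deg e x S == 0).
Proof.
rewrite sum_nat_eq0; apply: (iffP forall_inP) => H y yS; have := H y yS; by case: (e x y).
Qed.

Lemma deg_gt0P e x S : reflect (exists2 y, y \in S & e x y) (0 < deg e x S).
Proof.
rewrite lt0n; apply: (iffP idP) => [|[y yS exy]].
  rewrite sum_nat_eq0 negb_forall_in => /existsP[y /andP[yS H]].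
  by exists y => //; case: (e x y) H.
by apply/negP => /deg0P/(_ y yS); rewrite exy.
Qed.

Lemma disjU A B : [disjoint A & B] -> forall F : T -> nat,
  \sum_(x in A :|: B) F x = \sum_(x in A) F x + \sum_(x in B) F x.
Proof.
move=> dAB F; rewrite -bigU //=; apply: eq_bigl => x; by rewrite !inE.
Qed.

Lemma degU e x A B : [disjoint A & B] -> deg e x (A :|: B) = deg e x A + deg e x B.
Proof. by move=> d; rewrite /deg disjU. Qed.

Lemma nEU e A B : symmetric e -> [disjoint A & B] ->
  nE e (A :|: B) (A :|: B) = nE e A A + nE e B B + (nE e B A).*2.
Proof.
move=> sym d; rewrite /nE disjU //.
rewrite (eq_bigr (fun x => deg e x A + deg e x B)); last by move=> x _; rewrite degU.
rewrite [X in _ + X](eq_bigr (fun x => deg e x A + deg e x B)); last by move=> x _; rewrite degU.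
rewrite !big_split /=.
have -> : \sum_(i in A) deg e i B = \sum_(i in B) deg e i A.
  rewrite exchange_big /=; apply: eq_bigr => x _; apply: eq_bigr => y _; by rewrite sym.
lia.
Qed.

Lemma nEC e A B : symmetric e -> nE e A B = nE e B A.
Proof.
move=> sym; rewrite /nE exchange_big /=; apply: eq_bigr => x _; apply: eq_bigr => y _.
by rewrite sym.
Qed.

Lemma sum_ge (F : T -> nat) m A : (forall x, x \in A -> m <= F x) ->
  m * #|A| <= \sum_(x in A) F x.
Proof. by move=> H; rewrite mulnC -sum_nat_const; apply: leq_sum. Qed.

Lemma sum_le (F : T -> nat) m A : (forall x, x \in A -> F x <= m) ->
  \sum_(x in A) F x <= m * #|A|.
Proof. by move=> H; rewrite mulnC -sum_nat_const; apply: leq_sum. Qed.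

Lemma deg_sub e x A B : A \subset B -> deg e x A <= deg e x B.
Proof.
move=> sAB; rewrite !degE subset_leq_card //; apply/subsetP => y.
by rewrite !inE => /andP[/(subsetP sAB)-> ->].
Qed.

Lemma nE_sub e A B : A \subset B -> nE e A A <= nE e B B.
Proof.
move=> sAB; rewrite /nE [X in _ <= X](big_setID A) /= (setIidPr sAB).
apply: leq_trans (leq_addr _ _); apply: leq_sum => x _; exact: deg_sub.
Qed.

Lemma deg1 e x y : deg e x [set y] = e x y.
Proof. by rewrite /deg big_set1. Qed.

Lemma indep_nE e S : indep e S -> nE e S S = 0.
Proof.
move=> H; apply/eqP; rewrite sum_nat_eq0; apply/forall_inP => x xS.
by apply/deg0P => y yS; apply: H.
Qed.

Lemma nE_add1 e w S : symmetric e -> irreflexive e -> w \notin S ->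
  nE e (w |: S) (w |: S) = nE e S S + (deg e w S).*2.
Proof.
move=> sym irr wS; rewrite nEU //; last by rewrite disjoints1.
have -> : nE e [set w] [set w] = 0 by rewrite /nE big_set1 deg1 irr.
by rewrite nEC // /nE big_set1.
Qed.

Lemma proper_sub e f A B : A \subset B -> proper e f B -> proper e f A.
Proof. by move=> /subsetP s H x y xA yA; apply: H; apply: s. Qed.

Lemma colorable_sub e A B n : A \subset B -> colorable e B n -> colorable e A n.
Proof.
move=> s [f [H1 H2]]; exists f; split; last exact: proper_sub H2.
by move=> x xA; apply: H1; apply: (subsetP s).
Qed.

Lemma balanced_colorable e S n t : balanced e S n t -> colorable e S n.
Proof. by case=> f [H1 H2 _]; exists f. Qed.

Lemma cls_sum f S n : (forall x, x \in S -> f x < n) -> \sum_(i < n) #|cls f S i| = #|S|.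
Proof.
move=> H; rewrite (eq_bigr (fun i : 'I_n => \sum_(x in cls f S i) 1)); last by move=> i _; rewrite sum1_card.
rewrite -sum1_card.
case: n H => [|n] H.
  by rewrite big_ord0 big1 // => x /H.
rewrite (partition_big (fun x => inord (f x) : 'I_n.+1) xpredT) //=.
apply: eq_bigr => i _; apply: eq_bigl => x; rewrite inE.
case xS: (x \in S) => //=; rewrite -val_eqE /= inordK //; exact: H.
Qed.

Lemma balanced_card e S n t : balanced e S n t -> #|S| = n * t.
Proof.
case=> f [H1 _ H3]; rewrite -(cls_sum H1) (eq_bigr (fun=> t)); last by move=> i _; apply: H3.
by rewrite sum_nat_const card_ord.
Qed.

Lemma balanced_cat e A B a b t : [disjoint A & B] -> balanced e A a t -> balanced e B b t ->
  balanced e (A :|: B) (a + b) t.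
Proof.
move=> dAB [f [f1 f2 f3]] [g [g1 g2 g3]].
have BA x : x \in B -> (x \in A) = false by move=> xB; apply: (disjointFl dAB).
exists (fun x => if x \in A then f x else a + g x); split.
- move=> x; rewrite inE; case: ifP => xA /=; first by move=> _; have := f1 x xA; lia.
  by move=> /g1; lia.
- move=> x y; rewrite !inE; case: ifP => xA; case: ifP => yA //=.
  + by move=> _ _; apply: f2.
  + by move=> _ yB _; have := f1 x xA; lia.
  + by move=> xB _ _; have := f1 y yA; lia.
  + by move=> xB yB /(g2 _ _ xB yB); lia.
- move=> i iab; case: (ltnP i a) => ia.
    rewrite -(f3 i ia); apply: eq_card => x; rewrite !inE.
    case: ifP => xA //=; case xB: (x \in B) => //=; lia.
  rewrite -(g3 (i - a)); last lia.
  apply: eq_card => x; rewrite !inE.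
  case: ifP => xA //=; last by case: (x \in B) => //=; lia.
  rewrite (disjointFr dAB xA) /=; have := f1 x xA; lia.
Qed.

Lemma balanced1 e S t : indep e S -> #|S| = t -> balanced e S 1 t.
Proof.
move=> H1 H2; exists (fun=> 0); split=> //.
  by move=> x y xS yS; rewrite (negbTE (H1 x y xS yS)).
move=> [|//] _; rewrite -H2; apply: eq_card => x; by rewrite !inE eqxx andbT.
Qed.

(* Color names are irrelevant: any duplicate-free list [K] of colors will do. *)
Lemma balanced_relabel e S f (K : seq nat) t : uniq K -> (forall x, x \in S -> f x \in K) ->
  proper e f S -> (forall i, i \in K -> #|cls f S i| = t) -> balanced e S (size K) t.
Proof.
move=> uK H1 H2 H3; exists (fun x => index (f x) K); split.
- by move=> x /H1; rewrite index_mem.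
- move=> x y xS yS /(H2 _ _ xS yS); apply: contra => /eqP E.
  by rewrite -(nth_index 0 (H1 x xS)) E nth_index // H1.
- move=> i iK; rewrite -(H3 (nth 0 K i)) ?mem_nth //.
  apply: eq_card => x; rewrite !inE; case xS: (x \in S) => //=.
  apply/eqP/eqP => [<-|->]; first by rewrite nth_index // H1.
  by rewrite index_uniq.
Qed.

Lemma colorable_add e v S n : symmetric e -> irreflexive e ->
  colorable e S n -> deg e v S < n -> colorable e (v |: S) n.
Proof.
move=> sym irr [f [f1 f2]] dv.
have [i iP] : exists i : 'I_n, forall y, y \in S -> e v y -> f y != i.
  case: (boolP [exists i : 'I_n, [forall y in S, e v y ==> (f y != i)]]).
    case/existsP=> i /forall_inP H; exists i => y yS; exact/implyP/H.
  rewrite negb_exists => /forallP H; exfalso.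
  move: dv; rewrite ltnNge => /negP; apply.
  have n0 : 0 < n \/ n = 0 by lia.
  case: n0 => [n0|->//]; case: n n0 f1 H => // n _ f1 H.
  have /subset_leq_card : [set: 'I_n.+1] \subset
      [set (inord (f y) : 'I_n.+1) | y in [set y in S | e v y]].
    apply/subsetP => i _; have := H i; rewrite negb_forall_in => /existsP[y /andP[yS]].
    rewrite negb_imply negbK => /andP[evy /eqP fy]; apply/imsetP; exists y; first by rewrite inE yS.
    by rewrite fy inord_val.
  rewrite cardsT card_ord degE => /leq_trans; apply; exact: leq_imset_card.
exists (fun x => if x == v then (i : nat) else f x); split.
  by move=> x; rewrite !inE; case: eqP => //= _ xS; apply: f1.
move=> x y; rewrite !inE; case: eqP => [->|xv] /=; case: eqP => [->|yv] //=.
- by rewrite irr.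
- by move=> _ yS evy; rewrite eq_sym; apply: iP.
- by move=> xS _ exv; apply: iP => //; rewrite sym.
- exact: f2.
Qed.

(** The vertex [x], isolated in [B], can take over the color of [y], so it does not matter which of
    the two is left out. *)
Lemma balanced_swap e B x y n t : symmetric e -> x \in B -> y \in B -> deg e x B = 0 ->
  balanced e (B :\ x) n t -> balanced e (B :\ y) n t.
Proof.
move=> sym xB yB /eqP/deg0P x0; case: (eqVneq x y) => [-> //|nxy] [f [f1 f2 f3]].
exists (fun z => if z == x then f y else f z); split.
- move=> z; rewrite !inE => /andP[zy zB]; case: eqP => zx; apply: f1; rewrite !inE.
    by rewrite eq_sym nxy.
  by rewrite zB andbT; apply/eqP.
- move=> u v; rewrite !inE => /andP[uy uB] /andP[vy vB] euv.
  case: (eqVneq u x) => [ux|ux]; first by move: euv; rewrite ux (negbTE (x0 v vB)).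
  case: (eqVneq v x) => [vx|vx]; first by move: euv; rewrite sym vx (negbTE (x0 u uB)).
  by apply: f2; rewrite // !inE ?ux ?vx.
- move=> i ii; rewrite -(f3 i ii).
  have inj : {in cls f (B :\ x) i &, injective (fun z => if z == y then x else z)}.
    move=> u v; rewrite !inE => /andP[/andP[ux _] _] /andP[/andP[vx _] _].
    case: eqP => [->|_]; case: eqP => [->|_] //.
      by move=> E; rewrite E eqxx in vx.
    by move=> E; rewrite E eqxx in ux.
  rewrite -(card_in_imset inj); apply: eq_card => z; rewrite !inE.
  apply/idP/imsetP => [/andP[/andP[zy zB] zi]|[u]].
    move: zi; case: (eqVneq z x) => [->|zx] zi.
      by exists y; rewrite ?eqxx // !inE eq_sym nxy yB.
    by exists z; rewrite ?(negbTE zy) // !inE zx zB.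
  rewrite !inE => /andP[/andP[ux uB] ui] ->; case: (eqVneq u y) => uy.
    by rewrite nxy xB eqxx -uy.
  by rewrite uy uB (negbTE ux).
Qed.

End BalancedColorings.

(** * Moving vertices along paths of colors *)

Section Rebalancing.
Variables (T : finType).
Implicit Types (e : rel T) (A B S U V : {set T}) (f g : T -> nat).

Definition sparse e := forall S, 2 < #|S| -> nE e S S + 8 <= 4 * #|S|.
Definition degenerate e := forall S, S != set0 -> exists2 x, x \in S & deg e x S <= 3.

(** By sparsity the average degree inside [S] is below 4; in a set of at most two vertices any
    vertex will do. *)
Lemma sparse_degenerate e : sparse e -> degenerate e.
Proof.
move=> sp S S0; case: (ltnP 2 #|S|) => cS.
  case: (boolP [exists x in S, deg e x S <= 3]) => [/exists_inP[x]|]; first by exists x.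
  rewrite negb_exists_in => /forall_inP H; have := sp S cS.
  have : 4 * #|S| <= nE e S S by apply: sum_ge => x /H; rewrite -ltnNge.
  lia.
case/set0Pn: S0 => x xS; exists x => //; rewrite degE.
apply: leq_trans (_ : #|S| <= 3); last lia.
by apply: subset_leq_card; apply/subsetP => y; rewrite inE => /andP[].
Qed.

Lemma degenerate_colorable e S n : symmetric e -> irreflexive e -> degenerate e ->
  4 <= n -> colorable e S n.
Proof.
move=> sym irr dg n4; have [m] := ubnP #|S|; elim: m S => // m IH S cS.
case: (eqVneq S set0) => [->|S0].
  by exists (fun=> 0); split=> [x|x y]; rewrite inE.
have [x xS dx] := dg S S0.
rewrite -(setD1K xS); apply: colorable_add => //.
  by apply: IH; rewrite (cardsD1 x) xS in cS.
by apply: leq_ltn_trans (deg_sub e x (subsetDl S [set x])) _; lia.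
Qed.

(** The arcs of the auxiliary digraph on colors familiar from proofs of the Hajnal-Szemeredi
    theorem. *)
Definition moves e V f i j :=
  [exists u in V, (f u == i) && [forall v in V, e u v ==> (f v != j)]].

Lemma deg_colors e f A (K : seq nat) y : uniq K ->
  (forall j, j \in K -> exists v, [/\ v \in A, e y v & f v = j]) -> size K <= deg e y A.
Proof.
move=> uK H; rewrite degE cardE.
rewrite -(size_map f); apply: uniq_leq_size => // j /H[v [vA ev <-]].
by apply: map_f; rewrite mem_enum inE vA.
Qed.

Lemma cls_upd f S u j k : u \in S -> f u != j ->
  #|cls (fun x => if x == u then j else f x) S k| + (k == f u) = #|cls f S k| + (k == j).
Proof.
move=> uS fu; set f2 := fun x => _.
rewrite (cardsD1 u (cls f2 S k)) (cardsD1 u (cls f S k)) !inE uS /= /f2 eqxx.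
have -> : cls f2 S k :\ u = cls f S k :\ u.
  by apply/setP => x; rewrite !inE /f2; case: (x == u).
rewrite (eq_sym j k) (eq_sym (f u) k); lia.
Qed.

(* Moving one vertex along each step of a path of colors, starting at its end. *)
Lemma shift e V f i p : symmetric e -> irreflexive e -> proper e f V ->
  path (moves e V f) i p -> uniq (i :: p) ->
  exists f', [/\ proper e f' V,
    forall k, #|cls f' V k| + (k == i) = #|cls f V k| + (k == last i p),
    forall v, v \in V -> f' v = f v \/ (f v \in i :: p /\ f' v \in i :: p)
  & forall v, v \in V -> f' v = i -> f v = i].
Proof.
move=> sym irr pf; elim: p i => [|j p IH] i /=.
  by move=> _ _; exists f; split=> //; move=> v _; left.
case/andP => /exists_inP[u uV /andP[/eqP fu /forall_inP Hu]] pth /andP[iNp ujp].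
have [f1 [pf1 c1 r1 s1]] := IH j pth ujp.
have f1u : f1 u = i by case: (r1 u uV) => [->//|[]]; rewrite fu (negbTE iNp).
have ij : i != j by move: iNp; rewrite inE negb_or => /andP[].
exists (fun x => if x == u then j else f1 x); split.
(* By the last clause of the induction hypothesis, the shift along the tail puts no new vertex into
   color [j], so [u] still fits there. *)
- have key v : v \in V -> e u v -> f1 v != j.
    move=> vV euv; apply/eqP => /(s1 v vV) fv.
    by have := Hu v vV; rewrite euv fv eqxx.
  move=> x y xV yV; case: (eqVneq x u) => [->|xu]; case: (eqVneq y u) => [->|yu].
  + by rewrite irr.
  + by move=> /(key _ yV); rewrite eq_sym.
  + by rewrite sym => /(key _ xV).
  + exact: pf1.
- move=> k; by have := @cls_upd f1 V u j k uV; rewrite f1u => /(_ ij) ->; exact: c1.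
- move=> v vV; case: (eqVneq v u) => [->|_].
    by right; rewrite fu !inE !eqxx /= orbT.
  case: (r1 v vV) => [->|[a b]]; first by left.
  by right; rewrite inE a orbT inE b orbT.
- move=> v vV; case: (eqVneq v u) => [-> E|_ f1v]; first by rewrite E eqxx in ij.
  by case: (r1 v vV) => [<-//|[_]]; rewrite f1v (negbTE iNp).
Qed.

Lemma nE_ge_cut e A B : symmetric e -> [disjoint A & B] ->
  nE e A A + nE e B B + (nE e B A).*2 <= nE e (A :|: B) (A :|: B).
Proof. by move=> sym d; rewrite nEU. Qed.

(** Induction on the total overflow of the classes, which drops when an overfull class can shift a
    vertex towards a small one. If no overfull class can, every vertex outside the classes that
    reach a small one has a neighbor in each of those classes, and these edges are too many. *)
Lemma few_edges_balanced e U b t : symmetric e -> irreflexive e ->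
  colorable e U b -> #|U| = b * t -> nE e U U <= 2 * (b.-1 * t) -> balanced e U b t.
Proof.
move=> sym irr [f0 [r0 p0]] cU fewE.
have [m] := ubnP (\sum_(i < b) (#|cls f0 U i| - t)).
elim: m f0 r0 p0 => // m IH f rf pf lem.
have sumc := cls_sum rf.
case: (boolP [exists i : 'I_b, t < #|cls f U i|]); last first.
  rewrite negb_exists => /forallP H; exists f; split=> // i ib; apply/eqP.
  have le (j : 'I_b) : true -> #|cls f U j| <= t ?= iff (#|cls f U j| == t).
    by move=> _; split=> //; have := H j; lia.
  have [_] := leqif_sum le; rewrite sumc sum_nat_const card_ord cU eqxx.
  by move/esym/forall_inP/(_ (Ordinal ib) isT).
case/existsP => i ibig.
have [s sm] : exists s : 'I_b, #|cls f U s| < t.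
  case: (boolP [exists s : 'I_b, #|cls f U s| < t]) => [/existsP//|].
  rewrite negb_exists => /forallP H; exfalso.
  have: \sum_(j < b) t < \sum_(j < b) #|cls f U j|.
    rewrite (bigD1 i) //= [X in _ < X](bigD1 i) //= -addSn; apply: leq_add => //.
    by apply: leq_sum => j _; have := H j; lia.
  by rewrite sumc sum_nat_const card_ord cU ltnn.
pose r : rel 'I_b := fun j k => moves e U f j k.
pose K : {set 'I_b} := [set j | [exists s : 'I_b, (#|cls f U s| < t) && connect r j s]].
case: (boolP (i \in K)) => iK.
  move: iK; rewrite inE => /existsP[s' /andP[sm' /connectP[p0' pth0 ls0]]].
  move: ls0; case/shortenP: pth0 => p pth up _ ls.
  have [||f' [pf' c' r' _]] := @shift e U f i (map val p) sym irr pf.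
  - by rewrite path_map; move: pth; apply: sub_path.
  - by rewrite -(map_cons val) map_inj_uniq //; apply: val_inj.
  have ls' : last (i : nat) (map val p) = s' by rewrite last_map -ls.
  apply: (IH f') => //.
    move=> x xU; case: (r' x xU) => [->|[_]]; first exact: rf.
    by rewrite -(map_cons val) => /mapP[z _ ->]; exact: ltn_ord.
  rewrite ltnS in lem; apply: leq_trans lem.
  have is' : s' != i by apply: contraTneq sm' => ->; lia.
  rewrite (bigD1 i) //= [X in _ < X](bigD1 i) //= -addSn; apply: leq_add.
    have := c' i; rewrite ls' eqxx; have -> : (i == s' :> nat) = false.
      by apply/negbTE; rewrite eq_sym.
    lia.
  apply: leq_sum => j ji; have := c' j; rewrite ls'.
  have -> : (j == i :> nat) = false by apply/negbTE.
  case: (eqVneq (j : nat) s') => [E|_]; last lia.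
  have := sm'; rewrite -E; lia.
pose A := [set x in U | [exists j in K, f x == j]].
pose B := U :\: A.
have dAB : [disjoint A & B] by apply/pred0P => x /=; rewrite [x \in B]in_setD; case: (x \in A).
have AB : A :|: B = U.
  by apply/setP => x; rewrite !inE; case: (x \in U); rewrite ?andbF //= andbT orbN.
have degB y : y \in B -> #|K| <= deg e y A.
  move=> yB; rewrite cardE -(size_map val).
  apply: (@deg_colors e f).
    by rewrite map_inj_uniq ?enum_uniq //; apply: val_inj.
  move=> _ /mapP[j jK ->]; rewrite mem_enum in jK.
  have yU : y \in U by move: yB; rewrite inE => /andP[].
  have := yB; rewrite !inE yU andbT /=; move/negP => nyA.
  case: (boolP [exists v in U, e y v && (f v == j)]) => [/exists_inP[v vU /andP[eyv /eqP fv]]|].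
    exists v; split=> //; rewrite inE vU; apply/exists_inP; exists j => //; exact/eqP.
  rewrite negb_exists_in => /forall_inP H; case: nyA; apply/exists_inP.
  exists (Ordinal (rf y yU)) => //; rewrite inE.
  move: jK; rewrite inE => /existsP[s1 /andP[sm1 cn1]]; apply/existsP; exists s1; rewrite sm1 /=.
  apply: connect_trans cn1; apply: connect1; apply/exists_inP; exists y => //; rewrite eqxx /=.
  by apply/forall_inP => v /H; case: (e y v).
have Kt j : j \in K = false -> t <= #|cls f U j|.
  rewrite inE => jK; rewrite leqNgt; apply/negP => jt; case/negP: (negbT jK).
  by apply/existsP; exists j; rewrite jt connect0.
have cA : #|A| <= \sum_(j in K) #|cls f U j|.
  have sA : A \subset \bigcup_(j in K) cls f U j.
    apply/subsetP => x; rewrite inE => /andP[xU /exists_inP[j jK fx]].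
    by apply/bigcupP; exists j => //; rewrite inE xU.
  apply: leq_trans (subset_leq_card sA) _.
  elim/big_ind2: _ => [|m1 A1 m2 A2 h1 h2|//]; first by rewrite cards0.
  by apply: leq_trans (leq_card_setU _ _) _; apply: leq_add.
have cB : #|~: K| * t < #|B|.
  have : \sum_(j in ~: K) t < \sum_(j in ~: K) #|cls f U j|.
    have iK' : i \in ~: K by rewrite in_setC.
    rewrite (bigD1 i) //= [X in _ < X](bigD1 i) //= -addSn; apply: leq_add => //.
    by apply: leq_sum => j; rewrite in_setC => /andP[/negbTE jK _]; apply: Kt.
  rewrite sum_nat_const => h; apply: leq_trans h _.
  have : #|U| = #|A| + #|B| by rewrite -AB -cardsUI (disjoint_setI0 dAB) cards0 addn0.
  have : \sum_(j < b) #|cls f U j| = \sum_(j in K) #|cls f U j| + \sum_(j in ~: K) #|cls f U j|.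
    rewrite (bigID (mem K)) /=; congr addn; apply: eq_bigl => j; by rewrite in_setC.
  lia.
have K0 : 0 < #|K|.
  by apply/card_gt0P; exists s; rewrite inE; apply/existsP; exists s; rewrite sm connect0.
have K1 : 0 < #|~: K| by apply/card_gt0P; exists i; rewrite in_setC.
have Kb : #|K| + #|~: K| = b by rewrite cardsC card_ord.
have E1 : #|K| * #|B| <= nE e B A by apply: sum_ge.
have := nE_ge_cut sym dAB; rewrite AB.
(* Two positive numbers with sum [b] have product at least [b - 1], and [B] has more than
   [#|~: K| * t] vertices because one of its classes is overfull. *)
have : b.-1 * t < #|K| * #|B|.
  have : b.-1 <= #|K| * #|~: K| by nia.
  by move: cB; nia.
lia.
Qed.
End Rebalancing.

(** * Colorings that leave one vertex uncolored *)

Section BlockedColorings.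
Variables (T : finType).
Implicit Types (e : rel T) (A B N S U V W : {set T}) (f g : T -> nat).

Definition del e x y : rel T :=
  fun u v => e u v && ~~ ((u == x) && (v == y) || (u == y) && (v == x)).

(* [x] is uncolored; [N] is the class with one vertex missing; the set of the
   classes [N], [W1], [W] from which vertices can be moved, step by step, into
   [N] is closed, so every other vertex sees each of them.  They are at most
   three because [x], of degree at most 3, sees them too. *)
Inductive blocked e U b t : Prop :=
| Blocked1 N x of N \subset U & indep e N & #|N|.+1 = t
    & (forall y, y \in U :\: N -> 0 < deg e y N)
    & x \in U :\: N & deg e x U <= 3 & balanced e ((U :\: N) :\ x) (b - 1) t
| Blocked2 N W u x of N :|: W \subset U & [disjoint N & W] & indep e N & indep e W
    & #|N|.+1 = t & #|W| = t & u \in W & deg e u N = 0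
    & (forall y, y \in U :\: (N :|: W) -> 0 < deg e y N /\ 0 < deg e y W)
    & x \in U :\: (N :|: W) & deg e x U <= 3 & balanced e ((U :\: (N :|: W)) :\ x) (b - 2) t
| Blocked3 N W1 W z u x of N :|: W1 :|: W \subset U
    & [disjoint N & W1] & [disjoint N & W] & [disjoint W1 & W]
    & indep e N & indep e W1 & indep e W
    & #|N|.+1 = t & #|W1| = t & #|W| = t & z \in W1 & deg e z N = 0
    & u \in W & deg e u N = 0 \/ deg e u W1 = 0
    & (forall y, y \in U :\: (N :|: W1 :|: W) ->
         [/\ 0 < deg e y N, 0 < deg e y W1 & 0 < deg e y W])
    & x \in U :\: (N :|: W1 :|: W) & deg e x U <= 3
    & balanced e ((U :\: (N :|: W1 :|: W)) :\ x) (b - 3) t.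

Lemma cls_add f U x i k : x \in U ->
  #|cls (fun v => if v == x then i else f v) U k| = #|cls f (U :\ x) k| + (k == i).
Proof.
move=> xU; set g := fun v => _.
rewrite (cardsD1 x) !inE xU /g eqxx /= addnC (eq_sym i); congr (_ + _).
by apply: eq_card => v; rewrite !inE; case: (v == x).
Qed.

Lemma cls_del f U x k : x \in U ->
  #|cls f (U :\ x) k| + (k == f x) = #|cls f U k|.
Proof.
move=> xU; rewrite [RHS](cardsD1 x) !inE xU /= addnC (eq_sym k); congr (_ + _).
by apply: eq_card => v; rewrite !inE andbA.
Qed.

Lemma indep_cls e f V i : proper e f V -> indep e (cls f V i).
Proof.
move=> pf x y; rewrite !inE => /andP[xV /eqP fx] /andP[yV /eqP fy].
by apply/negP => /(pf _ _ xV yV); rewrite fx fy eqxx.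
Qed.

(** A balanced coloring found after deleting an edge [xy] must give both ends the same color, since
    otherwise it would be proper for [e]. Uncoloring [x] makes it proper and leaves the class of [x]
    one vertex short; this class is [N]. *)
Lemma blockedP e U b t : symmetric e -> irreflexive e -> degenerate e ->
  4 <= b -> #|U| = b * t ->
  (forall x y, x \in U -> y \in U -> e x y -> balanced (del e x y) U b t) ->
  ~ balanced e U b t -> blocked e U b t.
Proof.
move=> sym irr dgn b4 cU IH nbal.
(* Isolated vertices are set aside so that the vertex of low degree chosen in [S] has an edge to
   delete. *)
pose S := [set v in U | 0 < deg e v U].
have sSU : S \subset U by apply/subsetP => v; rewrite inE => /andP[].
case: (eqVneq S set0) => [S0|S0].
  case: nbal; apply: few_edges_balanced => //; first exact: degenerate_colorable.
  suff -> : nE e U U = 0 by [].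
  apply/eqP; rewrite sum_nat_eq0; apply/forall_inP => v vU.
  have : v \notin S by rewrite S0 inE.
  by rewrite inE vU -leqNgt leqn0.
have [x xS dxS] := dgn S S0.
have xU : x \in U by apply: (subsetP sSU).
have dx : deg e x U <= 3.
  apply: leq_trans dxS; rewrite !degE; apply: subset_leq_card; apply/subsetP => v.
  rewrite !inE => /andP[vU exv]; rewrite vU exv andbT /=.
  by apply/deg_gt0P; exists x => //; rewrite sym.
move: (xS); rewrite inE => /andP[_ /deg_gt0P[y yU exy]].
have [f [rf pf cf]] := IH x y xU yU exy.
have fxy : f x = f y.
  apply/eqP; apply/negP => nfxy; apply: nbal; exists f; split=> // u v uU vU euv.
  case: (boolP (del e x y u v)) => [/(pf _ _ uU vU)//|].
  rewrite /del euv /= negbK => /orP[/andP[/eqP-> /eqP->]|/andP[/eqP-> /eqP->]]; first exact/negP.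
  by rewrite eq_sym; apply/negP.
pose V := U :\ x; pose i0 := f x.
have i0b : i0 < b by apply: rf.
have VU v : v \in V -> v \in U by rewrite inE => /andP[].
have pfV : proper e f V.
  move=> u v uV vV euv; apply: pf; rewrite ?VU // /del euv /=.
  by move: uV vV; rewrite !inE => /andP[/negbTE-> _] /andP[/negbTE-> _]; rewrite !andbF.
have cV k : k < b -> #|cls f V k| + (k == i0) = t by move=> kb; rewrite cls_del // cf.
(* If [x] had no neighbor of color [i], a shift along the path would fill the gap in class [i0] and
   make room for [x] in class [i]. *)
have float i p : i < b -> path (moves e V f) i p -> uniq (i :: p) -> last i p = i0 ->
    all (fun j => j < b) p -> exists2 v, v \in V & e x v /\ f v = i.
  move=> ib pth up lp pb.
  case: (boolP [exists v in V, e x v && (f v == i)]) => [/exists_inP[v vV /andP[xv /eqP fv]]|].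
    by exists v.
  rewrite negb_exists_in => /forall_inP H; case: nbal.
  have [f' [pf' c' r' s']] := shift sym irr pfV pth up.
  have xf' v : v \in V -> e x v -> f' v != i.
    move=> vV exv; apply/eqP => /(s' v vV) fv.
    by have := H v vV; rewrite exv fv eqxx.
  have inV v : v \in U -> v != x -> v \in V by move=> vU vx; rewrite !inE vx vU.
  exists (fun v => if v == x then i else f' v); split.
  - move=> v vU; case: (eqVneq v x) => // vx; case: (r' v (inV _ vU vx)) => [->|[_]]; first exact: rf.
    by rewrite inE => /orP[/eqP->//|]; move/(allP pb).
  - move=> u v uU vU; case: (eqVneq u x) => [->|ux]; case: (eqVneq v x) => [->|vx].
    + by rewrite irr.
    + by move/(xf' v (inV _ vU vx)); rewrite eq_sym.
    + by rewrite sym; move/(xf' u (inV _ uU ux)).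
    + by apply: pf'; apply: inV.
  - by move=> k kb; rewrite cls_add // c' lp; apply: cV.
have nmv y' k : y' \in V -> ~~ moves e V f (f y') k -> 0 < deg e y' (cls f V k).
  move=> yV; rewrite negb_exists_in => /forall_inP/(_ y' yV); rewrite eqxx /=.
  rewrite negb_forall_in => /existsP[v /andP[vV]]; rewrite negb_imply negbK => /andP[ev fv].
  by apply/deg_gt0P; exists v => //; rewrite inE vV.
have sx k : (exists2 v, v \in V & e x v /\ f v = k) -> 0 < deg e x (cls f V k).
  by case=> v vV [xv fv]; apply/deg_gt0P; exists v => //; rewrite inE vV fv /=.
pose A (K : seq nat) := [set v in V | f v \in K].
have AK K : A K \subset U by apply/subsetP => v; rewrite inE => /andP[/VU].
have xA K : x \in U :\: A K by rewrite !inE eqxx xU.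
have rest K : uniq K -> all (fun j => j < b) K -> i0 \in K ->
    balanced e ((U :\: A K) :\ x) (b - size K) t.
  move=> uK bK i0K.
  pose K' := [seq k <- iota 0 b | k \notin K].
  have sK' : size K' = b - size K.
    have -> : size K = count (mem K) (iota 0 b).
      rewrite -size_filter; apply: perm_size; apply: uniq_perm => //.
        by rewrite filter_uniq // iota_uniq.
      move=> k; rewrite mem_filter mem_iota /= add0n.
      by case: (boolP (k \in K)) => //= /(allP bK).
    by rewrite size_filter -{2}(size_iota 0 b) -(count_predC (mem K)) addKn.
  rewrite -sK'; have inW v : v \in (U :\: A K) :\ x -> v \in V /\ f v \notin K.
    rewrite !inE => /andP[vx /andP[]]; rewrite vx /= => H vU; rewrite vU; split=> //.
    by apply: contra H => ->; rewrite vU.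
  apply: (@balanced_relabel _ e _ f).
  - by rewrite filter_uniq // iota_uniq.
  - by move=> v /inW[vV fv]; rewrite mem_filter fv mem_iota /=; apply/rf/VU.
  - by move=> u v /inW[uV _] /inW[vV _]; apply: pfV.
  - move=> i; rewrite mem_filter mem_iota /= add0n => /andP[iK ib].
    rewrite -(cV i ib); have -> : (i == i0) = false by apply: contraNF iK => /eqP->.
    rewrite addn0; apply: eq_card => v; rewrite !inE.
    case: (eqVneq v x) => //= _; case: (v \in U) => //=; rewrite ?andbF ?andbT //.
    by case: eqP => [->|]; rewrite ?andbF ?iK.
have notA K y' : y' \in U :\: A K -> y' != x -> y' \in V /\ f y' \notin K.
  rewrite !inE => /andP[H yU'] yx; rewrite yx yU' /= in H *; split=> //.
have s0 : 0 < deg e x (cls f V i0) by apply/sx/(float i0 [::]).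
have A1 : A [:: i0] = cls f V i0 by apply/setP => v; rewrite !inE.
have cN : #|cls f V i0|.+1 = t by rewrite -(cV i0 i0b) eqxx addn1.
case: (boolP [exists j : 'I_b, (j != i0 :> nat) && moves e V f j i0]); last first.
  rewrite negb_exists => /forallP H.
  apply: (@Blocked1 e U b t (A [:: i0]) x) => //.
  - by rewrite A1; apply: indep_cls.
  - by rewrite A1.
  - move=> y' yB; rewrite A1; case: (eqVneq y' x) => [->//|yx].
    have [yV fy] := notA _ _ yB yx; apply: nmv => //.
    have := H (Ordinal (rf _ (VU _ yV))); rewrite /= negb_and negbK => /orP[/eqP E|//].
    by rewrite inE E eqxx in fy.
  - by apply: (rest [:: i0]) => //=; rewrite ?i0b // inE eqxx.
case/existsP => [[j jb] /= /andP[ji0 mj]].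
have s1 : 0 < deg e x (cls f V j).
  by apply/sx/(float j [:: i0]) => //=; rewrite ?mj ?inE ?ji0 ?i0b.
have A2 : A [:: i0; j] = cls f V i0 :|: cls f V j.
  by apply/setP => v; rewrite !inE andb_orr.
have dcls k k' : k != k' -> [disjoint cls f V k & cls f V k'].
  move=> kk; apply/pred0P => v /=; rewrite !inE.
  by case: (f v =P k) => [->|]; rewrite ?(negbTE kk) ?andbF.
have cW k : k < b -> k != i0 -> #|cls f V k| = t.
  by move=> kb /negbTE ki; rewrite -(cV k kb) ki addn0.
have [z zW dz] : exists2 z, z \in cls f V j & deg e z (cls f V i0) = 0.
  case/exists_inP: mj => z zV /andP[fz /forall_inP H]; exists z; first by rewrite inE zV.
  apply/eqP/deg0P => v; rewrite inE => /andP[vV fv].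
  by have := H v vV; case: (e z v) => //=; rewrite fv.
have i0j : i0 != j by rewrite eq_sym.
case: (boolP [exists l : 'I_b, ((l : nat) \notin [:: i0; j]) && (moves e V f l i0 || moves e V f l j)]); last first.
  rewrite negb_exists => /forallP H.
  apply: (@Blocked2 e U b t (cls f V i0) (cls f V j) z x); rewrite -?A2 //.
  - exact: dcls.
  - exact: indep_cls.
  - exact: indep_cls.
  - by rewrite cW.
  - move=> y' yB; case: (eqVneq y' x) => [->//|yx].
    have [yV fy] := notA _ _ yB yx.
    have := H (Ordinal (rf _ (VU _ yV))); rewrite /= fy /= negb_or => /andP[h1 h2].
    by split; apply: nmv.
  - by apply: (rest [:: i0; j]) => //=; rewrite ?i0b ?jb // !inE ?i0j ?eqxx.
case/existsP => [[l lb] /= /andP[]]; rewrite !inE negb_or => /andP[li0 lj] ml.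
have ll p : path (moves e V f) l p -> all (fun j => j < b) p -> uniq (l :: p) -> last l p = i0 ->
  0 < deg e x (cls f V l) by move=> *; apply/sx/(float l p).
have [pl [pl1 pl2 pl3 pl4]] : exists p, [/\ path (moves e V f) l p, last l p = i0,
     uniq (l :: p) & {subset p <= [:: i0; j]}].
  case/orP: ml => ml.
    exists [:: i0]; rewrite /= ml !inE li0; split=> // k; rewrite !inE => ->//.
  exists [:: j; i0]; rewrite /= ml mj !inE !negb_or li0 lj ji0; split=> // k.
  by rewrite !inE orbC.
have plb : all (fun j => j < b) pl.
  by apply/allP => k /pl4; rewrite !inE => /orP[]/eqP->.
have s2 := ll pl pl1 plb pl3 pl2.
have A3 : A [:: i0; j; l] = cls f V i0 :|: cls f V j :|: cls f V l.
  by apply/setP => v; rewrite !inE !andb_orr orbA.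
have [u uW du] : exists2 u, u \in cls f V l &
    deg e u (cls f V i0) = 0 \/ deg e u (cls f V j) = 0.
  have mvd k : moves e V f l k -> exists2 u, u \in cls f V l & deg e u (cls f V k) = 0.
    case/exists_inP => u uV /andP[fu /forall_inP H]; exists u; first by rewrite inE uV.
    apply/eqP/deg0P => v; rewrite inE => /andP[vV fv].
    by have := H v vV; case: (e u v) => //=; rewrite fv.
  by case/orP: ml => /mvd[u uW du]; exists u => //; [left|right].
apply: (@Blocked3 e U b t (cls f V i0) (cls f V j) (cls f V l) z u x); rewrite -?A3 //.
- exact: dcls.
- by apply: dcls; rewrite eq_sym.
- by apply: dcls; rewrite eq_sym.
- exact: indep_cls.
- exact: indep_cls.
- exact: indep_cls.
- by rewrite cW.
- by rewrite cW.
- move=> y' yB; case: (eqVneq y' x) => [->//|yx].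
  have [yV fy] := notA _ _ yB yx.
  (* a fourth color with a move to these three would also be seen by [x] *)
  have nosee k : k \in [:: i0; j; l] -> ~~ moves e V f (f y') k.
    move=> kK; apply/negP => mk.
    have [q [q1 q2 q3 q4]] : exists q, [/\ path (moves e V f) k q, last k q = i0,
        uniq (k :: q) & {subset k :: q <= [:: i0; j; l]}].
      move: kK; rewrite !inE => /or3P[]/eqP->.
      - by exists [::]; split=> // a; rewrite !inE => ->.
      - exists [:: i0]; rewrite /= mj !inE ji0; split=> // a; rewrite !inE orbCA.
        by move=> /orP[]->; rewrite ?orbT.
      - exists pl; split=> // a; rewrite inE => /orP[/eqP->|/pl4]; rewrite !inE ?eqxx ?orbT //.
        by case/orP => ->; rewrite ?orbT.
    have qb : all (fun j => j < b) (k :: q).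
      by apply/allP => a /q4; rewrite !inE => /or3P[]/eqP->.
    have uq : uniq (f y' :: k :: q).
      by rewrite cons_uniq q3 andbT; apply: contra fy; apply: q4.
    have [v vV [xv fv]] := float (f y') (k :: q) (rf _ (VU _ yV)) (introT andP (conj mk q1)) uq q2 qb.
    have : size [:: f y'; i0; j; l] <= deg e x U.
      apply: (@deg_colors _ e f).
        by rewrite cons_uniq fy /= !inE !negb_or i0j (eq_sym i0) li0 eq_sym lj.
      move=> a; rewrite inE => /orP[/eqP->|]; first by exists v; split=> //; apply: VU.
      have gt v' : 0 < deg e x (cls f V v') -> exists v, [/\ v \in U, e x v & f v = v'].
        by case/deg_gt0P => w; rewrite inE => /andP[wV /eqP fw] ew; exists w; split=> //; apply: VU.
      by rewrite !inE => /or3P[]/eqP->; apply: gt.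
    by move=> /leq_trans/(_ dx).
  by split; apply: nmv => //; apply: nosee; rewrite !inE eqxx ?orbT.
- apply: (rest [:: i0; j; l]) => //=; rewrite ?i0b ?jb ?lb // ?inE ?eqxx //.
  by rewrite !negb_or i0j (eq_sym i0) li0 eq_sym lj.
Qed.

End BlockedColorings.

(** * Solo neighbors and exchanges *)

Section SoloNeighbors.
Variables (T : finType).
Implicit Types (e : rel T) (A B N S U V W : {set T}) (f g : T -> nat).

Definition triangle_free e := forall x y z, e x y -> e y z -> e x z -> False.

(** Of sparsity only 3-degeneracy is kept here, since it passes easily to the graphs with a deleted
    edge and to the padded graph; edge counts enter each stage as separate hypotheses. *)
Definition tfgraph e := [/\ symmetric e, irreflexive e, degenerate e & triangle_free e].

Lemma deg_mono e e' x S : (forall u v, e' u v -> e u v) -> deg e' x S <= deg e x S.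
Proof. by move=> H; apply: leq_sum => y _; have := H x y; case: (e' x y) => //= ->. Qed.

Lemma nE_mono e e' A B : (forall u v, e' u v -> e u v) -> nE e' A B <= nE e A B.
Proof. by move=> H; apply: leq_sum => y _; apply: deg_mono. Qed.

Lemma del_sub e x y u v : del e x y u v -> e u v.
Proof. by case/andP. Qed.

Lemma del_tfgraph e x y : tfgraph e -> tfgraph (del e x y).
Proof.
case=> sym irr dg tf; split.
- move=> u v; rewrite /del sym orbC; congr (_ && ~~ _).
  by rewrite andbC; congr (_ || _); rewrite andbC.
- by move=> u; rewrite /del irr.
- move=> S /dg[v vS dv]; exists v => //; apply: leq_trans dv; apply: deg_mono; exact: del_sub.
- by move=> u v w /del_sub uv /del_sub vw /del_sub; apply: tf uv vw.
Qed.

Lemma nE_del e x y U : x \in U -> y \in U -> e x y -> nE (del e x y) U U < nE e U U.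
Proof.
move=> xU yU exy; rewrite /nE (bigD1 x) //= [X in _ < X](bigD1 x) //= -addSn; apply: leq_add.
  rewrite /deg (bigD1 y) //= [X in _ < X](bigD1 y) //= -addSn; apply: leq_add.
    by rewrite /del !eqxx exy.
  by apply: leq_sum => v _; rewrite /del; case: (e x v); rewrite // leq_b1.
by apply: leq_sum => v _; apply: deg_mono; exact: del_sub.
Qed.

(** This packages the edge-minimal counterexample. The hypotheses [P] only have to survive edge
    deletion, so the same argument serves every stage. *)
Lemma edge_induction (P : rel T -> Prop) U b t :
  (forall e, P e -> tfgraph e) ->
  (forall e x y, P e -> P (del e x y)) ->
  4 <= b -> #|U| = b * t ->
  (forall e, P e -> blocked e U b t -> balanced e U b t) ->
  forall e, P e -> balanced e U b t.
Proof.
move=> tfP delP b4 cU H e; have [m] := ubnP (nE e U U); elim: m e => // m IH e lem Pe.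
case: (boolp.EM (balanced e U b t)) => // ng; apply: (H) => //.
have [sym irr dg _] := tfP e Pe; apply: blockedP => // x y xU yU exy.
apply: IH; last exact: delP.
by apply: leq_trans (nE_del xU yU exy) _.
Qed.

(* The neighbors of [w] in [B] that can replace [w] in [W]. *)
Definition solos e B W w := [set y in B | (deg e y W == 1) && e w y].

(** A vertex of [B] with a single neighbor in [W] sends one edge and is a solo neighbor of exactly
    one [w]; any other sends at least two edges. Either way it contributes at least 2. *)
Lemma solo_sum e B W : symmetric e -> (forall y, y \in B -> 0 < deg e y W) ->
  2 * #|B| <= nE e B W + \sum_(w in W) #|solos e B W w|.
Proof.
move=> sym pos.
have -> : \sum_(w in W) #|solos e B W w| = \sum_(y in B) (deg e y W == 1).
  rewrite (eq_bigr (fun w => \sum_(y in B) ((deg e y W == 1) && e w y : nat))); last first.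
    move=> w _; rewrite -sum1_card big_mkcond [RHS]big_mkcond /=; apply: eq_bigr => y _.
    by rewrite !inE; case: (y \in B) => //=; case: (_ && _).
  rewrite exchange_big /=; apply: eq_bigr => y _.
  case: (eqVneq (deg e y W) 1) => [d1|_] /=; last by rewrite big1.
  by rewrite -[RHS]d1; apply: eq_bigr => w _; rewrite sym.
rewrite /nE -big_split /=; apply: sum_ge => y /pos; case: eqP; lia.
Qed.

Lemma solos_le e B W w : #|solos e B W w| <= deg e w B.
Proof.
rewrite degE; apply: subset_leq_card; apply/subsetP => y.
by rewrite !inE => /and3P[-> _ ->].
Qed.

Lemma solo_uniq e B W w y v : symmetric e -> w \in W -> y \in solos e B W w -> v \in W ->
  e y v -> v = w.
Proof.
move=> sym wW; rewrite inE => /and3P[yB /eqP d1 ewy] vW eyv.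
apply/eqP; apply: contraTT isT => vw; move: d1.
rewrite /deg (bigD1 w) //= (bigD1 v) /=; last by rewrite vW.
by rewrite sym ewy eyv; lia.
Qed.

Lemma pigeon (F G : T -> nat) W : \sum_(w in W) G w < \sum_(w in W) F w ->
  exists2 w, w \in W & G w < F w.
Proof.
move=> lt; case: (boolP [exists w in W, G w < F w]) => [/exists_inP[w]|]; first by exists w.
rewrite negb_exists_in => /forall_inP H; exfalso; move: lt; rewrite ltnNge => /negP; apply.
by apply: leq_sum => w /H; rewrite -leqNgt.
Qed.

Lemma two_solos e B W w : 1 < #|solos e B W w| ->
  exists y1 y2, [/\ y1 \in solos e B W w, y2 \in solos e B W w & y1 != y2].
Proof. by case/card_gt1P => y1 [y2 [h1 h2 h3]]; exists y1, y2. Qed.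

Lemma solosB e B W w y : y \in solos e B W w -> y \in B.
Proof. by rewrite inE => /andP[]. Qed.

Lemma solosE e B W w y : y \in solos e B W w -> e w y.
Proof. by rewrite inE => /and3P[]. Qed.

Lemma indep_sub e A B : A \subset B -> indep e B -> indep e A.
Proof. by move=> /subsetP s H x y /s xB /s yB; apply: H. Qed.

Lemma indep_add e x S : symmetric e -> irreflexive e -> indep e S ->
  (forall y, y \in S -> ~~ e x y) -> indep e (x |: S).
Proof.
move=> sym irr iS xS u v; rewrite !inE => /orP[/eqP->|uS] /orP[/eqP->|vS].
- by rewrite irr.
- exact: xS.
- by rewrite sym; apply: xS.
- exact: iS.
Qed.

Lemma indep_solo e B W w y (X : {set T}) : tfgraph e -> indep e W -> w \in W -> y \in solos e B W w ->
  X \subset W :\ w -> indep e (y |: X).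
Proof.
move=> [sym irr _ _] iW wW ys /subsetP XW; apply: indep_add => //.
  by apply: indep_sub iW; apply/subsetP => x /XW; rewrite inE => /andP[].
move=> v /XW; rewrite !inE => /andP[vw vW]; apply/negP => /(solo_uniq sym wW ys vW) E.
by rewrite E eqxx in vw.
Qed.

(* Triangle-freeness makes the two new vertices, both adjacent to [w], non-adjacent. *)
Lemma indep_solos e B W w y1 y2 (X : {set T}) : tfgraph e -> indep e W -> w \in W ->
  y1 \in solos e B W w -> y2 \in solos e B W w -> X \subset W :\ w ->
  indep e (y1 |: (y2 |: X)).
Proof.
move=> tfg iW wW s1 s2 XW; have [sym irr _ tf] := tfg; apply: indep_add => //.
  exact: indep_solo s2 XW.
move=> v; rewrite inE => /orP[/set1P->|vX]; apply/negP => ev.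
  by apply: (tf w y1 y2) => //; [apply: solosE s1|apply: solosE s2].
have /setD1P[vw vW] := subsetP XW v vX.
by rewrite (solo_uniq sym wW s1 vW ev) eqxx in vw.
Qed.

Lemma balanced_cast e A B n m t : A = B -> n = m -> balanced e A n t -> balanced e B m t.
Proof. by move=> -> ->. Qed.

(* Exchanging [w] for two of its solo neighbors enlarges its class by one, so it
   only remains to color what is left of [B] together with [w]. *)
Lemma balanced_exchange_small e U N c y1 y2 b t : tfgraph e -> N \subset U -> indep e N -> #|N|.+1 = t ->
  c \in N -> y1 \in solos e (U :\: N) N c -> y2 \in solos e (U :\: N) N c -> y1 != y2 ->
  0 < b -> balanced e (c |: ((U :\: N) :\ y1) :\ y2) (b - 1) t -> balanced e U b t.
Proof.
move=> tfg NU iN cN cc s1 s2 y12 b0 gH.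
have /setDP[y1U y1N] := solosB s1; have /setDP[y2U y2N] := solosB s2.
have g1 : balanced e (y1 |: (y2 |: (N :\ c))) 1 t.
  apply: balanced1; first exact: indep_solos s1 s2 _.
  rewrite !cardsU1 !inE (negbTE y12) (negbTE y1N) (negbTE y2N) !andbF /=.
  by move: cN; rewrite (cardsD1 c N) cc; lia.
have eb : 1 + (b - 1) = b by lia.
apply: (balanced_cast _ eb (balanced_cat _ g1 gH)).
  apply/setP => x; rewrite !inE; case: (eqVneq x y1) => [->|x1]; first by rewrite y1U.
  case: (eqVneq x y2) => [->|x2]; first by rewrite y2U.
  case: (eqVneq x c) => [->|xc] /=; first by rewrite (subsetP NU).
  by case xN: (x \in N) => //=; rewrite (subsetP NU).
apply/pred0P => x /=; rewrite !inE.
case: (eqVneq x y1) => [->|x1] /=.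
  by rewrite ?andbF ?orbF /=; apply/negbTE; apply: contraNneq y1N => ->.
case: (eqVneq x y2) => [->|x2] /=; first by rewrite ?andbF ?orbF /=; apply/negbTE; apply: contraNneq y2N => ->.
by case: (eqVneq x c) => //= _; case: (x \in N).
Qed.

Section Exchange.
Variables (e : rel T) (U A0 W : {set T}) (n1 n2 t : nat).
Hypotheses (tfg : tfgraph e) (AWU : A0 :|: W \subset U) (dAW : [disjoint A0 & W])
  (iW : indep e W) (cW : #|W| = t).
Let B := U :\: (A0 :|: W).

(** The vertex [u] completes the accessible part [A0]. The class [W] loses [u] and [w] and gains two
    solo neighbors of [w], so it keeps its size. *)
Lemma balanced_exchange u w y1 y2 : u \in W -> u != w -> balanced e (u |: A0) n1 t -> w \in W ->
  y1 \in solos e B W w -> y2 \in solos e B W w -> y1 != y2 ->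
  balanced e (w |: (B :\ y1) :\ y2) n2 t -> balanced e U (n1 + 1 + n2) t.
Proof.
move=> uW uw gA wW s1 s2 y12 gH.
have := solosB s1; rewrite !inE negb_or => /andP[/andP[y1A y1W] y1U].
have := solosB s2; rewrite !inE negb_or => /andP[/andP[y2A y2W] y2U].
have AU x : x \in A0 -> x \in U by move=> xA; apply: (subsetP AWU); rewrite inE xA.
have WU x : x \in W -> x \in U by move=> xW; apply: (subsetP AWU); rewrite inE xW orbT.
have AW x : x \in W -> (x \in A0) = false by apply: disjointFl.
have g1 : balanced e (y1 |: (y2 |: ((W :\ w) :\ u))) 1 t.
  apply: balanced1; first by apply: indep_solos s1 s2 _ => //; apply: subD1set.
  rewrite !cardsU1 !inE (negbTE y12) (negbTE y1W) (negbTE y2W) !andbF /=.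
  by move: cW; rewrite (cardsD1 w W) wW (cardsD1 u (W :\ w)) !inE uw uW; clear; lia.
have g2 : balanced e ((u |: A0) :|: (y1 |: (y2 |: ((W :\ w) :\ u)))) (n1 + 1) t.
  apply: balanced_cat => //; apply/pred0P => x /=; rewrite !inE.
  case: (eqVneq x u) => [->|xu] /=.
    rewrite !orbF; apply/negbTE; rewrite negb_or.
    by apply/andP; split; apply: contraTneq uW => ->.
  case xA: (x \in A0) => //=; rewrite (disjointFr dAW xA) !andbF orbF.
  by apply/negbTE; rewrite negb_or; apply/andP; split; apply: contraTneq xA => ->.
apply: balanced_cast (balanced_cat _ g2 gH) => //.
  apply/setP => x; rewrite !inE; case: (eqVneq x y1) => [->|x1]; first by rewrite y1U !orbT.
  case: (eqVneq x y2) => [->|x2]; first by rewrite y2U !orbT.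
  case: (eqVneq x w) => [->|xw] /=; first by rewrite (WU w) ?orbT.
  case: (eqVneq x u) => [->|xu] /=; first by rewrite (WU u).
  case xA: (x \in A0) => //=; first by rewrite AU.
  by case xW: (x \in W) => //=; rewrite WU.
apply/pred0P => x /=; rewrite !inE.
case: (eqVneq x w) => [->|xw] /=.
  rewrite (eq_sym w u) (negbTE uw) (AW w wW) /= orbF.
  by rewrite andbT; apply/negbTE; rewrite negb_or; apply/andP; split; apply: contraTneq wW => ->.
case: (eqVneq x y1) => [->|x1] /=; first by rewrite andbF andbF.
case: (eqVneq x y2) => [->|x2] /=; first by rewrite andbF.
case: (eqVneq x u) => [->|xu] /=; first by rewrite uW orbT.
by case: (x \in A0) => //=; case: (x \in W).
Qed.

(** Here [w] itself completes [A0], and [y], which has no other neighbor in [W], takes its place. In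
    a counterexample a vertex that can move thus has no solo neighbor [y], as soon as [B :\ y] can
    be colored. *)
Lemma balanced_move w y : w \in W -> balanced e (w |: A0) n1 t -> y \in solos e B W w ->
  balanced e (B :\ y) n2 t -> balanced e U (n1 + 1 + n2) t.
Proof.
move=> wW gA s1 gB.
have := solosB s1; rewrite !inE negb_or => /andP[/andP[yA yW] yU].
have AU x : x \in A0 -> x \in U by move=> xA; apply: (subsetP AWU); rewrite inE xA.
have WU x : x \in W -> x \in U by move=> xW; apply: (subsetP AWU); rewrite inE xW orbT.
have g1 : balanced e (y |: (W :\ w)) 1 t.
  apply: balanced1; first by apply: indep_solo s1 _.
  rewrite cardsU1 !inE (negbTE yW) andbF.
  by move: cW; rewrite (cardsD1 w W) wW; lia.
have g2 : balanced e ((w |: A0) :|: (y |: (W :\ w))) (n1 + 1) t.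
  apply: balanced_cat => //; apply/pred0P => x /=; rewrite !inE.
  case: (eqVneq x w) => [->|xw] /=; first by rewrite orbF; apply: contraTF wW => /eqP->.
  case xA: (x \in A0) => //=; rewrite (disjointFr dAW xA) orbF.
  by apply: contraTF xA => /eqP->.
apply: balanced_cast (balanced_cat _ g2 gB) => //.
  apply/setP => x; rewrite !inE; case: (eqVneq x y) => [->|x1]; first by rewrite yU !orbT.
  case: (eqVneq x w) => [->|xw] /=; first by rewrite (WU w).
  case xA: (x \in A0) => //=; first by rewrite AU.
  by case xW: (x \in W) => //=; rewrite WU.
apply/pred0P => x /=; rewrite !inE.
case: (eqVneq x y) => [->|x1] /=; first by rewrite andbF.
case: (eqVneq x w) => [->|xw] /=; first by rewrite wW orbT.
by case: (x \in A0) => //=; case: (x \in W).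
Qed.

End Exchange.

(** Either [u] joins [N], or it takes the place of [z] in [W] while [z] joins [N]. *)
Lemma balanced_pair e N W z u t : symmetric e -> irreflexive e -> [disjoint N & W] ->
  indep e N -> indep e W -> #|N|.+1 = t -> #|W| = t -> z \in W -> deg e z N = 0 ->
  u \notin N :|: W -> deg e u N = 0 \/ deg e u W = 0 -> balanced e (u |: (N :|: W)) 2 t.
Proof.
move=> sym irr dNW iN iW cN cW zW /eqP/deg0P zN uNW du.
have [uN uW] : u \notin N /\ u \notin W by apply/andP; rewrite -negb_or -in_setU.
have NW x : x \in N -> (x \in W) = false by apply: disjointFr.
case: du => [] /eqP/deg0P du.
  have g1 : balanced e (u |: N) 1 t.
    by apply: balanced1; [apply: indep_add|rewrite cardsU1 uN].
  have g2 : balanced e W 1 t by apply: balanced1.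
  rewrite setUA; apply: (balanced_cat _ g1 g2).
  apply/pred0P => x /=; rewrite !inE; case: eqP => [->|_] /=; first exact/negbTE.
  by case xN: (x \in N) => //=; apply: NW.
have zN' : z \notin N by apply/negP => /NW; rewrite zW.
have g1 : balanced e (z |: N) 1 t.
  by apply: balanced1; [apply: indep_add|rewrite cardsU1 zN'].
have zu : z != u by apply: contraNneq uW => <-.
have g2 : balanced e (u |: (W :\ z)) 1 t.
  apply: balanced1; last by move: cW; rewrite cardsU1 !inE (negbTE uW) andbF (cardsD1 z W) zW; lia.
  apply: indep_add => //; first by apply: indep_sub iW; apply: subD1set.
  by move=> v; rewrite inE => /andP[_]; apply: du.
apply: balanced_cast (balanced_cat _ g1 g2) => //.
  apply/setP => x; rewrite !inE; case: (eqVneq x z) => [->|xz] /=; first by rewrite zW !orbT.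
  by case: (x == u); rewrite ?orbT.
apply/pred0P => x /=; rewrite !inE; case: (eqVneq x z) => [->|xz] /=; first by rewrite orbF; exact/negbTE.
case xN: (x \in N) => //=; rewrite (NW _ xN) orbF; apply: contraTF xN => /eqP->//.
Qed.

Lemma degD1 e x y S : y \in S -> deg e x S = e x y + deg e x (S :\ y).
Proof. by move=> yS; rewrite /deg (big_setD1 y). Qed.

(** Both removed vertices are neighbors of [w], so [w] brings back only [deg e w B - 2] edges, each
    counted twice. *)
Lemma nE_swap e B w y1 y2 : symmetric e -> irreflexive e -> w \notin B ->
  y1 \in B -> y2 \in B -> y1 != y2 -> e w y1 -> e w y2 ->
  nE e (w |: (B :\ y1) :\ y2) (w |: (B :\ y1) :\ y2) + 4 <= nE e B B + 2 * deg e w B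
  /\ deg e w ((B :\ y1) :\ y2) + 2 = deg e w B.
Proof.
move=> sym irr wB y1B y2B y12 e1 e2.
have d : deg e w ((B :\ y1) :\ y2) + 2 = deg e w B.
  rewrite (degD1 e w y1B) (@degD1 e w y2 (B :\ y1)) ?inE ?y2B 1?eq_sym ?y12 // e1 e2; lia.
split=> //; rewrite nE_add1 //; last by rewrite !inE (negbTE wB) !andbF.
have : nE e (B :\ y1 :\ y2) (B :\ y1 :\ y2) <= nE e B B.
  by apply: nE_sub; apply: subset_trans (subD1set _ _) (subD1set _ _).
by move: d; rewrite -!addnn; lia.
Qed.

Lemma card_swap e B W w y1 y2 : w \notin B -> y1 \in solos e B W w -> y2 \in solos e B W w ->
  y1 != y2 -> #|w |: (B :\ y1) :\ y2|.+1 = #|B|.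
Proof.
move=> wB /solosB y1B /solosB y2B y12.
by rewrite cardsU1 !inE (negbTE wB) !andbF (cardsD1 y1 B) y1B (cardsD1 y2 (B :\ y1)) !inE eq_sym y12 y2B.
Qed.

Lemma colorable_new e c S n : symmetric e -> irreflexive e -> colorable e S n ->
  colorable e (c |: S) n.+1.
Proof.
move=> sym irr [f [f1 f2]]; exists (fun x => if x == c then n else f x); split.
  by move=> x; rewrite !inE; case: eqP => //= _ /f1; lia.
move=> x y; rewrite !inE; case: (eqVneq x c) => [->|xc]; case: (eqVneq y c) => [->|yc] //=.
- by rewrite irr.
- by move=> _ /f1; rewrite neq_ltn orbC => ->.
- by move=> /f1; rewrite neq_ltn => ->.
- exact: f2.
Qed.

Lemma nE_le2_colorable e B : symmetric e -> irreflexive e -> nE e B B <= 2 -> colorable e B 2.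
Proof.
move=> sym irr le2; case: (boolP [exists p in B, 0 < deg e p B]) => [/exists_inP[p pB dp]|].
  have pS : p \notin B :\ p by rewrite !inE eqxx.
  have dE : deg e p (B :\ p) = deg e p B by rewrite (degD1 e p pB) irr.
  have := nE_add1 sym irr pS; rewrite setD1K // dE -addnn => E.
  rewrite -(setD1K pB); apply: colorable_add => //; last by rewrite dE; lia.
  have : nE e (B :\ p) (B :\ p) == 0 by lia.
  rewrite sum_nat_eq0 => /forall_inP H; exists (fun=> 0); split=> // x y xB yB exy.
  by have /deg0P/(_ y yB) := H x xB; rewrite exy.
rewrite negb_exists_in => /forall_inP H; exists (fun=> 0); split=> // x y xB yB exy.
by have /deg_gt0P := H x xB; case; exists y.
Qed.

End SoloNeighbors.

(** * Three accessible classes, and four colors with few edges *)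

Section FourColors.
Variables (T : finType).
Implicit Types (e : rel T) (A B N S U V W : {set T}) (f g : T -> nat).

Lemma setUDK A U : A \subset U -> A :|: (U :\: A) = U.
Proof. by move=> /setIidPr {1}<-; rewrite setID. Qed.

Lemma disjD A U : [disjoint A & U :\: A].
Proof. by apply/pred0P => x /=; rewrite inE; case: (x \in A). Qed.

Lemma nE_cut e A U : symmetric e -> A \subset U ->
  nE e U U = nE e A A + nE e (U :\: A) (U :\: A) + 2 * nE e (U :\: A) A.
Proof. by move=> sym s; rewrite -{1 2}(setUDK s) nEU ?disjD // mul2n. Qed.

Lemma deg_cut e x A U : A \subset U -> deg e x U = deg e x A + deg e x (U :\: A).
Proof. by move=> s; rewrite -{1}(setUDK s) degU ?disjD. Qed.

Lemma card_cut A U : A \subset U -> #|U :\: A| + #|A| = #|U|.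
Proof. by move=> s; rewrite addnC -(setUDK s) cardsU (disjoint_setI0 (disjD _ _)) cards0 subn0 setUDK. Qed.

Lemma card_disjU A B : [disjoint A & B] -> #|A :|: B| = #|A| + #|B|.
Proof. by move=> d; rewrite cardsU (disjoint_setI0 d) cards0 subn0. Qed.

Lemma nEUr e A B S : [disjoint A & B] -> nE e S (A :|: B) = nE e S A + nE e S B.
Proof. by move=> d; rewrite /nE -big_split; apply: eq_bigr => x _; rewrite degU. Qed.

Lemma nE_ge e B N : (forall y, y \in B -> 0 < deg e y N) -> #|B| <= nE e B N.
Proof. by move=> H; rewrite -[X in X <= _]mul1n; apply: sum_ge. Qed.

Lemma indep_deg0 e W w : indep e W -> w \in W -> deg e w W = 0.
Proof. by move=> iW wW; apply/eqP/deg0P => v vW; apply: iW. Qed.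

Lemma sum_pos_le (F : T -> nat) W : \sum_(w in W) (0 < F w) <= \sum_(w in W) F w.
Proof. by apply: leq_sum => w _; case: (F w). Qed.

(* [z] takes the color of [Q] and [y] that of [P]. *)
Lemma colorable3_recolor e (P Q R : {set T}) y z : symmetric e -> irreflexive e ->
  indep e P -> indep e Q -> indep e R -> (forall v, v \in P -> e y v -> v = z) ->
  deg e z Q = 0 -> colorable e (y |: (P :|: Q :|: R)) 3.
Proof.
move=> sym irr iP iQ iR yP /eqP/deg0P zQ.
exists (fun v => if v == y then 0 else if v == z then 1 else
   if v \in P then 0 else if v \in Q then 1 else 2); split.
  by move=> v _; do ![case: ifP => // _].
have zQ' v : v \in Q -> ~~ e v z by move=> vQ; rewrite sym; apply: zQ.
have yP' v : v \in P -> v != z -> ~~ e y v by move=> vP; apply: contra => /(yP _ vP)->.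
have yP'' v : v \in P -> v != z -> ~~ e v y by rewrite sym; apply: yP'.
move=> u v; rewrite !inE.
case: (eqVneq u y) => [->|uy]; case: (eqVneq v y) => [->|vy] /=; first by rewrite irr.
- case: (eqVneq v z) => // vz _ vV evy; case vP: (v \in P).
    by move: evy; rewrite (negbTE (yP' v vP vz)).
  by case: ifP.
- case: (eqVneq u z) => // uz _ vV evy; case vP: (u \in P).
    by move: evy; rewrite (negbTE (yP'' u vP uz)).
  by case: ifP.
case: (eqVneq u z) => [->|uz]; case: (eqVneq v z) => [->|vz]; first by rewrite irr.
- move=> _; case vP: (v \in P) => //; case vQ: (v \in Q) => //=.
  by rewrite (negbTE (zQ v vQ)).
- move=> + _; case vP: (u \in P) => //; case vQ: (u \in Q) => //=.
  by rewrite (negbTE (zQ' u vQ)).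
case uP: (u \in P); case vP: (v \in P) => //=; first by rewrite (negbTE (iP _ _ uP vP)).
- by case: ifP.
- by case: ifP.
case uQ: (u \in Q); case vQ: (v \in Q) => //=; first by rewrite (negbTE (iQ _ _ uQ vQ)).
by move=> uR vR; rewrite (negbTE (iR _ _ uR vR)).
Qed.

(** If [y] has a single neighbor [z] in [P], then [z] must have neighbors in both [Q] and [R]:
    otherwise [z] could be recolored and [y] could take its color. So [z] has degree at least 2 in
    [A] and is counted a second time. *)
Lemma bad_nbr e (A P Q R : {set T}) y : symmetric e -> irreflexive e ->
  P :|: Q :|: R = A -> [disjoint P & Q] -> [disjoint P & R] -> [disjoint Q & R] ->
  indep e P -> indep e Q -> indep e R -> 0 < deg e y P ->
  ~ colorable e (y |: A) 3 ->
  2 <= deg e y (P :&: [set z in A | 1 < deg e z A]) + deg e y P.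
Proof.
move=> sym irr AE dPQ dPR dQR iP iQ iR dyP nc.
case: (ltnP 1 (deg e y P)) => [|dyP1]; first lia.
have /deg_gt0P[z zP eyz] := dyP.
have yP v : v \in P -> e y v -> v = z.
  move=> vP eyv; apply/eqP; apply: contraTT dyP1 => vz; rewrite -ltnNge.
  by rewrite (degD1 e y zP) eyz (@degD1 _ e y v (P :\ z)) ?inE ?vz ?vP // eyv.
suff zb : 1 < deg e z A.
  suff : 0 < deg e y (P :&: [set z in A | 1 < deg e z A]) by lia.
  by apply/deg_gt0P; exists z => //; rewrite !inE zP zb -AE !inE zP.
have dUR : [disjoint P :|: Q & R].
  by rewrite disjoints_subset subUset -!disjoints_subset dPR.
have : deg e z A = deg e z P + deg e z Q + deg e z R by rewrite -AE !degU.
case: (posnP (deg e z Q)) => [zQ|].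
  by case: nc; rewrite -AE; apply: colorable3_recolor zQ.
case: (posnP (deg e z R)) => [zR|]; last lia.
by case: nc; rewrite -AE (setUAC P); apply: colorable3_recolor zR.
Qed.

Section Case3.
Variables (e : rel T) (U N W1 W : {set T}) (x : T) (b t : nat).
Hypotheses (sym : symmetric e) (irr : irreflexive e).
Let A := N :|: W1 :|: W.
Let B := U :\: A.
Hypotheses (AU : A \subset U) (dN1 : [disjoint N & W1]) (dNW : [disjoint N & W])
  (d1W : [disjoint W1 & W]) (iN : indep e N) (i1 : indep e W1) (iW : indep e W)
  (cN : #|N|.+1 = t) (c1 : #|W1| = t) (cW : #|W| = t)
  (see : forall y, y \in B -> [/\ 0 < deg e y N, 0 < deg e y W1 & 0 < deg e y W])
  (xB : x \in B) (dx : deg e x U <= 3) (gx : balanced e (B :\ x) (b - 3) t).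

Lemma case3_dUR : [disjoint N :|: W1 & W].
Proof. by rewrite disjoints_subset subUset -!disjoints_subset dNW. Qed.

Lemma case3_degA y : deg e y A = deg e y N + deg e y W1 + deg e y W.
Proof. by rewrite /A !degU ?case3_dUR. Qed.

Lemma case3_cardA : #|A|.+1 = 3 * t.
Proof. by rewrite /A !card_disjU ?case3_dUR //; lia. Qed.

(** The at most three edges at [x] are all spent on the three accessible classes. *)
Lemma case3_x : deg e x B = 0.
Proof.
have [h1 h2 h3] := see xB.
by have := dx; rewrite (deg_cut e x AU) case3_degA -/B; lia.
Qed.

Lemma case3_nEA : nE e A A = 2 * (nE e W1 N + nE e W N + nE e W W1).
Proof.
rewrite /A nEU ?case3_dUR // nEU // !indep_nE // nEUr //; lia.
Qed.

Lemma case3_nEB : nE e B A = nE e B N + nE e B W1 + nE e B W.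
Proof. by rewrite /A !nEUr ?case3_dUR. Qed.

(* No vertex [y] of [B] can be added to a 3-coloring of [A]; hence whenever [y] has
   a single neighbor in a class of [A], that neighbor has neighbors in both
   other classes, which costs many edges inside [A]. *)
Lemma case3_bad_count eps : 3 <= b -> \sum_(v in U) (deg e v U - b) <= eps ->
  (forall y, y \in B -> nE e A A + 2 * deg e y A <= 4 * t) -> ~ balanced e U b t ->
  exists bad, 6 * #|B| <= (b - 2) * bad + eps + nE e B A /\ 2 * bad <= nE e A A.
Proof.
move=> b3 ex few ng; pose Bad := [set z in A | 1 < deg e z A].
have yA y : y \in B -> y \notin A by rewrite inE => /andP[].
have nc y : y \in B -> ~ colorable e (y |: A) 3.
  move=> yB co; apply: ng.
  (* The bound [4 * t] in the hypothesis is what [few_edges_balanced] allows for three colors. *)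
  have g1 : balanced e (y |: A) 3 t.
    apply: few_edges_balanced => //; first by rewrite cardsU1 yA //; exact: case3_cardA.
    by rewrite nE_add1 ?yA //; have := few y yB; lia.
  have g2 : balanced e (B :\ y) (b - 3) t by apply: balanced_swap gx => //; apply: case3_x.
  have eb : 3 + (b - 3) = b by lia.
  apply: (balanced_cast _ eb (balanced_cat _ g1 g2)).
    by rewrite setUAC (setD1K yB) setUC setUDK.
  apply/pred0P => v /=; rewrite /B !inE; case: (eqVneq v y) => //= _.
  by case: (v \in N); case: (v \in W1); case: (v \in W).
have key y : y \in B -> 6 <= deg e y Bad + deg e y A.
  move=> yB; have [h1 h2 h3] := see yB.
  have sp : deg e y Bad = deg e y (N :&: Bad) + deg e y (W1 :&: Bad) + deg e y (W :&: Bad).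
    have E : Bad = (N :&: Bad) :|: (W1 :&: Bad) :|: (W :&: Bad).
      rewrite -!setIUl; apply/setP => v; rewrite in_setI; apply/idP/andP => [vB|[]//].
      by split=> //; move: vB; rewrite inE => /andP[].
    have dI (P Q : {set T}) : [disjoint P & Q] -> [disjoint P :&: Bad & Q :&: Bad].
      move=> d; apply/pred0P => v /=; rewrite !(in_setI); case vP: (v \in P) => //=.
      by rewrite (disjointFr d vP) andbF.
    rewrite {1}E !degU ?dI //.
    by rewrite -setIUl dI // case3_dUR.
  rewrite sp case3_degA.
  have b1 := @bad_nbr e A N W1 W y sym irr erefl dN1 dNW d1W iN i1 iW h1 (nc y yB).
  have d1N : [disjoint W1 & N] by rewrite disjoint_sym.
  have dWN : [disjoint W & N] by rewrite disjoint_sym.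
  have dW1 : [disjoint W & W1] by rewrite disjoint_sym.
  have E2 : W1 :|: N :|: W = A by rewrite (setUC W1).
  have b2 := @bad_nbr e A W1 N W y sym irr E2 d1N d1W dNW i1 iN iW h2 (nc y yB).
  have E3 : W :|: N :|: W1 = A by rewrite -setUA setUC.
  have b3' := @bad_nbr e A W N W1 y sym irr E3 dWN dW1 dN1 iW iN i1 h3 (nc y yB).
  rewrite -/Bad in b1 b2 b3'; lia.
have BU : Bad \subset U.
  by apply: subset_trans AU; apply/subsetP => v; rewrite inE => /andP[].
exists #|Bad|; split; last first.
  apply: (@leq_trans (nE e Bad A)).
    by apply: sum_ge => z; rewrite inE => /andP[].
  rewrite /nE [X in _ <= X](big_setID Bad) /=.
  have -> : A :&: Bad = Bad.
    by apply/setP => v; rewrite in_setI [v \in Bad]inE; case: (v \in A).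
  exact: leq_addr.
have : 6 * #|B| <= nE e B Bad + nE e B A.
  by rewrite /nE -big_split; apply: sum_ge.
suff : nE e B Bad <= (b - 2) * #|Bad| + eps by lia.
(* A bad vertex spends two edges inside [A], so at most [b - 2] edges, plus its excess over [b], go
   to [B]. *)
rewrite nEC //; apply: (@leq_trans (\sum_(z in Bad) ((b - 2) + (deg e z U - b)))).
  apply: leq_sum => z; rewrite inE => /andP[_]; rewrite (deg_cut e z AU) -/B; lia.
rewrite big_split /= sum_nat_const mulnC leq_add2l.
apply: leq_trans ex; rewrite [X in _ <= X](big_setID Bad) /= (setIidPr BU).
exact: leq_addr.
Qed.

End Case3.

Lemma excess_mono e e' U b : (forall u v, e' u v -> e u v) ->
  \sum_(v in U) (deg e' v U - b) <= \sum_(v in U) (deg e v U - b).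
Proof. by move=> s; apply: leq_sum => v _; rewrite leq_sub2r // deg_mono. Qed.

(* The numerical hypotheses of this and the next three lemmas are what the
   counting in [balanced_main] leaves outside of the accessible classes. *)
Lemma balanced4_sparse U t e : 0 < t -> #|U| = 4 * t -> tfgraph e ->
  nE e U U <= 2 * (3 * t + 2) -> (forall x, x \in U -> deg e x U <= 2 * t + 1) ->
  balanced e U 4 t.
Proof.
move=> t0 cU tfg eE dE.
pose P e := [/\ tfgraph e, nE e U U <= 2 * (3 * t + 2)
  & forall x, x \in U -> deg e x U <= 2 * t + 1].
apply: (@edge_induction _ P) => //; first by move=> e' [].
  move=> e' x y [h1 h2 h3]; split; first exact: del_tfgraph.
    by apply: leq_trans h2; apply: nE_mono; exact: del_sub.
  by move=> v /h3 h; apply: leq_trans h; apply: deg_mono; exact: del_sub.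
move=> {tfg eE dE}e [tfg eE dE]; have [sym irr dgn tf] := tfg.
case=> [N x NU iN cN see xB dx gx | N W u x AU dNW iN iW cN cW uW du see xB dx gx
  | N W1 W z u x AU dN1 dNW d1W iN i1 iW cN c1 cW zW dz uW du see xB dx gx].
- have := nE_cut sym NU; rewrite (indep_nE iN) => cut.
  have := card_cut NU; have := nE_ge see; have := solo_sum sym see.
  set B := U :\: N in see xB gx cut *; set s := \sum_(w in N) _ => hs hE cB.
  (* Here [B] has 3t + 1 vertices and sends at most 3t + 2 edges to [N], so the solo sum is at least
     3t, while [N] has only t - 1 vertices. *)
  have [c cN' sc] : exists2 c, c \in N & 1 < #|solos e B N c|.
    by apply: (@pigeon _ _ (fun=> 1)); rewrite sum1_card -/s; lia.
  have [y1 [y2 [s1 s2 y12]]] := two_solos sc.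
  have cB' : c \notin B by rewrite !inE cN'.
  have cH := card_swap cB' s1 s2 y12.
  have [eH _] := nE_swap sym irr cB' (solosB s1) (solosB s2) y12 (solosE s1) (solosE s2).
  have cU' : c \in U by apply: (subsetP NU).
  have := dE c cU'; rewrite (deg_cut e c NU) -/B => dc.
  apply: (balanced_exchange_small tfg NU iN cN cN' s1 s2 y12) => //; rewrite -/B subn1.
  (* At most one edge lies inside [B], and [c] brings back at most 2t - 1; together this is the 2t
     that three colors allow. Two colors suffice for what is left of [B], and [c] gets the third. *)
  apply: few_edges_balanced => //; [|lia|lia].
  apply: colorable_new => //; apply: colorable_sub (nE_le2_colorable sym irr (_ : nE e B B <= 2)).
    by apply: subset_trans (subD1set _ _) (subD1set _ _).
  lia.
(* Two or three accessible classes are impossible: at least 4t + 2 or 3t + 3 edges would leave [B],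
   against a total of at most 3t + 2. *)
- have := nE_cut sym AU; have := card_cut AU.
  rewrite (card_disjU dNW) (nEUr e (U :\: (N :|: W)) dNW).
  have := nE_ge (fun y yB => (see y yB).1); have := nE_ge (fun y yB => (see y yB).2); lia.
- have := nE_cut sym AU; have := card_cut AU.
  have := case3_cardA AU dN1 dNW d1W cN c1 cW xB dx; rewrite (case3_nEB e U dN1 dNW d1W).
  have h1 : #|U :\: (N :|: W1 :|: W)| <= nE e (U :\: (N :|: W1 :|: W)) N.
    by apply: nE_ge => y /see[].
  have h2 : #|U :\: (N :|: W1 :|: W)| <= nE e (U :\: (N :|: W1 :|: W)) W1.
    by apply: nE_ge => y /see[].
  have h3 : #|U :\: (N :|: W1 :|: W)| <= nE e (U :\: (N :|: W1 :|: W)) W.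
    by apply: nE_ge => y /see[].
  lia.
Qed.

End FourColors.

(** * What an exchange leaves behind, with four, five or more colors *)

Section FiveOrMoreColors.
Variables (T : finType).
Implicit Types (e : rel T) (A B N S U V W : {set T}) (f g : T -> nat).

Lemma sum_subset (F : T -> nat) A U : A \subset U -> \sum_(v in A) F v <= \sum_(v in U) F v.
Proof.
by move=> s; rewrite [X in _ <= X](big_setID A) /= (setIidPr s) leq_addr.
Qed.

Lemma sum_elt (F : T -> nat) U v : v \in U -> F v <= \sum_(v in U) F v.
Proof. by move=> vU; rewrite (bigD1 v) //= leq_addr. Qed.

Lemma colorable_rest e B x n : symmetric e -> irreflexive e -> x \in B ->
  colorable e (B :\ x) n -> deg e x B < n -> colorable e B n.
Proof.
move=> sym irr xB co dx; rewrite -(setD1K xB); apply: colorable_add => //.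
by apply: leq_ltn_trans (deg_sub e x (subsetDl B [set x])) _.
Qed.

Lemma swap_sub B w y1 y2 U : B \subset U -> w \in U -> w |: (B :\ y1) :\ y2 \subset U.
Proof.
move=> BU wU; rewrite subUset sub1set wU.
by apply: subset_trans (subD1set _ _) (subset_trans (subD1set _ _) BU).
Qed.

Lemma swapB B y1 y2 : (B :\ y1) :\ y2 \subset B.
Proof. by apply: subset_trans (subD1set _ _) (subD1set _ _). Qed.

(** Adding [w] raises the degree of each of its neighbors by one, and only these vertices can come
    to exceed [b]. *)
Lemma excess_swap e B w y1 y2 b : symmetric e -> irreflexive e -> w \notin B ->
  (forall v, v \in B -> deg e v B <= b) -> deg e w ((B :\ y1) :\ y2) <= b ->
  \sum_(v in w |: (B :\ y1) :\ y2) (deg e v (w |: (B :\ y1) :\ y2) - b)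
    <= deg e w ((B :\ y1) :\ y2).
Proof.
move=> sym irr wB dB dw; set B' := B :\ y1 :\ y2 in dw *.
have wB' : w \notin B' by apply: contra wB; apply: (subsetP (swapB _ _ _)).
have dwB : [disjoint [set w] & B'] by rewrite disjoints1.
rewrite big_setU1 //= degU // deg1 irr; have -> : 0 + deg e w B' - b = 0 by lia.
apply: leq_sum => v vB'; rewrite degU // deg1 sym.
have := dB v (subsetP (swapB _ _ _) v vB').
by have := deg_sub e v (swapB B y1 y2); rewrite -/B'; lia.
Qed.

Lemma balanced4 U t e : #|U| = 4 * t -> tfgraph e -> nE e U U + 10 <= 8 * t ->
  \sum_(v in U) (deg e v U - 4) <= 3 -> balanced e U 4 t.
Proof.
move=> cU tfg eE xE.
pose P e := [/\ tfgraph e, nE e U U + 10 <= 8 * t & \sum_(v in U) (deg e v U - 4) <= 3].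
apply: (@edge_induction _ P) => //; first by move=> e' [].
  move=> e' x y [h1 h2 h3]; split; first exact: del_tfgraph.
    by apply: leq_trans h2; rewrite leq_add2r; apply: nE_mono; exact: del_sub.
  by apply: leq_trans h3; apply: excess_mono; exact: del_sub.
move=> {tfg eE xE}e [tfg eE xE]; have [sym irr dgn tf] := tfg.
case=> [N x NU iN cN see xB dx gx | N W u x AU dNW iN iW cN cW uW du see xB dx gx
  | N W1 W z u x AU dN1 dNW d1W iN i1 iW cN c1 cW zW dz uW du see xB dx gx].
- have := nE_cut sym NU; rewrite (indep_nE iN) => cut.
  have := card_cut NU; have := nE_ge see; have := solo_sum sym see.
  have dxN := see x xB; have dcx := deg_cut e x NU.
  set B := U :\: N in see xB gx cut dcx *; set s := \sum_(w in N) _ => hs hE cB.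
  (* The weight 4 forces the chosen [c] to have no excess: with excess m it has at least 2 + 4m solo
     neighbors among its at most 4 + m neighbors. After the exchange [c] has at most two neighbors
     left, so one of three colors is free for it. *)
  have [c cN' sc] : exists2 c, c \in N & 1 + 4 * (deg e c U - 4) < #|solos e B N c|.
    apply: (@pigeon _ _ (fun c => 1 + 4 * (deg e c U - 4))).
    rewrite big_split /= sum1_card -big_distrr /= -/s.
    by have := sum_subset (fun c => deg e c U - 4) NU; lia.
  have := solos_le e B N c; have := deg_cut e c NU; rewrite -/B => dc sl.
  have [y1 [y2 [s1 s2 y12]]] := two_solos (leq_ltn_trans (leq_addr _ _) sc).
  have cB' : c \notin B by rewrite !inE cN'.
  have cH := card_swap cB' s1 s2 y12.
  have [eH dH] := nE_swap sym irr cB' (solosB s1) (solosB s2) y12 (solosE s1) (solosE s2).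
  apply: (balanced_exchange_small tfg NU iN cN cN' s1 s2 y12) => //; rewrite -/B subn1.
  apply: few_edges_balanced => //; [|lia|lia].
  apply: colorable_add => //; last by lia.
  apply: colorable_sub (swapB _ _ _) _; apply: (colorable_rest sym irr xB); last lia.
  exact: balanced_colorable gx.
- have := nE_cut sym AU; have := card_cut AU.
  rewrite (card_disjU dNW) (nEUr e (U :\: (N :|: W)) dNW).
  have := nE_ge (fun y yB => (see y yB).1); have := nE_ge (fun y yB => (see y yB).2); lia.
- case: (boolp.EM (balanced e U 4 t)) => // ng; exfalso.
  have cA := case3_cardA AU dN1 dNW d1W cN c1 cW xB dx.
  have := nE_cut sym AU; have := card_cut AU; have := case3_nEB e U dN1 dNW d1W.
  have h1 : #|U :\: (N :|: W1 :|: W)| <= nE e (U :\: (N :|: W1 :|: W)) N.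
    by apply: nE_ge => y /see[].
  have h2 : #|U :\: (N :|: W1 :|: W)| <= nE e (U :\: (N :|: W1 :|: W)) W1.
    by apply: nE_ge => y /see[].
  have h3 : #|U :\: (N :|: W1 :|: W)| <= nE e (U :\: (N :|: W1 :|: W)) W.
    by apply: nE_ge => y /see[].
  move=> hB cB cut.
  (* With t + 1 vertices in [B], the count of bad vertices would give 6t + 6 <= 5t - 10. *)
  have [||bad [b1 b2]] := case3_bad_count sym irr AU dN1 dNW d1W iN i1 iW cN c1 cW see xB dx gx _ xE _ ng => //; last lia.
  move=> y yB; have /setDP[yU _] := yB.
  have := sum_elt (fun v => deg e v U - 4) yU; have := deg_cut e y AU; lia.
Qed.

Lemma balanced5 U t e : 7 <= t -> #|U| = 5 * t -> tfgraph e -> nE e U U + 2 <= 14 * t ->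
  (forall v, v \in U -> deg e v U <= 6) ->
  \sum_(v in U) (deg e v U - 5) <= 4 -> balanced e U 5 t.
Proof.
move=> t7 cU tfg eE dE xE.
pose P e := [/\ tfgraph e, nE e U U + 2 <= 14 * t, forall v, v \in U -> deg e v U <= 6
  & \sum_(v in U) (deg e v U - 5) <= 4].
apply: (@edge_induction _ P) => //; first by move=> e' [].
  move=> e' x y [h1 h2 h3 h4]; split; first exact: del_tfgraph.
  - by apply: leq_trans h2; rewrite leq_add2r; apply: nE_mono; exact: del_sub.
  - by move=> v /h3 h; apply: leq_trans h; apply: deg_mono; exact: del_sub.
  - by apply: leq_trans h4; apply: excess_mono; exact: del_sub.
move=> {tfg eE dE xE}e [tfg eE dE xE]; have [sym irr dgn tf] := tfg.
case=> [N x NU iN cN see xB dx gx | N W u x AU dNW iN iW cN cW uW du see xB dx gx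
  | N W1 W z u x AU dN1 dNW d1W iN i1 iW cN c1 cW zW dz uW du see xB dx gx].
- have := nE_cut sym NU; rewrite (indep_nE iN) => cut.
  have := card_cut NU; have := nE_ge see; have := solo_sum sym see.
  set B := U :\: N in see xB gx cut *; set s := \sum_(w in N) _ => hs hE cB.
  have [c cN' sc] : exists2 c, c \in N & 1 < #|solos e B N c|.
    by apply: (@pigeon _ _ (fun=> 1)); rewrite sum1_card -/s; lia.
  have [y1 [y2 [s1 s2 y12]]] := two_solos sc.
  have cB' : c \notin B by rewrite !inE cN'.
  have cH := card_swap cB' s1 s2 y12.
  have [eH _] := nE_swap sym irr cB' (solosB s1) (solosB s2) y12 (solosE s1) (solosE s2).
  have cU' : c \in U by apply: (subsetP NU).
  have := dE c cU'; rewrite (deg_cut e c NU) -/B => dc.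
  apply: (balanced_exchange_small tfg NU iN cN cN' s1 s2 y12) => //; rewrite -/B.
  (* At most 3t - 2 edges lie inside [B], and [c], of degree at most 6, brings back at most 4. This
     is the bound 3t + 2 in [balanced4_sparse]. *)
  apply: balanced4_sparse => //; try lia.
  have sH := @swap_sub B c y1 y2 U (subsetDl _ _) cU'.
  move=> v /(subsetP sH) vU; have := dE v vU; have := deg_sub e v sH; lia.
- case: (boolp.EM (balanced e U 5 t)) => // ng; exfalso.
  have := nE_cut sym AU; have := card_cut AU.
  rewrite (card_disjU dNW) (nEUr e (U :\: (N :|: W)) dNW) nEU // (indep_nE iN) (indep_nE iW).
  have := nE_ge (fun y yB => (see y yB).1); have := solo_sum sym (fun y yB => (see y yB).2).
  have hW2 := nE_ge (fun y yB => (see y yB).2).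
  have dcx := deg_cut e x AU; have [sx1 sx2] := see x xB.
  move: dcx hW2; rewrite degU //.
  set B := U :\: (N :|: W) in see xB gx *; set s := \sum_(w in W) _.
  move=> dcx hW2 hs hE cB cut.
  have WU w : w \in W -> w \in U by move=> wW; apply: (subsetP AU); rewrite inE wW orbT.
  have wB w : w \in W -> w \notin B by move=> wW; rewrite !inE wW orbT.
  have coB : colorable e B 3.
    by apply: (colorable_rest sym irr xB); [apply: balanced_colorable gx|lia].
  have g1 v : v \in W -> deg e v N = 0 -> balanced e (v |: N) 1 t.
    move=> vW /eqP/deg0P vN; apply: balanced1; first exact: indep_add.
    by rewrite cardsU1 (disjointFl dNW).
  have mvb w : w \in W -> deg e w N = 0 -> #|solos e B W w| = 0.
    move=> wW dw; apply/eqP; rewrite cards_eq0; apply/eqP/setP => y; rewrite [RHS]inE.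
    apply/negbTE/negP => ys; apply: ng.
    apply: (@balanced_move _ e U N W 1 3 t tfg AU dNW iW cW w y wW (g1 w wW dw) ys).
    have yB := solosB ys; rewrite -/B in yB *.
    apply: few_edges_balanced => //; first by apply: colorable_sub coB; apply: subD1set.
      by move: cB; rewrite (cardsD1 y B) yB; lia.
    by have := nE_sub e (subD1set B y); lia.
  (* The solo sum is at least 2t + 4 plus the number of edges between [W] and [N], and the total
     weight is at most 16 plus that number; hence the hypothesis t >= 7. As with four colors, the
     weight 4 leaves the chosen [w] without excess. *)
  have [w wW sc] : exists2 w, w \in W & (0 < deg e w N) + 4 * (deg e w U - 5) < #|solos e B W w|.
    apply: (@pigeon _ _ (fun w => (0 < deg e w N) + 4 * (deg e w U - 5))).
    rewrite big_split /= -big_distrr /= -/s.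
    have WsU : W \subset U by apply/subsetP.
    have := sum_subset (fun c => deg e c U - 5) WsU.
    have : \sum_(w in W) (0 < deg e w N) <= nE e W N by apply: (@sum_pos_le _ (fun w => deg e w N)).
    lia.
  have dw0 : 0 < deg e w N.
    by rewrite lt0n; apply: contraTneq sc => /(mvb w wW)->.
  have := solos_le e B W w; have := deg_cut e w AU; have := dE w (WU w wW).
  rewrite degU // (indep_deg0 iW wW) -/B => dw6 dc sl.
  have sc2 : 1 < #|solos e B W w| by move: sc; rewrite dw0; lia.
  have [y1 [y2 [s1 s2 y12]]] := two_solos sc2.
  have cH := card_swap (wB w wW) s1 s2 y12.
  have [eH dH] := nE_swap sym irr (wB w wW) (solosB s1) (solosB s2) y12 (solosE s1) (solosE s2).
  have uw : u != w by apply: contraTneq dw0 => <-; rewrite du.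
  apply: ng; apply: (@balanced_exchange _ e U N W 1 3 t tfg AU dNW iW cW u w y1 y2) => //.
    exact: g1.
  rewrite -/B; apply: few_edges_balanced => //; [|lia|lia].
  apply: colorable_add => //; first by apply: colorable_sub coB; apply: swapB.
  by move: sc; rewrite dw0; lia.
- case: (boolp.EM (balanced e U 5 t)) => // ng; exfalso.
  have cA := case3_cardA AU dN1 dNW d1W cN c1 cW xB dx.
  have := nE_cut sym AU; have := card_cut AU; have := case3_nEB e U dN1 dNW d1W.
  have h1 : #|U :\: (N :|: W1 :|: W)| <= nE e (U :\: (N :|: W1 :|: W)) N.
    by apply: nE_ge => y /see[].
  have h2 : #|U :\: (N :|: W1 :|: W)| <= nE e (U :\: (N :|: W1 :|: W)) W1.
    by apply: nE_ge => y /see[].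
  have h3 : #|U :\: (N :|: W1 :|: W)| <= nE e (U :\: (N :|: W1 :|: W)) W.
    by apply: nE_ge => y /see[].
  move=> hB cB cut.
  have [||bad [b1 b2]] := case3_bad_count sym irr AU dN1 dNW d1W iN i1 iW cN c1 cW see xB dx gx _ xE _ ng => //; last lia.
  move=> y yB; have /setDP[yU _] := yB.
  have := dE y yU; have := deg_cut e y AU; lia.
Qed.

Lemma balanced6 U b t e : 6 <= b -> b + 2 <= t -> #|U| = b * t -> tfgraph e ->
  nE e U U + 12 <= 2 * ((b + 2) * t) + 2 * b ->
  (forall v, v \in U -> deg e v U <= b + 1) -> balanced e U b t.
Proof.
move=> b6 tb cU tfg eE dE.
pose P e := [/\ tfgraph e, nE e U U + 12 <= 2 * ((b + 2) * t) + 2 * b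
  & forall v, v \in U -> deg e v U <= b + 1].
apply: (@edge_induction _ P) => //; first by move=> e' [].
- move=> e' x y [h1 h2 h3]; split; first exact: del_tfgraph.
  + by apply: leq_trans h2; rewrite leq_add2r; apply: nE_mono; exact: del_sub.
  + by move=> v /h3 h; apply: leq_trans h; apply: deg_mono; exact: del_sub.
- by lia.
move=> {tfg eE dE}e [tfg eE dE]; have [sym irr dgn tf] := tfg.
have [c bc] : exists c, b = c + 6 by exists (b - 6); lia.
have cX : c <= c * t by apply: leq_pmulr; lia.
case=> [N x NU iN cN see xB dx gx | N W u x AU dNW iN iW cN cW uW du see xB dx gx
  | N W1 W z u x AU dN1 dNW d1W iN i1 iW cN c1 cW zW dz uW du see xB dx gx].
- have := nE_cut sym NU; rewrite (indep_nE iN) => cut.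
  have := card_cut NU; have := nE_ge see; have := solo_sum sym see.
  set B := U :\: N in see xB gx cut *; set s := \sum_(w in N) _ => hs hE cB.
  have [v vN' sc] : exists2 c, c \in N & 1 < #|solos e B N c|.
    by apply: (@pigeon _ _ (fun=> 1)); rewrite sum1_card -/s; subst b; clear - cX hs cut eE cB cU cN tb; lia.
  have [y1 [y2 [s1 s2 y12]]] := two_solos sc.
  have cB' : v \notin B by rewrite !inE vN'.
  have cH := card_swap cB' s1 s2 y12.
  have [eH _] := nE_swap sym irr cB' (solosB s1) (solosB s2) y12 (solosE s1) (solosE s2).
  have cU' : v \in U by apply: (subsetP NU).
  have := dE v cU'; rewrite (deg_cut e v NU) -/B => dc.
  apply: (balanced_exchange_small tfg NU iN cN vN' s1 s2 y12) => //; first lia.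
  rewrite -/B; have Eb1 : b - 1 = c + 5 by lia.
  rewrite Eb1; apply: few_edges_balanced => //.
  + by apply: degenerate_colorable => //; lia.
  + by subst b; clear - cH cB cU cN; lia.
  + have -> : (c + 5).-1 = c + 4 by lia.
    by subst b; clear - eH cX cut eE cB cU cN tb dc hE; lia.
(* Two accessible classes would receive at least 2(b - 2)t + 2 edges from [B], more than the (b +
   2)t + b - 6 available once b >= 6; three classes would receive even more. *)
- exfalso; have := nE_cut sym AU; have := card_cut AU.
  rewrite (card_disjU dNW) (nEUr e (U :\: (N :|: W)) dNW).
  have := nE_ge (fun y yB => (see y yB).1); have := nE_ge (fun y yB => (see y yB).2).
  by move=> *; subst b; clear see dE; lia.
- exfalso; have := nE_cut sym AU; have := card_cut AU.
  have := case3_cardA AU dN1 dNW d1W cN c1 cW xB dx; rewrite (case3_nEB e U dN1 dNW d1W).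
  have h1 : #|U :\: (N :|: W1 :|: W)| <= nE e (U :\: (N :|: W1 :|: W)) N.
    by apply: nE_ge => y /see[].
  have h2 : #|U :\: (N :|: W1 :|: W)| <= nE e (U :\: (N :|: W1 :|: W)) W1.
    by apply: nE_ge => y /see[].
  have h3 : #|U :\: (N :|: W1 :|: W)| <= nE e (U :\: (N :|: W1 :|: W)) W.
    by apply: nE_ge => y /see[].
  by move=> *; subst b; clear see dE; lia.
Qed.

End FiveOrMoreColors.

(** * The first stage: k colors and degrees at most k *)

Section MainCase.
Variables (T : finType).
Implicit Types (e : rel T) (A B N S U V W : {set T}) (f g : T -> nat).

Lemma balanced_blocked1 e U k t N : 6 <= k -> #|U| = k * t -> tfgraph e ->
  nE e U U + 8 <= 4 * (k * t) -> (forall v, v \in U -> deg e v U <= k) ->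
  N \subset U -> indep e N -> #|N|.+1 = t ->
  (forall y, y \in U :\: N -> 0 < deg e y N) -> balanced e U k t.
Proof.
move=> k6 cU tfg eE dE NU iN cN see; have [sym irr dgn tf] := tfg.
have := nE_cut sym NU; rewrite (indep_nE iN) => cut.
have := card_cut NU; have := nE_ge see; have := solo_sum sym see.
set B := U :\: N in see cut *; set s := \sum_(w in N) _ => hs hE cB.
have dNB : nE e B N <= k * #|N|.
  rewrite nEC //; apply: sum_le => v vN; apply: leq_trans (dE v (subsetP NU v vN)).
  by apply: deg_sub; apply: subsetDl.
(* Each vertex of [B] needs an edge to [N], which can take at most [k * #|N|] of them. Hence t >= k
   + 1, the lower bound on t required with k - 1 colors. *)
have kn : k <= #|N| by subst t; clear - dNB hE cB cU; lia.
have s6 : 6 * #|N| <= k * #|N| by rewrite leq_mul2r k6 orbT.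
have [v vN' sc] : exists2 c, c \in N & 1 < #|solos e B N c|.
  apply: (@pigeon _ _ (fun=> 1)); rewrite sum1_card -/s.
  by subst t; clear - s6 kn k6 hs dNB cB cU; lia.
clear hs s6 dNB; clearbody s; clear s.
have [y1 [y2 [s1 s2 y12]]] := two_solos sc.
have cB' : v \notin B by rewrite !inE vN'.
have cH := card_swap cB' s1 s2 y12.
have [eH dH] := nE_swap sym irr cB' (solosB s1) (solosB s2) y12 (solosE s1) (solosE s2).
have cU' : v \in U by apply: (subsetP NU).
have := dE v cU'; rewrite (deg_cut e v NU) -/B => dc.
apply: (balanced_exchange_small tfg NU iN cN vN' s1 s2 y12) => //; first lia.
rewrite -/B.
have sH := @swap_sub _ B v y1 y2 U (subsetDl _ _) cU'.
have dH' w : w \in v |: (B :\ y1) :\ y2 -> deg e w (v |: (B :\ y1) :\ y2) <= k.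
  by move=> /(subsetP sH) wU; apply: leq_trans (dE w wU); apply: deg_sub.
(* At most (k + 1)t + k - 7 edges are left for k - 1 colors. This is the edge bound of [balanced6]
   with b = k - 1, and that of [balanced5] when k = 6. *)
case: (ltnP 6 k) => k7.
  have [c kc] : exists c, k = c + 7 by exists (k - 7); clear - k7; lia.
  have ek : k - 1 = c + 6 by clear - kc; lia.
  have cc : c <= c * t by apply: leq_pmulr; clear - cN; lia.
  subst k; rewrite ek; apply: balanced6 => //; try lia.
  by move=> w /dH'; lia.
have {}k7 : k = 6 by clear - k6 k7; lia.
subst k; apply: balanced5 => //; try lia.
(* Vertices of [B] have a neighbor in [N], so at most 5 in [B]; only the at most four remaining
   neighbors of [v] can reach degree 6. *)
apply: (@leq_trans (deg e v (B :\ y1 :\ y2))); last lia.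
apply: excess_swap => //; last lia.
move=> w wB; have := see w wB; have /setDP[wU _] := wB.
by have := dE w wU; rewrite (deg_cut e w NU) -/B; clear; lia.
Qed.

Lemma balanced_blocked2 e U k t N W u : 6 <= k -> #|U| = k * t -> tfgraph e ->
  nE e U U + 8 <= 4 * (k * t) -> (forall v, v \in U -> deg e v U <= k) ->
  N :|: W \subset U -> [disjoint N & W] -> indep e N -> indep e W ->
  #|N|.+1 = t -> #|W| = t -> u \in W -> deg e u N = 0 ->
  (forall y, y \in U :\: (N :|: W) -> 0 < deg e y N /\ 0 < deg e y W) -> balanced e U k t.
Proof.
move=> k6 cU tfg eE dE AU dNW iN iW cN cW uW du see; have [sym irr dgn tf] := tfg.
case: (boolp.EM (balanced e U k t)) => // ng; exfalso.
have := nE_cut sym AU; have := card_cut AU.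
rewrite (card_disjU dNW) (nEUr e (U :\: (N :|: W)) dNW) nEU // (indep_nE iN) (indep_nE iW).
have := nE_ge (fun y yB => (see y yB).1); have := solo_sum sym (fun y yB => (see y yB).2).
have := nE_ge (fun y yB => (see y yB).2).
set B := U :\: (N :|: W) in see *; set s := \sum_(w in W) _.
move=> hW2 hs hE cB cut.
have [c kc] : exists c, k = c + 6 by exists (k - 6); lia.
have k2 : k - 2 = c + 4 by lia.
have WU w : w \in W -> w \in U by move=> wW; apply: (subsetP AU); rewrite inE wW orbT.
have wB w : w \in W -> w \notin B by move=> wW; rewrite !inE wW orbT.
have cB1 : #|B| = (c + 4) * t + 1 by subst k; clear - cB cU cN cW; lia.
have cc : c <= c * t by apply: leq_pmulr; clear - cN; lia.
have degB v : v \in B -> deg e v B <= c + 4.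
  move=> vB; have [h1 h2] := see v vB; have /setDP[vU _] := vB.
  by have := dE v vU; rewrite (deg_cut e v AU) -/B degU //; lia.
have nm0 : \sum_(w in W) (0 < deg e w N) <= nE e W N by apply: (@sum_pos_le _ (fun w => deg e w N)).
(* This counts the vertices of [W] that cannot move into [N]. Each costs an edge between [W] and
   [N], and they alone will turn out to have solo neighbors. *)
set nm := \sum_(w in W) _ in nm0.
have budget : nE e B B + 2 * nm + 2 * nE e B N + 2 * nE e B W + 8 <= 4 * (c * t) + 24 * t.
  by subst k; clear - nm0 cut eE; lia.
have gB y : y \in B -> balanced e (B :\ y) (k - 2) t.
  move=> yB; have nEy := nE_sub e (subD1set B y).
  have cBy : #|B :\ y| = (c + 4) * t by move: cB1; rewrite (cardsD1 y B) yB; lia.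
  (* At most 4t - 6 edges lie inside [B]. With five or more colors this is few enough for direct
     rebalancing; with four colors, which allow only 3t, [balanced4] takes over. *)
  rewrite k2; case: (posnP c) => c0.
    move: cBy budget cB1; rewrite c0 => cBy budget cB1; apply: balanced4 => //; first lia.
    rewrite big1 // => v /setD1P[_ vB]; have := degB v vB; have := deg_sub e v (subD1set B y); lia.
  apply: few_edges_balanced => //; first by apply: degenerate_colorable => //; lia.
  have -> : (c + 4).-1 = c + 3 by clear; lia.
  have : t <= c * t by rewrite -[X in X <= _]mul1n leq_mul2r c0 orbT.
  by clear - nEy budget hE hW2 cB1; lia.
have g1 v : v \in W -> deg e v N = 0 -> balanced e (v |: N) 1 t.
  move=> vW /eqP/deg0P vN; apply: balanced1; first exact: indep_add.
  by rewrite cardsU1 (disjointFl dNW).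
have k21 : 1 + 1 + (k - 2) = k by clear - k6; lia.
have mvb w : w \in W -> deg e w N = 0 -> #|solos e B W w| = 0.
  move=> wW dw; apply/eqP; rewrite cards_eq0; apply/eqP/setP => y; rewrite [RHS]inE.
  apply/negbTE/negP => ys; apply: ng; rewrite -k21.
  apply: (@balanced_move _ e U N W 1 (k - 2) t tfg AU dNW iW cW w y wW (g1 w wW dw) ys).
  exact: gB (solosB ys).
have sle w : w \in W -> #|solos e B W w| + deg e w N <= k.
  move=> wW; have := solos_le e B W w; have := dE w (WU w wW).
  by rewrite (deg_cut e w AU) degU // -/B; lia.
have snm : s <= (c + 5) * nm.
  rewrite /s /nm big_distrr /=; apply: leq_sum => w wW; case: (posnP (deg e w N)) => dw.
    by rewrite mvb.
  by rewrite muln1; have := sle w wW; lia.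
have [w wW sc] : exists2 w, w \in W & (0 < deg e w N) < #|solos e B W w|.
  by apply: pigeon; rewrite -/s -/nm; clear - budget hs hE cB1 hW2; lia.
have dw0 : 0 < deg e w N by rewrite lt0n; apply: contraTneq sc => /(mvb w wW)->.
rewrite dw0 in sc.
have [y1 [y2 [s1 s2 y12]]] := two_solos sc.
have cH := card_swap (wB w wW) s1 s2 y12.
have [eH dH] := nE_swap sym irr (wB w wW) (solosB s1) (solosB s2) y12 (solosE s1) (solosE s2).
have dwB : deg e w B <= c + 5.
  by have := dE w (WU w wW); rewrite (deg_cut e w AU) degU // -/B; clear - kc dw0; lia.
have uw : u != w by apply: contraTneq dw0 => <-; rewrite du.
apply: ng; rewrite -k21; apply: (@balanced_exchange _ e U N W 1 (k - 2) t tfg AU dNW iW cW u w y1 y2) => //.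
  exact: g1.
have cH' : #|w |: (B :\ y1) :\ y2| = (c + 4) * t by clear - cH cB1; lia.
rewrite -/B k2; case: (posnP c) => c0.
  (* The edge bound of [balanced4] needs [nm] to be at least 2. This holds because the solo sum is
     at least [nm + 7] and, by [snm], at most [5 * nm]. *)
  move: cH' budget cB1 dwB snm degB; rewrite c0 => cH' budget cB1 dwB snm degB; apply: balanced4 => //; first lia.
  apply: (@leq_trans (deg e w (B :\ y1 :\ y2))); last lia.
  by apply: excess_swap => //; [apply: wB|lia].
apply: few_edges_balanced => //; first by apply: degenerate_colorable => //; lia.
have -> : (c + 4).-1 = c + 3 by clear; lia.
have : c + t <= c * t + 1 by clear - c0 cN; nia.
by clear - cN eH dwB budget hE hW2 cB1; lia.
Qed.

Lemma balanced_blocked3 e U k t N W1 W z u x : 6 <= k -> #|U| = k * t -> tfgraph e ->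
  nE e U U + 8 <= 4 * (k * t) -> (forall v, v \in U -> deg e v U <= k) ->
  N :|: W1 :|: W \subset U ->
  [disjoint N & W1] -> [disjoint N & W] -> [disjoint W1 & W] ->
  indep e N -> indep e W1 -> indep e W ->
  #|N|.+1 = t -> #|W1| = t -> #|W| = t -> z \in W1 -> deg e z N = 0 ->
  u \in W -> deg e u N = 0 \/ deg e u W1 = 0 ->
  (forall y, y \in U :\: (N :|: W1 :|: W) ->
     [/\ 0 < deg e y N, 0 < deg e y W1 & 0 < deg e y W]) ->
  x \in U :\: (N :|: W1 :|: W) -> deg e x U <= 3 ->
  balanced e ((U :\: (N :|: W1 :|: W)) :\ x) (k - 3) t -> balanced e U k t.
Proof.
move=> k6 cU tfg eE dE AU dN1 dNW d1W iN i1 iW cN c1 cW zW dz uW du see xB dx gx.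
have [sym irr dgn tf] := tfg.
case: (boolp.EM (balanced e U k t)) => // ng; exfalso.
have dUR := case3_dUR dNW d1W.
have := nE_cut sym AU; have := card_cut AU.
rewrite (case3_nEB e U dN1 dNW d1W) (case3_nEA sym AU dN1 dNW d1W iN i1 iW cN c1 cW xB dx).
have cA := case3_cardA AU dN1 dNW d1W cN c1 cW xB dx.
have dx0 := case3_x AU dN1 dNW d1W cN c1 cW see xB dx.
have h1 : #|U :\: (N :|: W1 :|: W)| <= nE e (U :\: (N :|: W1 :|: W)) N.
  by apply: nE_ge => y /see[].
have h2 : #|U :\: (N :|: W1 :|: W)| <= nE e (U :\: (N :|: W1 :|: W)) W1.
  by apply: nE_ge => y /see[].
have seeW y : y \in U :\: (N :|: W1 :|: W) -> 0 < deg e y W by case/see.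
have := solo_sum sym seeW.
set B := U :\: (N :|: W1 :|: W) in see xB gx dx0 h1 h2 seeW *; set s := \sum_(w in W) _.
move=> hs cB cut.
have [c kc] : exists c, k = c + 6 by exists (k - 6); clear - k6; lia.
have WU w : w \in W -> w \in U by move=> wW; apply: (subsetP AU); rewrite !inE wW orbT.
have wB w : w \in W -> w \notin B by move=> wW; rewrite !inE wW orbT.
have cB1 : #|B| = (c + 3) * t + 1 by subst k; clear - cB cU cA; lia.
(* The vertices of [W] that can move neither into [N] nor into [W1]. Each costs two edges inside the
   accessible part, hence the term [4 * nm] in [budget]. *)
pose G w : bool := (0 < deg e w N) && (0 < deg e w W1).
pose nm := \sum_(w in W) G w.
have nm1 : nm <= nE e W N by apply: leq_sum => w _; rewrite /G; case: (deg e w N) => [|d] //; case: (_ && _).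
have nm2 : nm <= nE e W W1.
  by apply: leq_sum => w _; rewrite /G; case: (deg e w W1) => [|d]; rewrite ?andbF //; case: (_ && _).
have nmt : nm + 1 <= t.
  rewrite /nm (big_setD1 u) //= /G.
  have -> : (0 < deg e u N) && (0 < deg e u W1) = false by case: du => ->; rewrite ?andbF.
  rewrite add0n -cW (cardsD1 u W) uW addnC leq_add2l -sum1_card.
  by apply: leq_sum => v _; case: (_ && _).
have cc : c * nm + c <= c * t by rewrite addnC -mulnS leq_mul2l -addn1 nmt orbT.
have budget : nE e B B + 4 * nm + 2 * nE e B N + 2 * nE e B W1 + 2 * nE e B W + 8
    <= 4 * (c * t) + 24 * t.
  by subst k; clear - nm1 nm2 cut eE; lia.
have k21 : 2 + 1 + (k - 3) = k by clear - k6; lia.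
have g2 v : v \in W -> ~~ G v -> balanced e (v |: (N :|: W1)) 2 t.
  move=> vW Gv; apply: (balanced_pair sym irr dN1 iN i1 cN c1 zW dz).
    by rewrite (disjointFl dUR).
  by move: Gv; rewrite negb_and -!leqNgt !leqn0 => /orP[]/eqP->; [left|right].
have mvb w : w \in W -> ~~ G w -> #|solos e B W w| = 0.
  move=> wW dw; apply/eqP; rewrite cards_eq0; apply/eqP/setP => y; rewrite [RHS]inE.
  apply/negbTE/negP => ys; apply: ng; rewrite -k21.
  apply: (@balanced_move _ e U (N :|: W1) W 2 (k - 3) t tfg AU dUR iW cW w y wW (g2 w wW dw) ys).
  by apply: balanced_swap gx => //; apply: solosB ys.
have dwB w : w \in W -> G w -> deg e w B <= c + 4.
  move=> wW /andP[a1 a2]; have := dE w (WU w wW).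
  by rewrite (deg_cut e w AU) degU // degU // -/B; clear - kc a1 a2; lia.
have snm : s <= (c + 4) * nm.
  rewrite /s /nm big_distrr /=; apply: leq_sum => w wW; case Gw: (G w).
    by rewrite muln1; apply: leq_trans (solos_le e B W w) (dwB w wW Gw).
  by rewrite mvb // Gw.
have [w wW sc] : exists2 w, w \in W & G w < #|solos e B W w|.
  by apply: (@pigeon _ _ (fun w => G w)); rewrite -/s -/nm; clear - budget hs h1 h2 cB1; lia.
have Gw : G w by apply: contraTT sc => /(mvb w wW)->.
rewrite Gw in sc.
have [y1 [y2 [s1 s2 y12]]] := two_solos sc.
have cH := card_swap (wB w wW) s1 s2 y12.
have [eH dH] := nE_swap sym irr (wB w wW) (solosB s1) (solosB s2) y12 (solosE s1) (solosE s2).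
have uw : u != w.
  by apply: contraTneq Gw => <-; rewrite /G; case: du => ->; rewrite ?andbF.
have nGu : ~~ G u by rewrite /G; case: du => ->; rewrite ?andbF.
apply: ng; rewrite -k21.
apply: (@balanced_exchange _ e U (N :|: W1) W 2 (k - 3) t tfg AU dUR iW cW u w y1 y2) => //; first exact: g2.
have k3 : k - 3 = c + 3 by clear - kc; lia.
have cH' : #|w |: (B :\ y1) :\ y2| = (c + 3) * t by clear - cH cB1; lia.
have dwBw := dwB w wW Gw.
rewrite -/B k3; apply: few_edges_balanced => //.
  apply: colorable_add => //; last by clear - dH dwBw; lia.
  apply: colorable_sub (swapB _ _ _) _; apply: (colorable_rest sym irr xB); last by rewrite dx0 addn3.
  by rewrite -k3; apply: balanced_colorable gx.
have -> : (c + 3).-1 = c + 2 by clear; lia.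
by clear - eH cc budget snm hs h1 h2 cB1 dwBw nmt; lia.
Qed.

Lemma balanced_main U k t e : 6 <= k -> #|U| = k * t -> tfgraph e ->
  nE e U U + 8 <= 4 * (k * t) -> (forall v, v \in U -> deg e v U <= k) -> balanced e U k t.
Proof.
move=> k6 cU tfg eE dE.
pose P e := [/\ tfgraph e, nE e U U + 8 <= 4 * (k * t) & forall v, v \in U -> deg e v U <= k].
apply: (@edge_induction _ P) => //; first by move=> e' [].
- move=> e' x y [h1 h2 h3]; split; first exact: del_tfgraph.
  + by apply: leq_trans h2; rewrite leq_add2r; apply: nE_mono; exact: del_sub.
  + by move=> v /h3 h; apply: leq_trans h; apply: deg_mono; exact: del_sub.
- by lia.
move=> {tfg eE dE}e [tfg eE dE].
case=> [N x NU iN cN see xB dx gx | N W u x AU dNW iN iW cN cW uW du see xB dx gx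
  | N W1 W z u x AU dN1 dNW d1W iN i1 iW cN c1 cW zW dz uW du see xB dx gx].
- exact: balanced_blocked1 see.
- exact: (balanced_blocked2 k6 cU tfg eE dE AU dNW iN iW cN cW uW du see).
- exact: (balanced_blocked3 k6 cU tfg eE dE AU dN1 dNW d1W iN i1 iW cN c1 cW zW dz uW du see xB dx gx).
Qed.

End MainCase.

(** * Adding one or two vertices *)

Section Padding.
Variables (T : finType) (e : rel T).

(* One or two new vertices, adjacent to each other and to nothing else. *)
Definition padded : rel (T + 'I_2) := fun u v =>
  match u, v with inl x, inl y => e x y | inr a, inr b => a != b | _, _ => false end.

Definition pad_set (U : {set T}) (D : {set 'I_2}) : {set T + 'I_2} :=
  [set u | match u with inl x => x \in U | inr a => a \in D end].

Lemma pad_sum (F : T + 'I_2 -> nat) U D :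
  \sum_(u in pad_set U D) F u = \sum_(x in U) F (inl x) + \sum_(a in D) F (inr a).
Proof.
rewrite big_sumType; congr (_ + _); apply: eq_bigl => x; by rewrite inE.
Qed.

Lemma pad_card U D : #|pad_set U D| = #|U| + #|D|.
Proof. by rewrite -!sum1_card pad_sum. Qed.

Lemma pad_degl x U D : deg padded (inl x) (pad_set U D) = deg e x U.
Proof. by rewrite /deg pad_sum /= [X in _ + X]big1 // addn0. Qed.

Lemma pad_degr a U D : deg padded (inr a) (pad_set U D) <= 1.
Proof.
rewrite /deg pad_sum /= big1 // add0n.
apply: leq_trans (sum_subset (fun i => (a != i : nat)) (subsetT D)) _.
rewrite (eq_bigl xpredT) => [|i]; last by rewrite inE.
by rewrite !big_ord_recl big_ord0; case: a => [[|[]]].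
Qed.

Lemma pad_nE U D : nE padded (pad_set U D) (pad_set U D) <= nE e U U + #|D|.
Proof.
rewrite /nE pad_sum; apply: leq_add.
  by apply: leq_sum => x _; rewrite pad_degl.
by rewrite -sum1_card; apply: leq_sum => a _; apply: pad_degr.
Qed.

Lemma pad_setE (S : {set T + 'I_2}) :
  S = pad_set [set x | inl x \in S] [set a | inr a \in S].
Proof. by apply/setP => -[x|a]; rewrite !inE. Qed.

(** Two adjacent new vertices create no triangle, whereas a clique of three would; this limits the
    padding to two vertices. *)
Lemma pad_tfgraph : tfgraph e -> tfgraph padded.
Proof.
case=> sym irr dg tf; split.
- by move=> [x|a] [y|b] //=; rewrite eq_sym.
- by move=> [x|a] //=; rewrite eqxx.
- move=> S /set0Pn[u uS]; rewrite (pad_setE S).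
  set U := [set x | _]; set D := [set a | _].
  have [D0|/set0Pn[a aD]] := eqVneq D set0; last first.
    by exists (inr a); [rewrite inE|apply: leq_trans (pad_degr _ _ _) _].
  have [x xU dx] : exists2 x, x \in U & deg e x U <= 3.
    apply: dg; apply/set0Pn; case: u uS => [x|a] uS; first by exists x; rewrite inE.
    have : a \in D by rewrite inE.
    by rewrite D0 inE.
  by exists (inl x); [rewrite inE|rewrite pad_degl].
- move=> [x|a] [y|b] [z|c] //=; first exact: tf.
  by move: a b c => [[|[]] // ?] [[|[]] // ?] [[|[]] // ?].
Qed.

End Padding.

(** * Vertex sets of arbitrary size *)

Section ArbitraryOrder.
Variables (T : finType).
Implicit Types (e : rel T) (A B N S U V W : {set T}) (f g : T -> nat).

Definition equitably_colorable e U k := exists f,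
  [/\ forall x, x \in U -> f x < k, proper e f U &
      forall i, i < k -> #|U| %/ k <= #|cls f U i| <= #|U| %/ k + 1].

Lemma balanced_equitable e U k t : 0 < k -> balanced e U k t -> equitably_colorable e U k.
Proof.
move=> k0 gU; have cU := balanced_card gU; case: gU => f [f1 f2 f3]; exists f; split=> // i ik.
by rewrite cU mulKn // f3 // leqnn leq_addr.
Qed.

Lemma sparse_nE e U k t : sparse e -> 6 <= k -> 0 < t -> #|U| = k * t ->
  nE e U U + 8 <= 4 * (k * t).
Proof. by move=> sp k6 t0 cU; rewrite -cU; apply: sp; rewrite cU; nia. Qed.

(** Two new vertices are adjacent, hence in different classes, so removing them costs each class at
    most one vertex. *)
Lemma padded_equitable e U k (D : {set 'I_2}) : tfgraph e -> sparse e -> 6 <= k ->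
  (forall v, v \in U -> deg e v U <= k) ->
  0 < #|D| -> #|U| %% k + #|D| = k -> equitably_colorable e U k.
Proof.
move=> tfg sp k6 dE D0 rD; pose t := #|U| %/ k + 1.
have D2 : #|D| <= 2 by have := max_card (mem D); rewrite card_ord.
have cU : #|U| + #|D| = k * t.
  by rewrite /t {1}(divn_eq #|U| k) mulnDr muln1 mulnC; clear - rD; lia.
have U3 : 2 < #|U|.
  by apply: leq_trans (leq_mod #|U| k); clear - rD D2 k6; lia.
have eE := sp U U3.
have [f [f1 f2 f3]] : balanced (padded e) (pad_set U D) k t.
  apply: balanced_main => //; first by rewrite pad_card.
  - exact: pad_tfgraph.
  - by have := pad_nE e U D; clear - eE cU D0; lia.
  - move=> [x|a] vU; first by rewrite pad_degl dE //; rewrite inE in vU.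
    by apply: leq_trans (pad_degr _ _ _ _) _; clear - k6; lia.
exists (f \o inl); split.
- by move=> x xU; apply: f1; rewrite inE.
- by move=> x y xU yU exy; apply: f2; rewrite ?inE.
move=> i ik; have := f3 i ik.
have -> : cls f (pad_set U D) i = pad_set (cls (f \o inl) U i) [set a in D | f (inr a) == i].
  by apply/setP => -[x|a]; rewrite !inE.
rewrite pad_card; suff : #|[set a in D | f (inr a) == i]| <= 1.
  by rewrite /t; clear; lia.
apply/card_le1_eqP => a b; rewrite !inE => /andP[aD /eqP fa] /andP[bD /eqP fb].
apply/eqP; apply: contraTT isT => ab.
have : f (inr b) != f (inr a) by apply: f2; rewrite ?inE //= eq_sym.
by rewrite fa fb eqxx.
Qed.

Lemma sparse_equitable e U k : tfgraph e -> sparse e -> 6 <= k ->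
  (forall v, v \in U -> deg e v U <= k) -> equitably_colorable e U k.
Proof.
move=> tfg sp k6; have [sym irr dg tf] := tfg; have k0 : 0 < k by clear - k6; lia.
have [m] := ubnP #|U|; elim: m U => // m IH U cUm dE.
have Ek := divn_eq #|U| k; have rk := ltn_pmod #|U| k0.
set q := #|U| %/ k in Ek; set r := #|U| %% k in Ek rk.
case: (posnP r) => [r0|r0].
  apply: (@balanced_equitable e U k q) => //; case: (posnP q) => q0.
    have U0 : U = set0 by apply/eqP; rewrite -cards_eq0 Ek r0 q0.
    rewrite U0; exists (fun=> 0); split; try by move=> x; rewrite inE.
    by move=> i _; rewrite q0; apply/eqP; rewrite cards_eq0; apply/eqP/setP => x; rewrite !inE.
  have cU : #|U| = k * q by rewrite Ek r0 addn0 mulnC.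
  by apply: balanced_main => //; apply: sparse_nE.
case: (ltnP (r + 2) k) => rk2; last first.
  have [E|E] : r + 1 = k \/ r + 2 = k by clear - rk rk2; lia.
    by apply: (@padded_equitable e U k [set ord0]) => //; rewrite cards1.
  by apply: (@padded_equitable e U k setT) => //; rewrite cardsT card_ord.
have U0 : U != set0 by rewrite -card_gt0 Ek; clear - r0; lia.
have [x xU dx] := dg U U0.
have sub := subsetDl U [set x].
have cUx : #|U :\ x|.+1 = #|U| by rewrite [RHS](cardsD1 x) xU.
have EUx : #|U :\ x| = q * k + r.-1 by clear - cUx Ek r0; lia.
have qx : #|U :\ x| %/ k = q.
  by rewrite EUx divnMDl // divn_small ?addn0 //; clear - rk; lia.
have [||f [f1 f2]] := IH (U :\ x).
- by clear - cUm cUx; lia.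
- by move=> v /(subsetP sub) vU; apply: leq_trans (dE v vU); apply: deg_sub.
rewrite qx => f3.
pose K := [seq i <- iota 0 k | #|cls f (U :\ x) i| == q].
(* There are r - 1 classes of size q + 1, hence k - r + 1 of size q, and r + 2 < k. *)
have sK : 4 <= size K.
  have sc := cls_sum f1.
  have : \sum_(i < k) #|cls f (U :\ x) i| + size K = \sum_(i < k) (q + 1).
    rewrite size_filter -sum1_count -(big_mkord xpredT (fun i => #|cls f (U :\ x) i|)).
    rewrite -(big_mkord xpredT (fun=> q + 1)) /index_iota subn0 [X in _ + X = _]big_mkcond /= -big_split.
    rewrite big_seq [RHS]big_seq; apply: eq_bigr => i; rewrite mem_iota add0n /= => ik.
    by have := f3 i ik; case: eqP; clear; lia.
  rewrite sc EUx sum_nat_const card_ord; clear - rk2 r0 rk; nia.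
have [i ik [ci xi]] : exists2 i, i < k & #|cls f (U :\ x) i| = q /\
    forall v, v \in U :\ x -> e x v -> f v != i.
  case: (boolP (all (fun i => [exists v in U :\ x, e x v && (f v == i)]) K)) => [/allP H|].
    have : size K <= deg e x (U :\ x).
      apply: (@deg_colors _ e f); first by rewrite filter_uniq // iota_uniq.
      by move=> j /H /exists_inP[v vU /andP[xv /eqP fv]]; exists v.
    have := deg_sub e x sub; clear - sK dx; lia.
  case/allPn => i; rewrite mem_filter mem_iota add0n => /andP[/eqP ci ik].
  rewrite negb_exists_in => /forall_inP H; exists i => //; split=> // v vU xv.
  by have := H v vU; rewrite xv.
have xV v : v \in U -> v != x -> v \in U :\ x by move=> vU vx; rewrite !inE vx.
exists (fun v => if v == x then i else f v); split.
- by move=> v vU; case: (eqVneq v x) => // vx; apply/f1/xV.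
- move=> u v uU vU; case: (eqVneq u x) => [->|ux]; case: (eqVneq v x) => [->|vx].
  + by rewrite irr.
  + by move/(xi v (xV v vU vx)); rewrite eq_sym.
  + by rewrite sym; move/(xi u (xV u uU ux)).
  + by apply: f2; apply: xV.
move=> j jk; rewrite cls_add // -/q; have := f3 j jk; case: eqP => [->|_]; last by rewrite addn0.
by rewrite ci; clear; lia.
Qed.

End ArbitraryOrder.

(** * Euler's inequality for minors of the grid *)

Section Grid.
Local Open Scope ring_scope.
Notation P := (nat * nat)%type.
Implicit Types p q a b : P.

Lemma addF2 (x : 'F_2) : x + x = 0.
Proof. by apply: val_inj; case: x => [[|[|]]]. Qed.

Lemma addF2_eq0 (x y : 'F_2) : (x + y == 0) = (x == y).
Proof. by rewrite -(addF2 y) (inj_eq (addIr y)). Qed.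

Definition nb p : seq P := [:: (p.1.+1, p.2); (p.1.-1, p.2); (p.1, p.2.+1); (p.1, p.2.-1)]%N.
(** At coordinate 0 the predecessor is truncated and [nb] lists a point as its own neighbor, so only
    points with positive coordinates serve as grid points. *)
Definition pos p := (0 < p.1)%N && (0 < p.2)%N.
Definition gadj p q := [&& pos p, pos q & q \in nb p].

Lemma gadj_sym : symmetric gadj.
Proof.
case=> [i j] [i' j']; rewrite /gadj /pos !inE !xpair_eqE /=.
apply/idP/idP => /and3P[/andP[a1 a2] /andP[a3 a4] H]; apply/and3P; split; try apply/andP; try by split.
  by move: H; lia.
by move: H; lia.
Qed.

Lemma nb_uniq p : pos p -> uniq (nb p).
Proof. by case: p => [i j]; rewrite /pos /= !inE !xpair_eqE => H; lia. Qed.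

Lemma gadj_neq p q : gadj p q -> p != q.
Proof.
case: p q => [i j] [i' j']; by rewrite /gadj /pos !inE !xpair_eqE /= => /and3P[/andP[a1 a2] _ H]; lia.
Qed.

(* The square [(i, j)] has the point [(i, j)] as its upper right corner; the
   two squares [fst (sides p q)] and [snd (sides p q)] lie on the two sides of the grid edge [pq]. *)
Definition sides p q : P * P :=
  if (p.2 == q.2)%N then let i := minn p.1 q.1 in ((i.+1, p.2.+1), (i.+1, p.2))
  else let j := minn p.2 q.2 in ((p.1, j.+1), (p.1.+1, j.+1)).

Definition side_sum (Phi : P -> 'F_2) p q := Phi (sides p q).1 + Phi (sides p q).2.

Lemma sides_sym p q : gadj p q -> sides p q = sides q p.
Proof.
case: p q => [i j] [i' j']; rewrite /gadj /pos !inE !xpair_eqE /= => /and3P[_ _ H].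
rewrite /sides /= (eq_sym j' j); case: (eqVneq j j') => [->|jj]; first by rewrite minnC.
have -> : i = i' by lia.
by rewrite /= minnC.
Qed.

(** Each of the four squares around [p] lies beside two of the four edges at [p]. *)
Lemma dif_closed Phi p : pos p -> \sum_(q <- nb p) side_sum Phi p q = 0.
Proof.
case: p => [[|i] [|j]] //= _; rewrite !big_cons big_nil /side_sum /sides /= !eqxx.
have -> : (j.+1 == j.+2)%N = false by lia.
have -> : (j.+1 == j)%N = false by lia.
have m1 : minn i.+1 i.+2 = i.+1 by lia.
have m2 : minn i.+1 i = i by lia.
have m3 : minn j.+1 j.+2 = j.+1 by lia.
have m4 : minn j.+1 j = j by lia.
rewrite /= m1 m2 m3 m4 addr0.
set A := Phi _; set B := Phi _; set C := Phi _; set D := Phi (i.+1, j.+1).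
have -> : A + B + (C + D + (C + A + (D + B))) = (A + A) + (B + B) + ((C + C) + (D + D)) by ring.
by rewrite !addF2.
Qed.

Section Potential.
Variable (c : P -> P -> 'F_2).
Hypotheses (csym : forall p q, c p q = c q p) (cpos : forall p q, c p q != 0 -> pos p && pos q)
  (cev : forall p, pos p -> \sum_(q <- nb p) c p q = 0).

(* The parity of the number of edges of the chain met by a leftward ray. *)
Definition potential (s : P) : 'F_2 :=
  if s.2 is j.+1 then \sum_(i < s.1) c (i : nat, j) (i : nat, j.+1) else 0.

(** For a vertical edge the two sums differ by the term of that edge alone. For horizontal edges,
    induction along the row from the border, where [c] vanishes, with the evenness of [c] at the
    common end of consecutive edges. *)
Lemma potentialP p q : gadj p q -> side_sum potential p q = c p q.
Proof.
have c0 i j q' : ~~ pos (i, j) -> c (i, j) q' = 0.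
  by move=> np; apply: contraNeq np => /cpos/andP[].
have hor i j : side_sum potential (i, j.+1) (i.+1, j.+1) = c (i, j.+1) (i.+1, j.+1).
  rewrite /side_sum /sides /= eqxx; have -> : minn i i.+1 = i by lia.
  elim: i => [|i IH].
    by rewrite /potential /= !big_ord1 !c0 ?addr0.
  move: IH; rewrite /potential /= !(big_ord_recr i.+1) /=.
  have := cev (p := (i.+1, j.+1)) isT; rewrite !big_cons big_nil /= addr0.
  rewrite (csym (i.+1, j.+1) (i, j.+1)) (csym (i.+1, j.+1) (i.+1, j)).
  set x1 := c _ _; set x2 := c _ _; set x3 := c _ _; set x4 := c _ _ => E.
  set S1 := \sum_(i0 < _) _; set S2 := \sum_(i0 < _) _ => IH.
  by rewrite addrACA IH; apply/esym/eqP; rewrite -addF2_eq0 E.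
have ver i j : side_sum potential (i, j) (i, j.+1) = c (i, j) (i, j.+1).
  rewrite /side_sum /sides /=; have -> : (j == j.+1)%N = false by lia.
  have -> /= : minn j j.+1 = j by lia.
  by rewrite /potential /= big_ord_recr /= addrA addF2 add0r.
move=> pq; have := pq; case: p q pq => [i j] [i' j'] pq.
rewrite /gadj !inE !xpair_eqE /= => /and3P[/andP[/= i0 j0] /andP[/= i0' j0']].
have dsym : side_sum potential (i, j) (i', j') = side_sum potential (i', j') (i, j).
  by rewrite /side_sum sides_sym.
case/or4P => /andP[/eqP ei /eqP ej]; subst i' j'.
- by case: j j0 {j0' dsym pq} => // j _; apply: hor.
- rewrite dsym csym; case: i j i0 j0 {i0' j0' pq dsym} => [|i] [|j] // _ _; exact: hor.
- exact: ver.
- rewrite dsym csym; case: j j0 {j0' pq dsym} => // j _; exact: ver.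
Qed.
End Potential.

Definition estep a b p q : 'F_2 := (((p, q) == (a, b)) + ((p, q) == (b, a)))%:R.

(** Multiplicities are taken mod 2: edges that a walk repeats cancel, so walks need not be
    simple. *)
Fixpoint chain a (s : seq P) p q : 'F_2 :=
  if s is b :: s' then estep a b p q + chain b s' p q else 0.

Lemma estep_sym a b p q : estep a b p q = estep a b q p.
Proof. by rewrite /estep !xpair_eqE addnC; congr (_%:R); congr (_ + _)%N; rewrite andbC. Qed.

Lemma chain_sym a s p q : chain a s p q = chain a s q p.
Proof. by elim: s a => //= b s IH a; rewrite estep_sym IH. Qed.

Lemma sum_nb (s : seq P) b : uniq s -> \sum_(q <- s) (q == b)%:R = (b \in s)%:R :> 'F_2.
Proof.
move=> us; rewrite -natr_sum; congr (_%:R); rewrite -(count_uniq_mem b us) -sum1_count.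
by rewrite [RHS]big_mkcond; apply: eq_bigr => q _ /=; case: (q == b).
Qed.

Lemma estep_bd a b p : gadj a b -> pos p -> \sum_(q <- nb p) estep a b p q = ((p == a) + (p == b))%:R.
Proof.
move=> ab pp; have ba : gadj b a by rewrite gadj_sym.
have un := nb_uniq pp; rewrite /estep.
rewrite (eq_bigr (fun q => (p == a)%:R * (q == b)%:R + (p == b)%:R * (q == a)%:R)); last first.
  by move=> q _; rewrite -!natrM -natrD !xpair_eqE !mulnb.
rewrite big_split -!big_distrr /= !sum_nb // natrD.
congr (_ + _).
  by case: eqP => [->|_]; rewrite ?mul0r // mul1r; case/and3P: ab => _ _ ->.
by case: eqP => [->|_]; rewrite ?mul0r // mul1r; case/and3P: ba => _ _ ->.
Qed.

Lemma chain_bd a s p : path gadj a s -> pos p ->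
  \sum_(q <- nb p) chain a s p q = (p == a)%:R + (p == last a s)%:R.
Proof.
move=> + pp; elim: s a => [|b s IH] a /=; first by rewrite big1 // addF2.
case/andP => ab pth; rewrite big_split /= IH // estep_bd // natrD.
by rewrite -addrA; congr (_ + _); rewrite addrA addF2 add0r.
Qed.

Lemma estep_supp a b p q : estep a b p q != 0 -> (p, q) = (a, b) \/ (p, q) = (b, a).
Proof. by rewrite /estep; case: ((p, q) =P (a, b)); [left|case: ((p, q) =P (b, a)); [right|rewrite eqxx]]. Qed.

Lemma chain_supp a s p q : path gadj a s -> chain a s p q != 0 ->
  [/\ p \in a :: s, q \in a :: s & gadj p q].
Proof.
elim: s a => [|b s IH] a /=; first by move=> _ /eqP.
case/andP => ab pth; case: (eqVneq (chain b s p q) 0) => [->|/(IH b pth)[h1 h2 h3] _].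
  rewrite addr0 => /estep_supp[] [-> ->]; rewrite !inE !eqxx ?orbT; split=> //.
  by rewrite gadj_sym.
by split=> //; rewrite inE ?h1 ?h2 orbT.
Qed.

Lemma sum_sym0 (s : seq P) (g : P -> P -> 'F_2) : (forall p q, g p q = g q p) ->
  (forall p, g p p = 0) -> \sum_(p <- s) \sum_(q <- s) g p q = 0.
Proof.
move=> gs g0; elim: s => [|a s IH]; first by rewrite big_nil.
rewrite big_cons big_cons g0 add0r.
rewrite [X in _ + X](eq_bigr (fun p => g a p + \sum_(q <- s) g p q)); last first.
  by move=> p _; rewrite big_cons gs.
by rewrite big_split /= IH addr0 addF2.
Qed.

End Grid.

(** * Faces of a graph modelled in the grid *)

Section Model.
Local Arguments nb : simpl never.
Local Open Scope ring_scope.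
Notation P := (nat * nat)%type.
Variables (T : finType) (e : rel T) (S : {set T}).
(** The branch set of [x] is [pts x], with center [r x]. Inside it [s x y] leads from the center to
    the point [a x y], which is joined by a grid edge to the branch set of [y]. Coordinates above 1
    keep all neighbors of these points positive. *)
Variables (pts : T -> seq P) (r : T -> P) (s : T -> T -> seq P).
Hypotheses (sym : symmetric e) (irr : irreflexive e).
Let a x y := last (r x) (s x y).
Hypotheses (rP : forall x, r x \in pts x)
  (pts_pos : forall x p, p \in pts x -> (1 < p.1)%N && (1 < p.2)%N)
  (pts_inj : forall x y p, p \in pts x -> p \in pts y -> x = y)
  (sP : forall x y, e x y -> path gadj (r x) (s x y))
  (s_pts : forall x y, e x y -> {subset s x y <= pts x})
  (link : forall x y, e x y -> gadj (a x y) (a y x)).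

Let a_pts x y : e x y -> a x y \in pts x.
Proof.
move=> exy; have : a x y \in r x :: s x y by apply: mem_last.
by rewrite inE => /orP[/eqP->//|/(s_pts exy)].
Qed.

Let pts_pos1 x p : p \in pts x -> pos p.
Proof. by move=> /pts_pos; rewrite /pos; case: p => i j /=; lia. Qed.

Let nb_gadj x p q : p \in pts x -> q \in nb p -> gadj p q.
Proof.
move=> px qp; apply/and3P; split=> //; first exact: pts_pos1 px.
move: (pts_pos px) qp; case: p q {px} => [i j] [i' j'].
by rewrite /pos /nb !inE !xpair_eqE /=; lia.
Qed.

(* The grid edges that are kept: those inside a branch set [pts x], and one edge
   for each edge of the graph induced on [S]. *)
Definition model_edge (p q : P) := (exists x, p \in pts x /\ q \in pts x) \/
  (exists x y, [/\ x \in S, y \in S, e x y & p = a x y /\ q = a y x]).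

Definition face_fun (Phi : P -> 'F_2) :=
  forall p q, gadj p q -> ~ model_edge p q -> side_sum Phi p q = 0.

(* Faces are defined by duality, which avoids paths of squares. *)
Definition same_face (c d : P) := forall Phi, face_fun Phi -> Phi c = Phi d.

(** Every face function agrees on the two squares beside an edge that is not kept, so these squares
    belong to the same face. *)
Lemma face_fun_ind c : face_fun (fun d => (boolp.asbool (same_face c d))%:R).
Proof.
move=> p q pq nH; rewrite /side_sum; set A := (sides p q).1; set B := (sides p q).2.
have AB Phi : face_fun Phi -> Phi A = Phi B.
  by move=> /(_ p q pq nH)/eqP; rewrite addF2_eq0 => /eqP.
have -> : boolp.asbool (same_face c A) = boolp.asbool (same_face c B).
  apply/boolp.asboolP/boolp.asboolP => H Phi fP; first by rewrite -AB // H.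
  by rewrite AB // H.
exact: addF2.
Qed.

Definition oriented_edges : {set T * T} :=
  [set p | [&& p.1 \in S, p.2 \in S, e p.1 p.2 & (enum_rank p.1 < enum_rank p.2)%N]].

Definition endpoint (p : T * T) v := (p.1 == v) || (p.2 == v).

Definition jump (Phi : P -> 'F_2) (p : T * T) := side_sum Phi (a p.1 p.2) (a p.2 p.1).

Let edges_e p : p \in oriented_edges -> e p.1 p.2.
Proof. by rewrite inE => /and4P[]. Qed.

Let jump_sym Phi x y : e x y -> jump Phi (x, y) = jump Phi (y, x).
Proof. by move=> exy; rewrite /jump /side_sum /= (sides_sym (link exy)). Qed.

Let sum_edges v (g : T * T -> 'F_2) : v \in S -> (forall x y, e x y -> g (x, y) = g (y, x)) ->
  \sum_(p in oriented_edges) (endpoint p v)%:R * g p = \sum_(w | (w \in S) && e v w) g (v, w).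
Proof.
move=> vS gs; rewrite big_mkcond /=.
rewrite (eq_bigr (fun p : T * T => (p.1 == v)%:R * (p \in oriented_edges)%:R * g p +
   (p.2 == v)%:R * (p \in oriented_edges)%:R * g p)); last first.
  case=> x y _; case: ifP => [|_]; last by rewrite !mulr0 !mul0r addr0.
  move=> /edges_e /= exy; rewrite /endpoint /= !mulr1 -mulrDl; congr (_ * _).
  case: (eqVneq x v) => [xv|_]; case: (eqVneq y v) => [yv|_]; rewrite ?addr0 ?add0r //.
  by move: exy; rewrite xv yv irr.
rewrite (_ : \sum_(p : T * T) _ = \sum_x \sum_y ((x == v)%:R * ((x, y) \in oriented_edges)%:R * g (x, y) +
   (y == v)%:R * ((x, y) \in oriented_edges)%:R * g (x, y))); last first.
  by rewrite pair_bigA; apply: eq_bigr => -[x y].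
rewrite (eq_bigr (fun x => \sum_y (x == v)%:R * (((x, y) \in oriented_edges)%:R * g (x, y)) +
   \sum_y (y == v)%:R * (((x, y) \in oriented_edges)%:R * g (x, y)))); last first.
  by move=> x _; rewrite -big_split; apply: eq_bigr => y _; rewrite !mulrA.
rewrite big_split /= [X in _ + X]exchange_big /=.
have pick1 (F : T -> T -> 'F_2) : \sum_x \sum_y (x == v)%:R * F x y = \sum_y F v y.
  rewrite (bigD1 v) //= [X in _ + X]big1 ?addr0.
    by apply: eq_bigr => y _; rewrite eqxx mul1r.
  by move=> x xv; apply: big1 => y _; rewrite (negbTE xv) mul0r.
rewrite (pick1 (fun x y => ((x, y) \in oriented_edges)%:R * g (x, y))).
rewrite (pick1 (fun y x => ((x, y) \in oriented_edges)%:R * g (x, y))).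
rewrite -big_split [RHS]big_mkcond /=; apply: eq_bigr => w _.
rewrite !inE /= vS ?andbT /= (sym w v).
case wS: (w \in S) => /=; last by rewrite !mul0r addr0.
case evw: (e v w); last by rewrite !mul0r addr0.
rewrite (gs v w) // -mulrDl /=; case: (ltngtP (enum_rank v) (enum_rank w)) => [||E].
- by rewrite mulr1n mulr0n addr0 mul1r.
- by rewrite mulr1n mulr0n add0r mul1r.
- by move: evw; rewrite (enum_rank_inj (val_inj E)) irr.
Qed.

(** Add the identities of [dif_closed] over the branch set of [v]. Edges inside it occur twice and
    cancel; among the edges that leave it only the kept ones contribute, and there is one for each
    edge of the induced graph at [v]. *)
Lemma face_fun_even Phi v : face_fun Phi -> v \in S ->
  \sum_(p in oriented_edges) (endpoint p v)%:R * jump Phi p = 0.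
Proof.
move=> fP vS; rewrite sum_edges //; last by move=> x y; apply: jump_sym.
pose D := undup (pts v).
have Dv p : (p \in D) = (p \in pts v) by rewrite mem_undup.
have : \sum_(p <- D) \sum_(q <- nb p) side_sum Phi p q = 0.
  rewrite big_seq big1 // => p; rewrite Dv => pv; apply: dif_closed; exact: pts_pos1 pv.
under eq_bigr do rewrite (bigID (mem D)) /=.
rewrite big_split /=.
have -> : \sum_(p <- D) \sum_(q <- nb p | q \in D) side_sum Phi p q = 0.
  rewrite -[RHS](@sum_sym0 D (fun p q => (gadj p q)%:R * side_sum Phi p q)); last first.
  - by move=> p; rewrite /gadj; case: (boolP (gadj p p)) => [/gadj_neq|/negbTE]; rewrite ?eqxx // /gadj => ->; rewrite mul0r.
  - move=> p q; rewrite gadj_sym; case qp: (gadj q p); last by rewrite !mul0r.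
    by rewrite /side_sum sides_sym // gadj_sym.
  rewrite big_seq [RHS]big_seq; apply: eq_bigr => p; rewrite Dv => pv.
  rewrite -big_filter (perm_big [seq q <- D | q \in nb p]); last first.
    apply: uniq_perm; rewrite ?filter_uniq ?undup_uniq ?nb_uniq //; first exact: pts_pos1 pv.
    by move=> q; rewrite !mem_filter andbC.
  rewrite big_filter big_mkcond /= big_seq [RHS]big_seq; apply: eq_bigr => q; rewrite Dv => qv.
  rewrite /gadj (pts_pos1 pv) (pts_pos1 qv) /=.
  by case: ifP => _; rewrite ?mul1r ?mul0r.
rewrite add0r => H0; apply: etrans _ H0.
have key p q : p \in pts v -> q \in nb p -> q \notin D ->
    side_sum Phi p q = \sum_(w | (w \in S) && e v w) (p == a v w)%:R * (q == a w v)%:R * jump Phi (v, w).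
  move=> pv qp; rewrite Dv => qv.
  case: (boolp.EM (model_edge p q)) => [[[x [px qx]]|[x [y [xS yS exy [pa qa]]]]]|nH].
  - by rewrite -(pts_inj px pv) qx in qv.
  - have xv : x = v by apply: pts_inj (a_pts exy) _; rewrite -pa.
    subst x; rewrite (bigD1 y) /=; last by rewrite yS.
    rewrite -pa -qa !eqxx !mul1r big1 ?addr0; first by rewrite /jump /= -pa -qa.
    move=> w /andP[/andP[wS evw] wy]; case: (q =P a w v) => [E|]; last by rewrite mulr0 mul0r.
    case/eqP: wy; apply: pts_inj (a_pts (_ : e w v)) _; first by rewrite sym.
    by rewrite -E qa; apply: a_pts; rewrite sym.
  - rewrite fP //; last exact: nb_gadj pv qp.
    rewrite big1 // => w /andP[wS evw].
    case: (p =P a v w) => [E1|]; last by rewrite !mul0r.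
    case: (q =P a w v) => [E2|]; last by rewrite mulr0 mul0r.
    by case: nH; right; exists v, w.
rewrite [RHS]big_seq [RHS](eq_bigr (fun p => \sum_(q <- nb p | q \notin D)
   \sum_(w | (w \in S) && e v w) (p == a v w)%:R * (q == a w v)%:R * jump Phi (v, w))); last first.
  move=> p; rewrite Dv => pv; rewrite -big_filter -[RHS]big_filter.
  by apply: eq_big_seq => q; rewrite mem_filter => /andP[qD qp]; apply: key.
rewrite -big_seq; under [RHS]eq_bigr do rewrite exchange_big /=.
rewrite [RHS]exchange_big /=; apply: eq_bigr => w /andP[wS evw].
have avw := a_pts evw.
rewrite (bigD1_seq (a v w)) /= ?undup_uniq ?Dv // [X in _ + X]big1 ?addr0; last first.
  by move=> p pw; apply: big1 => q _; rewrite (negbTE pw) !mul0r.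
rewrite eqxx -big_filter; under eq_bigr do rewrite mul1r.
have ewv : e w v by rewrite sym.
have aD : a w v \notin D.
  rewrite Dv; apply/negP => h; move: evw.
  by rewrite (pts_inj (a_pts ewv) h) irr.
rewrite -big_distrl sum_nb ?filter_uniq ?nb_uniq //; last exact: pts_pos1 avw.
rewrite mem_filter aD /=; have /and3P[_ _ ->] := link evw.
by rewrite mul1r.
Qed.

(** Replace each edge [xy] by the grid walk from [r x] to [r y] through both branch sets. Weighted
    by [z], these walks form a chain that is even at every point and supported on kept edges, so its
    potential is a face function with the prescribed jumps. *)
Lemma even_potential (z : T * T -> 'F_2) :
  (forall v, v \in S -> \sum_(p in oriented_edges) (endpoint p v)%:R * z p = 0) ->
  exists2 Phi, face_fun Phi & forall p, p \in oriented_edges -> jump Phi p = z p.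
Proof.
move=> zev.
pose X (i : T * T) p q := chain (r i.1) (s i.1 i.2) p q + chain (r i.2) (s i.2 i.1) p q
  + estep (a i.1 i.2) (a i.2 i.1) p q.
pose c p q := \sum_(i in oriented_edges) z i * X i p q.
have csym p q : c p q = c q p.
  by apply: eq_bigr => i _; rewrite /X !(chain_sym _ _ p q) estep_sym.
have inpts x y p : e x y -> p \in r x :: s x y -> p \in pts x.
  by move=> exy; rewrite inE => /orP[/eqP->//|/(s_pts exy)].
have csupp p q : c p q != 0 -> gadj p q /\ model_edge p q.
  move=> cpq; have [i iE Xi] : exists2 i, i \in oriented_edges & X i p q != 0.
    apply/exists_inP; apply: contraNT cpq; rewrite negb_exists_in => /forall_inP H.
    by apply/eqP/big1 => i /H; rewrite negbK => /eqP->; rewrite mulr0.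
  have e1 := edges_e iE; have e2 : e i.2 i.1 by rewrite sym.
  case: (eqVneq (chain (r i.1) (s i.1 i.2) p q) 0) => [c1|/(chain_supp (sP e1))[h1 h2 h3]]; last first.
    by split=> //; left; exists i.1; split; apply: inpts e1 _.
  case: (eqVneq (chain (r i.2) (s i.2 i.1) p q) 0) => [c2|/(chain_supp (sP e2))[h1 h2 h3]]; last first.
    by split=> //; left; exists i.2; split; apply: inpts e2 _.
  move: Xi; rewrite /X c1 c2 !add0r; move: iE; rewrite inE => /and4P[i1 i2 _ _].
  move/estep_supp => [] [-> ->].
    by split; [apply: link|right; exists i.1, i.2].
  by split; [apply: link|right; exists i.2, i.1].
have cpos p q : c p q != 0 -> pos p && pos q.
  by move=> /csupp[/and3P[-> ->]].
have cev p : pos p -> \sum_(q <- nb p) c p q = 0.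
  move=> pp; rewrite exchange_big /=.
  rewrite (eq_bigr (fun i : T * T => ((p == r i.1)%:R + (p == r i.2)%:R) * z i)); last first.
    move=> i /edges_e e1; have e2 : e i.2 i.1 by rewrite sym.
    rewrite -big_distrr /= mulrC; congr (_ * _).
    rewrite !big_split /= (chain_bd (sP e1)) // (chain_bd (sP e2)) // estep_bd ?link // natrD.
    rewrite -/(a i.1 i.2) -/(a i.2 i.1).
    set u1 := (p == r i.1)%:R; set u2 := (p == r i.2)%:R; set u3 := (p == a _ _)%:R.
    set u4 := (p == a _ _)%:R.
    have -> : u1 + u3 + (u2 + u4) + (u3 + u4) = u1 + u2 + ((u3 + u3) + (u4 + u4)) by ring.
    by rewrite !addF2 addr0.
  case: (boolP [exists v in S, p == r v]) => [/exists_inP[v vS /eqP pv]|].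
    rewrite -[RHS](zev v vS); apply: eq_bigr => i iE; congr (_ * _).
    have rv x : (p == r x) = (x == v).
      apply/eqP/eqP => [E|->//]; apply: pts_inj (rP x) _; by rewrite -E pv.
    rewrite !rv /endpoint; have e1 := edges_e iE.
    case: (eqVneq i.1 v) => [xv|_]; case: (eqVneq i.2 v) => [yv|_]; rewrite ?addr0 ?add0r //.
    by move: e1; rewrite xv yv irr.
  rewrite negb_exists_in => /forall_inP H; apply: big1 => i; rewrite inE => /and4P[i1 i2 _ _].
  by rewrite (negbTE (H _ i1)) (negbTE (H _ i2)) addr0 mul0r.
have pot p q : gadj p q -> side_sum (potential c) p q = c p q by apply: potentialP.
exists (potential c).
  move=> p q pq nH; rewrite pot //; apply/eqP; apply: contraT => /csupp[_ /nH//].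
move=> p pE; have ep := edges_e pE; rewrite /jump pot ?link //.
have ep' : e p.2 p.1 by rewrite sym.
have nin x : ~ (a p.1 p.2 \in pts x /\ a p.2 p.1 \in pts x).
  move=> [h1 h2]; move: (ep).
  by rewrite (pts_inj (a_pts ep) h1) (pts_inj (a_pts ep') h2) irr.
have ch0 x y : e x y -> chain (r x) (s x y) (a p.1 p.2) (a p.2 p.1) = 0.
  move=> exy; apply/eqP; apply: contraT => /(chain_supp (sP exy))[h1 h2 _].
  by case: (nin x); split; apply: inpts exy _.
rewrite /c (bigD1 p) //= big1 ?addr0.
  rewrite /X !ch0 // !add0r /estep eqxx xpair_eqE.
  suff -> : (a p.1 p.2 == a p.2 p.1) = false by rewrite mulr1.
  by apply/negP => /eqP E; case: (nin p.1); rewrite -E; split; apply: a_pts.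
move=> i /andP[iE ip]; have ei := edges_e iE; have ei' : e i.2 i.1 by rewrite sym.
rewrite /X !ch0 // !add0r; apply/eqP; rewrite mulf_eq0; apply/orP; right.
apply: contraT => /estep_supp[] [E1 E2].
  have h1 : i.1 = p.1 by apply: pts_inj (a_pts ei) _; rewrite -E1; apply: a_pts.
  have h2 : i.2 = p.2 by apply: pts_inj (a_pts ei') _; rewrite -E2; apply: a_pts.
  by case/eqP: ip; rewrite (surjective_pairing i) (surjective_pairing p) h1 h2.
have x1 : p.1 = i.2 by apply: pts_inj (a_pts ep) _; rewrite E1; apply: a_pts.
have x2 : p.2 = i.1 by apply: pts_inj (a_pts ep') _; rewrite E2; apply: a_pts.
move: iE pE; rewrite !inE x1 x2 => /and4P[_ _ _ h1] /and4P[_ _ _ h2].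
by move: (ltn_trans h1 h2); rewrite ltnn.
Qed.

End Model.

(* The cycle space is the kernel of the incidence matrix [B]; it lies in the row
   space of the dual incidence matrix [D].  The rows of [D] add up to 0, each is a
   nonzero element of the cycle space, hence has at least four entries 1, and
   each column of [D] has at most two. *)
Section Dual.
Local Open Scope ring_scope.
Variables (T : finType) (S : {set T}) (Es : {set T * T}) (Q : Type) (l r : T * T -> Q)
  (ok : (Q -> 'F_2) -> Prop).
Let same c d := forall Phi, ok Phi -> Phi c = Phi d.
Hypotheses
  (okI : forall c, ok (fun d => (boolp.asbool (same c d))%:R))
  (okE : forall Phi v, ok Phi -> v \in S ->
     \sum_(p in Es) (endpoint p v)%:R * (Phi (l p) + Phi (r p)) = 0)
  (okP : forall z : T * T -> 'F_2,
     (forall v, v \in S -> \sum_(p in Es) (endpoint p v)%:R * z p = 0) ->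
     exists2 Phi, ok Phi & forall p, p \in Es -> Phi (l p) + Phi (r p) = z p)
  (girth : forall z : T * T -> 'F_2,
     (forall v, v \in S -> \sum_(p in Es) (endpoint p v)%:R * z p = 0) ->
     (exists2 p, p \in Es & z p != 0) -> (4 <= \sum_(p in Es) (z p != 0)%R)%N)
  (EsS : forall p, p \in Es -> [/\ p.1 \in S, p.2 \in S & p.1 != p.2]).

(** To obtain a finite index set, a face is represented by a pair of an edge and one of its two
    sides. *)
Let sq (f : (T * T) * bool) := if f.2 then l f.1 else r f.1.
Let rep f := odflt f [pick g | boolp.asbool (same (sq f) (sq g))].

Let repP f : same (sq f) (sq (rep f)).
Proof. by rewrite /rep; case: pickP => [g /boolp.asboolP|_ Phi]. Qed.

Let rep_eq f g : rep f = rep g <-> same (sq f) (sq g).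
Proof.
split=> [E|fg].
  by move=> Phi h; rewrite (repP f h) E -(repP g h).
rewrite /rep.
have -> : [pick h | boolp.asbool (same (sq f) (sq h))] = [pick h | boolp.asbool (same (sq g) (sq h))].
  apply: eq_pick => h; apply/boolp.asboolP/boolp.asboolP => H Phi hP.
    by rewrite -(fg Phi hP) H.
  by rewrite (fg Phi hP) H.
by case: pickP => // /(_ g)/boolp.asboolP[].
Qed.

Let z f p : 'F_2 := ((rep (p, true) == f) + (rep (p, false) == f))%:R.
(** Faces that lie on both sides or on neither side of every edge would give zero rows, to which the
    girth bound does not apply. *)
Let F : {set (T * T) * bool} :=
  [set f | [exists p in Es, (rep (p, true) == f) != (rep (p, false) == f)]].

Let z_neq0 f p : (z f p != 0) = ((rep (p, true) == f) != (rep (p, false) == f)).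
Proof. by rewrite /z; case: (_ == f); case: (_ == f). Qed.

Let z_even f v : f \in F -> v \in S -> \sum_(p in Es) (endpoint p v)%:R * z f p = 0.
Proof.
move=> fF vS; have [g fg] : exists g, rep g = f.
  move: fF; rewrite inE => /exists_inP[p _].
  case: (rep (p, true) =P f) => [|_]; first by exists (p, true).
  by case: (rep (p, false) =P f) => [|//]; exists (p, false).
rewrite -[RHS](okE (okI (sq f)) vS); apply: eq_bigr => p _; congr (_ * _).
have rE b : (rep (p, b) == f) = boolp.asbool (same (sq f) (sq (p, b))).
  apply/eqP/boolp.asboolP => [<-|H]; first by move=> Phi h; rewrite -(repP _ h).
  rewrite -fg; apply/rep_eq => Phi h; rewrite -(H Phi h) -fg; exact/esym/repP.
by rewrite /z !rE natrD.
Qed.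

Let z_sum (G : (T * T) * bool -> 'F_2) p : p \in Es ->
  \sum_(f in F) G f * z f p =
  if rep (p, true) == rep (p, false) then 0 else G (rep (p, true)) + G (rep (p, false)).
Proof.
move=> pE; case: (rep (p, true) =P rep (p, false)) => [E|/eqP nE].
  by apply: big1 => f _; rewrite /z E natrD addF2 mulr0.
have r1 : rep (p, true) \in F.
  by rewrite inE; apply/exists_inP; exists p; rewrite // eqxx eq_sym eqb_id eq_sym.
have r2 : rep (p, false) \in F.
  by rewrite inE; apply/exists_inP; exists p; rewrite // eqxx (negbTE nE).
rewrite (bigD1 (rep (p, true))) //= (bigD1 (rep (p, false))) /=; last first.
  by rewrite r2 eq_sym.
rewrite big1 ?addr0.
  by rewrite /z !eqxx (negbTE nE) eq_sym (negbTE nE) !mulr1.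
move=> f /andP[/andP[_ f1] f2]; rewrite /z eq_sym (negbTE f1) eq_sym (negbTE f2).
by rewrite mulr0.
Qed.

Lemma dual_edge_bound : (2 < #|S|)%N -> (#|Es| + 4 <= 2 * #|S|)%N.
Proof.
move=> S2.
pose B : 'M['F_2]_(#|Es|, #|S|) := \matrix_(i, v) (endpoint (enum_val i) (enum_val v))%:R.
pose D : 'M['F_2]_(#|F|, #|Es|) := \matrix_(f, i) z (enum_val f) (enum_val i).
have rank1 n : (0 < n)%N -> \rank (const_mx 1 : 'cV['F_2]_n) = 1%N.
  move=> n0; apply/eqP; rewrite eqn_leq rank_leq_col lt0n mxrank_eq0.
  apply/eqP => /matrixP/(_ (Ordinal n0) ord0); rewrite !mxE => /eqP; by rewrite oner_eq0.
have rankB : (\rank B + 1 <= #|S|)%N.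
  have S0 : (0 < #|S|)%N by apply: leq_trans S2.
  suff : B *m (const_mx 1 : 'cV_#|S|) = 0 by move/mulmx0_rank_max; rewrite rank1.
  apply/matrixP => i j; rewrite !mxE.
  have [h1 h2 h3] := EsS (enum_valP i).
  rewrite (eq_bigr (fun v => (endpoint (enum_val i) (enum_val v))%:R)); last first.
    by move=> v _; rewrite !mxE mulr1.
  rewrite -(big_enum_val (A := mem S) (fun v => (endpoint (enum_val i) v)%:R : 'F_2)) /=.
  rewrite (bigD1 (enum_val i).1) //= (bigD1 (enum_val i).2) /=; last by rewrite h2 eq_sym.
  rewrite /endpoint !eqxx orbT big1 ?addr0; first exact: addF2.
  by move=> v /andP[/andP[_ v1] v2]; rewrite eq_sym (negbTE v1) eq_sym (negbTE v2).
have rankD : (0 < #|F|)%N -> (\rank D + 1 <= #|F|)%N.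
  move=> F0; suff : (const_mx 1 : 'rV_#|F|) *m D = 0.
    by move/mulmx0_rank_max; rewrite -mxrank_tr trmx_const rank1 // addnC.
  apply/matrixP => i j; rewrite !mxE.
  rewrite (eq_bigr (fun f => 1 * z (enum_val f) (enum_val j))); last by move=> f _; rewrite !mxE.
  rewrite -(big_enum_val (A := mem F) (fun f => 1 * z f (enum_val j))) /=.
  rewrite (z_sum (fun=> 1)) ?enum_valP //; by case: ifP => // _; apply: addF2.
(* The values on the faces of a face function with jumps [x] are the coefficients of [x] in terms of
   the rows of [D]. *)
have kerD : (kermx B <= D)%MS.
  apply/rV_subP => x /sub_kermxP xB.
  pose x' p := \sum_(i < #|Es|) (enum_val i == p)%:R * x 0 i.
  have x'E i : x' (enum_val i) = x 0 i.
    rewrite /x' (bigD1 i) //= eqxx mul1r big1 ?addr0 // => j ji.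
    by rewrite (inj_eq enum_val_inj) (negbTE ji) mul0r.
  have [|Phi okPhi PhiE] := okP (z := x').
    move=> v vS; have /matrixP/(_ 0 (enum_rank_in vS v)) := xB; rewrite !mxE => H0; apply: etrans _ H0.
    have sE (G : T * T -> 'F_2) : \sum_(p in Es) G p = \sum_(i < #|Es|) G (enum_val i).
      exact: big_enum_val.
    rewrite sE; apply: eq_bigr => i _.
    by rewrite x'E mxE enum_rankK_in // mulrC.
  suff -> : x = (\row_f Phi (sq (enum_val f))) *m D by apply: submxMl.
  apply/matrixP => i j; rewrite !ord1 !mxE.
  rewrite (eq_bigr (fun f => Phi (sq (enum_val f)) * z (enum_val f) (enum_val j))); last first.
    by move=> f _; rewrite !mxE.
  rewrite -(big_enum_val (A := mem F) (fun f => Phi (sq f) * z f (enum_val j))) /=.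
  rewrite (z_sum (fun f => Phi (sq f))) ?enum_valP // -x'E -PhiE ?enum_valP //.
  rewrite -(repP (enum_val j, true) okPhi) -(repP (enum_val j, false) okPhi) /=.
  case: eqP => // /rep_eq/(_ Phi okPhi) /= ->; exact: addF2.
have rk := mxrankS kerD; rewrite mxrank_ker in rk.
have F4 : (4 * #|F| <= 2 * #|Es|)%N.
  apply: (@leq_trans (\sum_(f in F) \sum_(p in Es) (z f p != 0)%R)).
    apply: sum_ge => f fF; apply: girth => [v vS|]; first exact: z_even.
    move: fF; rewrite inE => /exists_inP[p pE pf]; exists p => //.
    by rewrite z_neq0.
  rewrite exchange_big /=; apply: sum_le => p pE.
  apply: (@leq_trans (\sum_(f in [set rep (p, true); rep (p, false)]) 1)); last first.
    by rewrite sum1_card cards2; case: eqP.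
  rewrite big_mkcond [X in (_ <= X)%N]big_mkcond /=; apply: leq_sum => f _.
  case: (f \in F) => //; rewrite !inE z_neq0 (eq_sym f) (eq_sym f).
  by case: (_ == f); case: (_ == f).
have rF : (#|F| = 0)%N -> (\rank D = 0)%N.
  by move=> F0; have := rank_leq_row D; rewrite {2}F0 leqn0 => /eqP.
(* Without rows there are at most [#|S| - 1] edges, which suffices because [#|S|] is at least 3.
   Otherwise the number of edges is at most [(#|S| - 1) + (#|F| - 1)], and [2 * #|F|] is at most the
   number of edges. *)
case: (posnP #|F|) => [F0|/rankD F1]; first by rewrite (rF F0) in rk; lia.
lia.
Qed.

End Dual.

(** * Even edge sets in triangle-free graphs *)

Section Girth.
Variables (T : finType) (e : rel T) (S : {set T}).
Hypotheses (sym : symmetric e) (irr : irreflexive e) (tf : triangle_free e).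

Lemma nE_edges : nE e S S = 2 * #|oriented_edges e S|.
Proof.
have cE : #|oriented_edges e S| = \sum_x \sum_y ((x, y) \in oriented_edges e S : nat).
  by rewrite pair_bigA -sum1_card big_mkcond /=; apply: eq_bigr => -[x y] _; case: (_ \in _).
rewrite mul2n -addnn {1}cE [X in X + _]exchange_big cE -big_split /=.
rewrite /nE big_mkcond; apply: eq_bigr => x _ /=; rewrite -big_split /=.
rewrite /deg; case xS: (x \in S); last first.
  by rewrite big1 // => y _; rewrite !inE /= xS andbF.
rewrite big_mkcond; apply: eq_bigr => y _ /=; rewrite !inE /= xS /= (sym y x).
case: (y \in S) => //=; case exy: (e x y) => //=.
case: (ltngtP (enum_rank x) (enum_rank y)) => // E.
by move: exy; rewrite (enum_rank_inj (val_inj E)) irr.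
Qed.

Lemma edges_ends p v : p \in oriented_edges e S -> endpoint p v ->
  exists w, [/\ e v w, endpoint p w & forall u, endpoint p u -> u = v \/ u = w].
Proof.
rewrite inE => /and4P[_ _ ep _] /orP[]/eqP E.
  exists p.2; rewrite -E ep /endpoint eqxx orbT; split=> // u /orP[]/eqP; by [left|right].
exists p.1; rewrite -E sym ep /endpoint eqxx; split=> // u /orP[]/eqP; by [right|left].
Qed.

Lemma edges_inj p q u v : p \in oriented_edges e S -> q \in oriented_edges e S -> u != v ->
  endpoint p u -> endpoint p v -> endpoint q u -> endpoint q v -> p = q.
Proof.
case: p q => [x y] [x' y']; rewrite !inE /endpoint /= => /and4P[_ _ _ l1] /and4P[_ _ _ l2] uv.
move=> /orP[]/eqP E1 /orP[]/eqP E2 /orP[]/eqP E3 /orP[]/eqP E4; subst => //;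
  try by rewrite eqxx in uv.
- by have := ltn_trans l1 l2; rewrite ltnn.
- by have := ltn_trans l1 l2; rewrite ltnn.
Qed.

Local Open Scope ring_scope.

(** By evenness each edge of the set continues at both of its ends: [p0 = xy] continues with [p1] at
    [x] and [p2] at [y], and [p1] with [p3] at its far end. These four are distinct; [p3 = p2] would
    close a triangle. *)
Lemma even_set_size (z : T * T -> 'F_2) :
  (forall v, v \in S -> \sum_(p in oriented_edges e S) (endpoint p v)%:R * z p = 0) ->
  (exists2 p, p \in oriented_edges e S & z p != 0) -> (4 <= \sum_(p in oriented_edges e S) (z p != 0)%R)%N.
Proof.
move=> ev [p0 p0E z0]; pose Z := [set p in oriented_edges e S | z p != 0].
have -> : (\sum_(p in oriented_edges e S) (z p != 0)%R)%N = #|Z|.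
  rewrite -sum1_card big_mkcond [RHS]big_mkcond; apply: eq_bigr => p _.
  by rewrite !inE; case: (_ && _) => //; case: (z p == 0).
have ZE p : p \in Z -> p \in oriented_edges e S by rewrite inE => /andP[].
have endS p v : p \in oriented_edges e S -> endpoint p v -> v \in S.
  by rewrite inE => /and4P[h1 h2 _ _] /orP[]/eqP<-.
have next p v : p \in Z -> endpoint p v -> exists q, [/\ q \in Z, q != p & endpoint q v].
  move=> pZ pv; have pE := ZE p pZ.
  case: (boolP [exists q in Z, (q != p) && endpoint q v]) => [/exists_inP[q qZ /andP[h1 h2]]|].
    by exists q.
  rewrite negb_exists_in => /forall_inP H; exfalso.
  have := ev v (endS p v pE pv); rewrite (bigD1 p) //= pv mul1r big1 ?addr0.
    by apply/eqP; move: pZ; rewrite inE => /andP[].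
  move=> q /andP[qE qp]; case: (eqVneq (z q) 0) => [->|zq]; first by rewrite mulr0.
  have qZ : q \in Z by rewrite inE qE.
  by have := H q qZ; rewrite qp /= => /negbTE->; rewrite mul0r.
have p0Z : p0 \in Z by rewrite inE p0E.
have [x [y [exy p0x p0y p0xy]]] : exists x y, [/\ e x y, endpoint p0 x, endpoint p0 y &
    forall u, endpoint p0 u -> u = x \/ u = y].
  have p01 : endpoint p0 p0.1 by rewrite /endpoint eqxx.
  by have [y [h1 h2 h3]] := edges_ends p0E p01; exists p0.1, y.
have xy : x != y by apply: contraTneq exy => ->; rewrite irr.
have [p1 [p1Z p10 p1x]] := next p0 x p0Z p0x.
have [p2 [p2Z p20 p2y]] := next p0 y p0Z p0y.
have [x' [exx' p1x' p1_]] := edges_ends (ZE _ p1Z) p1x.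
have xx' : x != x' by apply: contraTneq exx' => ->; rewrite irr.
have [p3 [p3Z p31 p3x']] := next p1 x' p1Z p1x'.
have x'y : x' != y.
  apply: contraNneq p10 => E; apply/eqP; apply: (edges_inj (ZE _ p1Z) p0E xy) => //.
  by rewrite -E.
have p12 : p1 != p2.
  apply/eqP => E; case: (p1_ y); rewrite ?E // => E'; first by rewrite E' eqxx in xy.
  by rewrite E' eqxx in x'y.
have p30 : p3 != p0.
  apply/eqP => E; case: (p0xy x'); rewrite -?E // => E'; first by rewrite E' eqxx in xx'.
  by rewrite E' eqxx in x'y.
have p32 : p3 != p2.
  apply/eqP => E; have p2x' : endpoint p2 x' by rewrite -E.
  have [w [eyw _ p2_]] := edges_ends (ZE _ p2Z) p2y.
  case: (p2_ x' p2x') => E'; first by rewrite E' eqxx in x'y.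
  by apply: (tf exy _ exx'); rewrite E'.
have un : uniq [:: p0; p1; p2; p3].
  by rewrite /= !inE !negb_or (eq_sym p0) p10 (eq_sym p0) p20 (eq_sym p0) p30 p12
    (eq_sym p1) p31 eq_sym p32.
have /esym /= -> := card_uniqP un; apply/subset_leq_card/subsetP => p.
by rewrite !in_cons in_nil orbF => /or4P[]/eqP->.
Qed.

End Girth.

(** * The edge bound for graphs modelled in the grid *)

Section Sparse.
Local Open Scope ring_scope.
Notation P := (nat * nat)%type.
Variables (T : finType) (e : rel T).
Variables (pts : T -> seq P) (r : T -> P) (s : T -> T -> seq P).
Hypotheses (sym : symmetric e) (irr : irreflexive e) (tf : triangle_free e).
Hypotheses (rP : forall x, r x \in pts x)
  (pts_pos : forall x p, p \in pts x -> (1 < p.1)%N && (1 < p.2)%N)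
  (pts_inj : forall x y p, p \in pts x -> p \in pts y -> x = y)
  (sP : forall x y, e x y -> path gadj (r x) (s x y))
  (s_pts : forall x y, e x y -> {subset s x y <= pts x})
  (link : forall x y, e x y -> gadj (last (r x) (s x y)) (last (r y) (s y x))).

Lemma grid_sparse : sparse e.
Proof.
move=> S S2; rewrite nE_edges //.
suff : (#|oriented_edges e S| + 4 <= 2 * #|S|)%N by lia.
pose a x y := last (r x) (s x y).
apply: (@dual_edge_bound T S (oriented_edges e S) P
  (fun p => (sides (a p.1 p.2) (a p.2 p.1)).1) (fun p => (sides (a p.1 p.2) (a p.2 p.1)).2)
  (face_fun e S pts r s)) => //.
- by move=> c; apply: face_fun_ind.
- by move=> Phi v; apply: face_fun_even.
- by move=> z zev; apply: even_potential.
- by move=> z; apply: even_set_size.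
- move=> p; rewrite inE => /and4P[h1 h2 h3 _]; split=> //.
  by apply: contraTneq h3 => ->; rewrite irr.
Qed.

End Sparse.

(** * From a drawing to the grid *)

Section Walks.
Notation P := (nat * nat)%type.

Definition walk (Z : P -> Prop) (a b : P) (s : seq P) :=
  [/\ path gadj a s, last a s = b & forall q, q \in a :: s -> Z q].

(** The walk is followed until it first reaches [B], and only the part after its last visit to [A]
    is kept; [t] collects the points since that visit. *)
Lemma split_walk (A B : P -> Prop) c s t a : (forall q, A q -> B q -> False) ->
  A a -> path gadj a (rcons t c) -> (forall q, q \in t -> ~ A q /\ ~ B q) ->
  path gadj c s -> B (last c s) ->
  exists a' t' b', [/\ A a', B b', path gadj a' (rcons t' b'),
    forall q, q \in t' -> ~ A q /\ ~ B q & {subset t' <= t ++ c :: s}].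
Proof.
move=> AB; elim: s c t a => [|d s IH] c t a Aa pt tAB /=.
  by move=> _ Bc; exists a, t, c; split=> // q; rewrite mem_cat => ->.
case/andP => cd ps Bl.
case: (boolp.EM (B c)) => [Bc|nBc].
  by exists a, t, c; split=> // q; rewrite mem_cat => ->.
case: (boolp.EM (A c)) => [Ac|nAc].
  have [|//|||a' [t' [b' [h1 h2 h3 h4 h5]]]] := IH d [::] c Ac => //=; first by rewrite cd.
  exists a', t', b'; split=> // q /h5 /= qs.
  by rewrite mem_cat inE qs !orbT.
have [||//|//|a' [t' [b' [h1 h2 h3 h4 h5]]]] := IH d (rcons t c) a Aa.
- by rewrite rcons_path pt last_rcons.
- by move=> q; rewrite mem_rcons inE => /orP[/eqP->|/tAB].
exists a', t', b'; split=> // q /h5.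
by rewrite mem_cat mem_rcons mem_cat !inE -!orbA => /or4P[]->; rewrite ?orbT.
Qed.

Variables (T : finType) (e : rel T).
Hypotheses (sym : symmetric e) (irr : irreflexive e).
Definition oriented x y := e x y && (enum_rank x < enum_rank y).
Variables (r : T -> P) (Zv : T -> P -> Prop) (Ze : T -> T -> P -> Prop).
Hypotheses (Zv_r : forall x, Zv x (r x))
  (Zv_pos : forall x p, Zv x p -> (1 < p.1) && (1 < p.2))
  (Ze_pos : forall x y p, oriented x y -> Ze x y p -> (1 < p.1) && (1 < p.2))
  (ZvZv : forall x y p, Zv x p -> Zv y p -> x = y)
  (ZvZe : forall x y z p, oriented x y -> Zv z p -> Ze x y p -> z = x \/ z = y)
  (ZeZe : forall x y x' y' p, oriented x y -> oriented x' y' -> Ze x y p -> Ze x' y' p ->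
     x = x' /\ y = y')
  (walks : forall x y, oriented x y -> exists a b,
     [/\ exists s, walk (Zv x) (r x) a s, exists s, walk (Zv y) (r y) b s
       & exists s, walk (Ze x y) a b s]).

(** A zone may contain cells that no walk inside it joins to [r x]; only those that are joined may
    serve in the branch set. *)
Let D x p := exists s, walk (Zv x) (r x) p s.

Let D_Zv x p : D x p -> Zv x p.
Proof. by case=> s [_ <- H]; apply: H; apply: mem_last. Qed.

Let D_pt x p s q : walk (Zv x) (r x) p s -> q \in r x :: s -> D x q.
Proof.
case=> pth _ H; rewrite inE => /orP[/eqP->|qs].
  by exists [::]; split=> // q'; rewrite inE => /eqP->; apply: H; rewrite inE eqxx.
move: pth H; case/splitPr: qs => s1 s2; rewrite cat_path /= => /and3P[p1 p2 _] H.
exists (rcons s1 q); split; first by rewrite rcons_path p1.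
  by rewrite last_rcons.
move=> q'; rewrite inE mem_rcons inE => h; apply: H.
by rewrite !inE mem_cat inE; case/or3P: h => ->; rewrite ?orbT.
Qed.

(** The zone of an edge overlaps those of its two ends, so its walk is cut down to a stretch that
    meets [D x] and [D y] only in its end points. The points strictly between are given to the
    branch set of [x], the end that comes first in the enumeration. *)
Lemma zones_sparse : triangle_free e -> sparse e.
Proof.
move=> tf.
have link (xy : T * T) : exists w : seq P * seq P * seq P, oriented xy.1 xy.2 ->
   [/\ walk (Zv xy.1) (r xy.1) (last (r xy.1) w.1.1) w.1.1,
       walk (Zv xy.2) (r xy.2) (last (r xy.2) w.2) w.2,
       path gadj (last (r xy.1) w.1.1) (rcons w.1.2 (last (r xy.2) w.2)) &
       forall q, q \in w.1.2 -> [/\ Ze xy.1 xy.2 q, ~ D xy.1 q & ~ D xy.2 q]].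
  case: xy => x y /=; case: (boolP (oriented x y)) => [xy|]; last by exists ([::], [::], [::]).
  have [a [b [Da Db [s [ps ls Zs]]]]] := walks xy.
  have nxy : x <> y by move=> E; move: xy; rewrite /oriented E irr.
  have dis q : D x q -> D y q -> False by move=> /D_Zv h1 /D_Zv h2; apply/nxy/(ZvZv h1 h2).
  have [a' [t [b' [[s1 w1] [s2 w2] h3 h4 h5]]]] : exists a' t' b', [/\ D x a', D y b',
      path gadj a' (rcons t' b'), forall q, q \in t' -> ~ D x q /\ ~ D y q & {subset t' <= a :: s}].
    case: s ps ls Zs => [_ /= E _|c s /= /andP[ac ps] ls Zs].
      by case: (dis a) => //; rewrite E.
    have [||||a' [t' [b' [h1 h2 h3 h4 h5]]]] := @split_walk (D x) (D y) c s [::] a dis Da => //=.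
    - by rewrite ac.
    - by rewrite ls.
    by exists a', t', b'; split=> // q /h5 /= qs; rewrite [q \in a :: _]in_cons qs orbT.
  exists (s1, t, s2) => _ /=; have [q1 l1 z1] := w1; have [q2 l2 z2] := w2.
  rewrite l1 l2; split=> // q qt; have [n1 n2] := h4 q qt; split=> //.
  by apply: Zs; apply: h5.
have [w wP] := boolp.choice link.
pose s x y := if enum_rank x < enum_rank y then (w (x, y)).1.1 ++ (w (x, y)).1.2 else (w (y, x)).2.
have can2 x y : e x y -> enum_rank x < enum_rank y = false -> oriented y x.
  move=> exy lt; rewrite /oriented sym exy /=.
  case: ltngtP lt => // E _; by move: exy; rewrite (enum_rank_inj (val_inj E)) irr.
pose pts x := r x :: flatten [seq s x y | y <- enum T & e x y].
pose Own x p := D x p \/ exists y, oriented x y /\ p \in (w (x, y)).1.2.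
have ptsO x p : p \in pts x -> Own x p.
  rewrite inE => /orP[/eqP->|/flatten_mapP[y]].
    left; exists [::]; split=> // q; rewrite inE => /eqP->; exact: Zv_r.
  rewrite mem_filter => /andP[exy _]; rewrite /s; case: ifP => lt.
    have xy : oriented x y by rewrite /oriented exy.
    have [w1 _ _ _] := wP (x, y) xy; rewrite mem_cat => /orP[pw|pw]; last by right; exists y.
    by left; apply: D_pt w1 _; rewrite inE pw orbT.
  have yx := can2 x y exy lt; have [_ w2 _ _] := wP (y, x) yx => pw.
  by left; apply: D_pt w2 _; rewrite inE pw orbT.
have OwnI x y p : Own x p -> Own y p -> x = y.
  case=> [Dx|[x' [xx' px]]].
    case=> [Dy|[y' [yy' py]]]; first by apply: ZvZv (D_Zv Dx) (D_Zv Dy).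
    have [_ _ _ /(_ p py)[/= zp n1 n2]] := wP (y, y') yy'.
    by case: (ZvZe yy' (D_Zv Dx) zp) => // E; case: n2; rewrite -E.
  have [_ _ _ /(_ p px)[/= zp n1 n2]] := wP (x, x') xx'.
  case=> [Dy|[y' [yy' py]]].
    by case: (ZvZe xx' (D_Zv Dy) zp) => [->//|E]; case: n2; rewrite -E.
  have [_ _ _ /(_ p py)[/= zp' _ _]] := wP (y, y') yy'.
  by have [] := ZeZe xx' yy' zp zp'.
have Own_pos x p : Own x p -> (1 < p.1) && (1 < p.2).
  case=> [/D_Zv/Zv_pos//|[y [xy py]]]; have [_ _ _ /(_ p py)[/= zp _ _]] := wP (x, y) xy.
  exact: Ze_pos zp.
have rcat x y : oriented x y -> path gadj (r x) ((w (x, y)).1.1 ++ rcons (w (x, y)).1.2 (last (r y) (w (x, y)).2)).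
  by move=> xy; have [[p1 _ _] _ p3 _] := wP (x, y) xy; rewrite cat_path p1.
apply: (@grid_sparse T e pts r s) => //.
- by move=> x; rewrite inE eqxx.
- by move=> x p /ptsO; apply: Own_pos.
- by move=> x y p /ptsO h1 /ptsO; apply: OwnI h1.
- move=> x y exy; rewrite /s; case: ifP => lt.
    have xy : oriented x y by rewrite /oriented exy.
    by have := rcat x y xy; rewrite -rcons_cat rcons_path => /andP[].
  by have [_ [p2 _ _] _ _] := wP (y, x) (can2 x y exy lt).
- move=> x y exy q qs; rewrite inE; apply/orP; right; apply/flatten_mapP.
  by exists y => //; rewrite mem_filter exy mem_enum.
- have main x y : oriented x y -> gadj (last (r x) ((w (x, y)).1.1 ++ (w (x, y)).1.2)) (last (r y) (w (x, y)).2).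
    by move=> xy; have := rcat x y xy; rewrite -rcons_cat rcons_path => /andP[].
  move=> x y exy; rewrite /s; case: (ltngtP (enum_rank x) (enum_rank y)) => lt.
  + by apply: main; rewrite /oriented exy.
  + by rewrite gadj_sym; apply: main; rewrite /oriented sym exy.
  + by move: exy; rewrite (enum_rank_inj (val_inj lt)) irr.
Qed.

End Walks.

From mathcomp Require Import all_classical all_reals all_analysis.
Import numFieldNormedType.Exports.

(** * Rounding arcs to grid cells *)

Section Cells.
Local Open Scope ring_scope.
Local Open Scope classical_set_scope.
Variable R : realType.
Implicit Types (K L : set (R * R)) (p q : R * R).

(** Stated for all small positive [d], so that finitely many pairs of compact sets can be treated
    with one [d]. *)
Lemma compact_separation K L : compact K -> compact L -> (forall p, K p -> L p -> False) ->
  \forall d \near (0 : R)^'+, forall p q, K p -> L q -> ~ ball p d q.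
Proof.
move=> cK cL KL; have clL : closed L.
  by apply: compact_closed cL; apply: norm_hausdorff.
suff : \forall d \near (0 : R)^'+, K `<=` [set p | forall q, L q -> ~ ball p d q].
  by apply: filterS => d H p q Kp Lq; apply: H Lq.
have /compact_near_coveringP cov := cK.
apply: (cov R _ (fun d p => forall q, L q -> ~ ball p d q)) => p Kp.
have /nbhs_ballP[d /= d0 dL] : nbhs p (~` L).
  by apply: open_nbhs_nbhs; split; [rewrite openC|move=> /(KL p Kp)].
have d20 : 0 < d / 2 by rewrite divr_gt0.
exists (ball p (d / 2), [set x | x < d / 2]).
  by split; [exact: nbhsx_ballx|apply: nbhs_right_lt].
move=> [p' d'] /= [pp' dd'] q Lq p'q; apply: (dL q) => //.
by apply: ball_split pp' _; apply: le_ball p'q; apply: ltW.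
Qed.

Variables (eta M : R).
Hypothesis eta0 : 0 < eta.

(* [M] is an offset that makes all coordinates positive. *)
Definition cell1 (x : R) : nat := Num.truncn ((x + M) / eta).
Definition cell p : nat * nat := (cell1 p.1, cell1 p.2).
(** Rounding changes a coordinate by less than [eta], and passing to a nearby point of the arc by
    less than another [eta]; the factor 3 has room for both. The factor 5 in [inside] then keeps the
    cells of a zone above 1. *)
Definition close (c : nat) (x : R) := `|c%:R * eta - (x + M)| < 3 * eta.
Definition zone K (c : nat * nat) := exists p, [/\ K p, close c.1 p.1 & close c.2 p.2].
Definition inside K := forall p, K p -> 5 * eta <= p.1 + M /\ 5 * eta <= p.2 + M.

Lemma cell1_bounds x : 5 * eta <= x + M ->
  (cell1 x)%:R * eta <= x + M < (cell1 x).+1%:R * eta.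
Proof.
move=> h; have e0 := eta0; have h0 : 0 <= (x + M) / eta by apply: divr_ge0; [lra|apply: ltW].
by have := truncn_itv h0; rewrite ler_pdivlMr // ltr_pdivrMr.
Qed.

Lemma zone_pos K c : inside K -> zone K c -> (1 < c.1)%N && (1 < c.2)%N.
Proof.
move=> iK [p [Kp c1 c2]]; have e0 := eta0; have [i1 i2] := iK p Kp.
have H (n : nat) x : close n x -> 5 * eta <= x + M -> (1 < n)%N.
  rewrite /close ltr_norml => /andP[a _] b; rewrite -(ltr_nat R) -(ltr_pM2r eta0); lra.
by rewrite (H _ _ c1) ?(H _ _ c2).
Qed.

Lemma walk_cat Z a b c s1 s2 : walk Z a b s1 -> walk Z b c s2 -> walk Z a c (s1 ++ s2).
Proof.
move=> [p1 l1 z1] [p2 l2 z2]; split; first by rewrite cat_path p1 l1.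
  by rewrite last_cat l1.
move=> q; rewrite inE mem_cat orbA => /orP[h|h]; first by apply: z1; rewrite inE.
by apply: z2; rewrite inE h orbT.
Qed.

Lemma walk1 (Z : nat * nat -> Prop) a b : Z a -> Z b -> a = b \/ gadj a b -> exists s, walk Z a b s.
Proof.
move=> Za Zb [<-|ab]; first by exists [::]; split=> // q; rewrite inE => /eqP->.
exists [:: b]; split=> //=; first by rewrite ab.
by move=> q; rewrite !inE => /orP[]/eqP->.
Qed.

(** The two cells differ by at most 1 in each coordinate, and the walk turns at the cell that takes
    one coordinate from each. *)
Lemma walk_close K p q : inside K -> K p -> K q -> ball p eta q ->
  exists s, walk (zone K) (cell p) (cell q) s.
Proof.
move=> iK Kp Kq [b1 b2]; have e0 := eta0; have [p1 p2] := iK p Kp; have [q1 q2] := iK q Kq.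
move: b1 b2; rewrite -!ball_normE /= !ltr_norml => /andP[b1 b1'] /andP[b2 b2'].
have succ (n : nat) : n.+1%:R * eta = n%:R * eta + eta by rewrite -natr1 mulrDl mul1r.
have near_cell x y : 5 * eta <= x + M -> - eta < y - x < eta -> close (cell1 x) y.
  move=> h /andP[h1 h2]; rewrite /close ltr_norml.
  by have := cell1_bounds h; rewrite succ => /andP[h3 h4]; apply/andP; split; lra.
have near_cells x y : 5 * eta <= x + M -> 5 * eta <= y + M -> y - x < eta ->
    (cell1 y <= (cell1 x).+1)%N.
  move=> hx hy d; rewrite -ltnS -(ltr_nat R) -(ltr_pM2r eta0).
  have := cell1_bounds hx; have := cell1_bounds hy; rewrite !succ => /andP[h1 h2] /andP[h3 h4].
  lra.
have cp : zone K (cell p) by exists p; split=> //; apply: near_cell => //; apply/andP; split; lra.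
have cq : zone K (cell q) by exists q; split=> //; apply: near_cell => //; apply/andP; split; lra.
have cm : zone K (cell1 q.1, cell1 p.2).
  by exists p; split=> //; apply: near_cell => //; apply/andP; split; lra.
have n1 : (cell1 q.1 <= (cell1 p.1).+1)%N by apply: near_cells => //; lra.
have n2 : (cell1 p.1 <= (cell1 q.1).+1)%N by apply: near_cells => //; lra.
have n3 : (cell1 q.2 <= (cell1 p.2).+1)%N by apply: near_cells => //; lra.
have n4 : (cell1 p.2 <= (cell1 q.2).+1)%N by apply: near_cells => //; lra.
have zpos c : zone K c -> pos c.
  by move=> /(zone_pos iK) /andP[h1 h2]; rewrite /pos (ltnW h1) (ltnW h2).
have diff (m n : nat) : (m <= n.+1)%N -> (n <= m.+1)%N -> [\/ m = n, m = n.+1 | m = n.-1].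
  rewrite leq_eqVlt => /orP[/eqP->|]; first by constructor 2.
  rewrite ltnS leq_eqVlt => /orP[/eqP->|mn]; first by constructor 1.
  move=> nm; constructor 3; apply/eqP; rewrite eqn_leq; apply/andP; split.
    by rewrite -ltnS (ltn_predK mn).
  by rewrite -ltnS (ltn_predK mn).
have [s1 w1] : exists s, walk (zone K) (cell p) (cell1 q.1, cell1 p.2) s.
  apply: walk1 => //; rewrite /gadj (zpos _ cp) (zpos _ cm) /cell /nb /=.
  by have [->|->|->] := diff _ _ n1 n2; [left|right|right]; rewrite ?inE ?eqxx ?orbT.
have [s2 w2] : exists s, walk (zone K) (cell1 q.1, cell1 p.2) (cell q) s.
  apply: walk1 => //; rewrite /gadj (zpos _ cq) (zpos _ cm) /cell /nb /=.
  by have [->|->|->] := diff _ _ n3 n4; [left|right|right]; rewrite ?inE ?eqxx ?orbT.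
by exists (s1 ++ s2); apply: walk_cat w1 w2.
Qed.

(** Connectedness of the interval: the parameters whose cells can be reached form a relatively open
    and closed subset. *)
Lemma walk_arc (g : R -> R * R) a b : a <= b -> {within `[a, b], continuous g} ->
  inside (g @` `[a, b]) -> exists s, walk (zone (g @` `[a, b])) (cell (g a)) (cell (g b)) s.
Proof.
move=> ab cg iK; set K := g @` `[a, b] in iK *.
pose A : set R := `[a, b].
pose W t := exists s, walk (zone K) (cell (g a)) (cell (g t)) s.
have loc t : A t -> \forall u \near t, A u ->
    (exists s, walk (zone K) (cell (g t)) (cell (g u)) s) /\
    (exists s, walk (zone K) (cell (g u)) (cell (g t)) s).
  move=> At; move/subspace_continuousP: cg => /(_ t At) cgt.
  have : \forall u \near within A (nbhs t), ball (g t) eta (g u).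
    by apply: (cgt (ball (g t) eta)); apply: nbhsx_ballx.
  rewrite near_withinE; apply: filterS => u H Au; have Bu := H Au.
  have Kt : K (g t) by exists t.
  have Ku : K (g u) by exists u.
  by split; apply: walk_close => //; apply: ball_sym.
have Wa : W a by apply: walk_close; rewrite //; [exists a; rewrite //= in_itv /= lexx ab| exists a; rewrite //= in_itv /= lexx ab|apply: ballxx].
have Aa : A a by rewrite /A /= in_itv /= lexx ab.
have Ab : A b by rewrite /A /= in_itv /= lexx ab.
suff E : A `&` W = A.
  have Wb : (A `&` W) b by rewrite E.
  by case: Wb.
apply: (@segment_connected R a b); first by exists a.
- exists ((fun u => A u -> W u)°); first exact: open_interior.
  rewrite eqEsubset; split=> t [At Wt]; split=> //; last exact: (interior_subset Wt).
  rewrite /interior; apply: filterS (loc t At) => u H Au; have [[s ws] _] := H Au.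
  by case: Wt => s0 w0; exists (s0 ++ s); apply: walk_cat w0 ws.
- exists (closure (A `&` W)); first exact: closed_closure.
  rewrite eqEsubset; split=> t [At Wt]; split=> //; first exact: subset_closure.
  have [u [[Au [s0 w0]] H]] := Wt _ (loc t At); have [_ [s ws]] := H Au.
  by exists (s0 ++ s); apply: walk_cat w0 ws.
Qed.

(** Points close to the same cell differ by less than twice [3 * eta] in each coordinate. *)
Lemma zone_disjoint K L d c : (forall p q, K p -> L q -> ~ ball p d q) -> 6 * eta <= d ->
  zone K c -> zone L c -> False.
Proof.
move=> sep ed [p [Kp p1 p2]] [q [Lq q1 q2]]; apply: (sep p q Kp Lq).
move: p1 p2 q1 q2; rewrite /close !ltr_norml => /andP[? ?] /andP[? ?] /andP[? ?] /andP[? ?].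
by split; rewrite -ball_normE /= ltr_norml; apply/andP; split; lra.
Qed.

Lemma zone_sub K L c : K `<=` L -> zone K c -> zone L c.
Proof. by move=> KL [p [/KL Lp h1 h2]]; exists p. Qed.

End Cells.

(** * Stars and middle thirds of a plane drawing *)

Section Drawing.
Local Open Scope ring_scope.
Local Open Scope classical_set_scope.
Variables (R : realType) (T : finType) (e : rel T).
Variables (pt : T -> R * R) (edge : T -> T -> set (R * R)).
Hypotheses (sym : symmetric e) (irr : irreflexive e) (draw : plane_drawing e pt edge).

(** Each arc is cut into thirds, the outer ones going to the stars of its ends. The middle thirds
    are compact and avoid the drawn vertices and one another, so they stay at a positive distance
    from them. *)
Let piece := (T + (T * T) * 'I_3)%type.
Variable G : T * T -> R -> R * R.
Hypotheses (Gc : forall xy, {within `[0, 1], continuous (G xy)})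
  (GP : forall x y, oriented e x y -> [/\ {in `[0, 1] &, injective (G (x, y))},
     G (x, y) 0 = pt x, G (x, y) 1 = pt y & G (x, y) @` `[0, 1] = edge x y]).

Let o0 : 'I_3 := @Ordinal 3 0 isT.
Let o1 : 'I_3 := @Ordinal 3 1 isT.
Let o2 : 'I_3 := @Ordinal 3 2 isT.
Let itv (k : 'I_3) : set R := `[k%:R / 3, k.+1%:R / 3].
Let K (i : piece) : set (R * R) :=
  match i with inl x => [set pt x] | inr (xy, k) => G xy @` itv k end.

Let at_star x (i : piece) : Prop :=
  match i with inl z => z = x
  | inr ((u, v), k) => oriented e u v /\ (u = x /\ k = 0%N :> nat \/ v = x /\ k = 2%N :> nat) end.
Let star x : set (R * R) := [set p | exists2 i, at_star x i & K i p].
Let mid x y := K (inr ((x, y), o1)).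

Let itv01 k : itv k `<=` `[0, 1].
Proof.
move=> t; rewrite /itv /= !in_itv /= => /andP[h1 h2]; case: k h1 h2 => [[|[|[|//]]] hk] /= h1 h2;
  apply/andP; split; lra.
Qed.

Let K_compact i : compact (K i).
Proof.
case: i => [x|[xy k]] /=; first exact: compact_set1.
by apply: continuous_compact; [exact: (continuous_subspaceW (@itv01 k) (@Gc xy))|exact: segment_compact].
Qed.

Let orientedE x y : oriented e x y -> e x y.
Proof. by case/andP. Qed.

Let oriented_neq x y : oriented e x y -> x <> y.
Proof. by move=> /orientedE exy E; move: exy; rewrite E irr. Qed.

Let K_inner u v k p : oriented e u v -> K (inr ((u, v), k)) p ->
  edge u v p /\ exists2 t, itv k t & [/\ G (u, v) t = p, p = pt u -> t = 0 & p = pt v -> t = 1].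
Proof.
move=> uv [t tk Gt]; have [inj G0 G1 E] := GP uv.
have t01 := itv01 tk; have z0 : (`[0, 1] : set R) 0 by rewrite /= in_itv /= lexx ler01.
have z1 : (`[0, 1] : set R) 1 by rewrite /= in_itv /= lexx ler01.
split; first by rewrite -E; exists t.
by exists t => //; split=> // Ep; [apply: (inj _ _ (mem_set t01) (mem_set z0)); rewrite Gt G0|apply: (inj _ _ (mem_set t01) (mem_set z1)); rewrite Gt G1].
Qed.

(* A point of the star of [x] is [pt x] itself or an inner point of an edge at [x]. *)
Let star_inner x p : star x p -> p = pt x \/ exists u v k t, [/\ oriented e u v, edge u v p,
   (u = x /\ t < 1 / 2 \/ v = x /\ 1 / 2 < t), G (u, v) t = p & [/\ itv k t, p <> pt u & p <> pt v]].
Proof.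
case=> -[z zx Kp|[[u v] k] [uv st] Kp]; first by left; rewrite -zx; exact: Kp.
have [Ep [t tk [Gt t0 t1]]] := K_inner uv Kp.
have [inj G0 G1 _] := GP uv.
have tk' := tk; rewrite /itv /= in_itv /= in tk'.
case: st => -[ux k0]; rewrite k0 in tk'; case/andP: tk' => h1 h2.
- case: (EM (p = pt u)) => [pu|npu]; first by left; rewrite -ux.
  right; exists u, v, k, t; split=> //; first by left; split=> //; lra.
  by split=> // /t1 E; move: h2; rewrite E; lra.
- case: (EM (p = pt v)) => [pu|npu]; first by left; rewrite -ux.
  right; exists u, v, k, t; split=> //; first by right; split=> //; lra.
  by split=> // /t0 E; move: h1; rewrite E; lra.
Qed.

Let mid_inner x y p : oriented e x y -> mid x y p -> edge x y p /\ (p <> pt x /\ p <> pt y).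
Proof.
move=> xy Kp; have [Ep [t tk [Gt t0 t1]]] := K_inner xy Kp; split=> //.
move: tk; rewrite /itv /= in_itv /= => /andP[h1 h2].
by split=> [/t0|/t1] E; move: h1 h2; rewrite E; lra.
Qed.

Let inner_edge u v u' v' p : oriented e u v -> oriented e u' v' -> edge u v p -> p <> pt u -> p <> pt v ->
  edge u' v' p -> u = u' /\ v = v'.
Proof.
move=> uv uv' Ep pu pv Ep'; have [_ _ _ _ D5] := draw.
have [/setP E|nE] := EM ([set u; v]%SET = [set u'; v']%SET).
  have := E u; have := E v; have := E u'; have := E v'; rewrite !inE !eqxx /= !orbT.
  move=> /orP[]/eqP h1 /orP[]/eqP h2 /esym/orP[]/eqP h3 /esym/orP[]/eqP h4; subst => //;
  try by case: (oriented_neq uv).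
  by case/andP: uv => _ l1; case/andP: uv' => _ l2; have := ltn_trans l1 l2; rewrite ltnn.
have := D5 u v u' v' (orientedE uv) (orientedE uv') nE; rewrite eqEsubset => -[/(_ p) H _].
by case: H; split=> //; split=> // -[].
Qed.

Let inner_pt u v z p : oriented e u v -> edge u v p -> p <> pt u -> p <> pt v -> p <> pt z.
Proof.
move=> uv Ep pu pv E; have [_ _ _ D4 _] := draw.
by apply: (D4 u v z (orientedE uv)); rewrite -E; split=> // -[].
Qed.

(** A point of two stars that is not a drawn vertex is an inner point of a single arc and has a
    single parameter there, which cannot lie in the outer thirds at both ends. *)
Let star_star x y p : star x p -> star y p -> x = y.
Proof.
have [pt_inj _ _ _ _] := draw.
move=> /star_inner[px|[u [v [k [t [uv Ep ux Gt [tk pu pv]]]]]]].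
  move=> /star_inner[py|[u [v [k [t [uv Ep ux Gt [tk pu pv]]]]]]].
    by apply: pt_inj; rewrite -px.
  by case: (inner_pt uv Ep pu pv px).
move=> /star_inner[py|[u' [v' [k' [t' [uv' Ep' ux' Gt' [tk' pu' pv']]]]]]].
  by case: (inner_pt uv Ep pu pv py).
have [E1 E2] := inner_edge uv uv' Ep pu pv Ep'; subst u' v'.
have [inj _ _ _] := GP uv.
have E : t = t' by apply: (inj _ _ (mem_set (itv01 tk)) (mem_set (itv01 tk'))); rewrite Gt.
subst t'; case: ux => -[<- h]; case: ux' => -[<- h'] //; by have := lt_trans h h'; rewrite ltxx.
Qed.

Let star_mid x y z p : oriented e x y -> star z p -> mid x y p -> z = x \/ z = y.
Proof.
move=> xy sz /(mid_inner xy)[Ep [px py]].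
case: (star_inner sz) => [pz|[u [v [k [t [uv Ep' ux Gt [tk pu pv]]]]]]].
  by case: (inner_pt xy Ep px py pz).
have [<- <-] := inner_edge uv xy Ep' pu pv Ep.
by case: ux => -[<- _]; [left|right].
Qed.

Let mid_mid x y x' y' p : oriented e x y -> oriented e x' y' -> mid x y p -> mid x' y' p ->
  x = x' /\ y = y'.
Proof.
move=> xy xy' /(mid_inner xy)[Ep [px py]] /(mid_inner xy')[Ep' _].
exact: inner_edge xy xy' Ep px py Ep'.
Qed.

Lemma drawing_sparse : triangle_free e -> sparse e.
Proof.
have [B Bpos KB] : exists2 B : R, 0 < B & forall i p, K i p -> `|p| <= B.
  have : \forall B \near +oo, forall i p, K i p -> `|p| <= B.
    by apply: filter_forall => i; apply: (compact_bounded (@K_compact i)).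
  move=> nB; have : \forall B \near +oo, (0 : R) < B by apply: nbhs_pinfty_gt; rewrite num_real.
  by move=> /(filterI nB)/filter_ex[B [h1 h2]]; exists B.
(* Only disjoint pieces are separated. Two pieces whose zones share a cell must then have a common
   point, and the three facts above about stars and middle thirds apply to it. *)
pose dis i j := forall p, K i p -> K j p -> False.
have [d [d0 d1 sep]] : exists d : R, [/\ 0 < d, d < 1 &
    forall i j, dis i j -> forall p q, K i p -> K j q -> ~ ball p d q].
  have : \forall d \near (0 : R)^'+, forall ij : piece * piece, dis ij.1 ij.2 ->
      forall p q, K ij.1 p -> K ij.2 q -> ~ ball p d q.
    apply: filter_forall => -[i j] /=; case: (EM (dis i j)) => [dij|nd].
      by apply: filterS (compact_separation (@K_compact i) (@K_compact j) dij) => d h _.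
    by apply: filterS (nbhs_right_gt (0 : R)) => d _ /nd.
  move=> nd; have n1 : \forall d \near (0 : R)^'+, 0 < d < 1.
    near=> d; apply/andP; split; near: d; [exact: nbhs_right_gt|exact: nbhs_right_lt].
  move: n1 => /(filterI nd)/filter_ex[d [h1 /andP[h2 h3]]].
  by exists d; split=> // i j; apply: (h1 (i, j)).
(* The shift makes all coordinates at least 1, which exceeds [5 * eta] because [d < 1]; and
   [6 * eta = d] is the separation that [zone_disjoint] asks for. *)
pose eta := d / 6; pose M := B + 1.
have eta0 : 0 < eta by rewrite /eta; lra.
have e6 : 6 * eta <= d by rewrite /eta; lra.
have ins i : inside eta M (K i).
  move=> p Kp; have pB := KB i p Kp.
  have p1 : `|p.1| <= `|p| by rewrite prod_normE le_max lexx.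
  have p2 : `|p.2| <= `|p| by rewrite prod_normE le_max lexx orbT.
  have := le_trans p1 pB; have := le_trans p2 pB; rewrite !ler_norml /M /eta.
  by move=> /andP[? ?] /andP[? ?]; split; lra.
have zone_piece x c : zone eta M (star x) c -> exists2 i, at_star x i & zone eta M (K i) c.
  by case=> p [[i xi Ki] h1 h2]; exists i => //; exists p.
have piece_zone x i : at_star x i -> K i `<=` star x by move=> xi p Kp; exists i.
have zdis i j c : zone eta M (K i) c -> zone eta M (K j) c -> exists p, K i p /\ K j p.
  move=> zi zj; case: (EM (dis i j)) => [dij|nd].
    by case: (zone_disjoint (sep i j dij) e6 zi zj).
  by apply: contrapT => H; apply: nd => p h1 h2; apply: H; exists p.
have inStar x : inside eta M (star x) by move=> p [i _ /ins].
have walkK xy k : exists s, walk (zone eta M (K (inr (xy, k)))) (cell eta M (G xy (k%:R / 3)))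
    (cell eta M (G xy (k.+1%:R / 3))) s.
  apply: walk_arc => //; first by rewrite ler_pM2r ?ler_nat.
    exact: (continuous_subspaceW (@itv01 k) (@Gc xy)).
  exact: (ins (inr (xy, k))).
have zwalk (Z Z' : nat * nat -> Prop) a b s : (forall c, Z c -> Z' c) -> walk Z a b s -> walk Z' a b s.
  by move=> ZZ [h1 h2 h3]; split=> // q /h3 /ZZ.
have rev (Z : nat * nat -> Prop) a b : (exists s, walk Z a b s) -> exists s, walk Z b a s.
  case=> s; elim: s a => [|c s IH] a [].
    by move=> _ /= <- h; exists [::].
  move=> /= /andP[ac ps] ls h.
  have [|s' w'] := IH c; first by split=> // q qs; apply: h; rewrite inE qs orbT.
  exists (s' ++ [:: a]); apply: walk_cat w' _; split=> //=; first by rewrite gadj_sym ac.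
  by move=> q; rewrite !inE => /orP[]/eqP->; apply: h; rewrite !inE eqxx ?orbT.
apply: (@zones_sparse T e sym irr (fun x => cell eta M (pt x)) (fun x => zone eta M (star x))
  (fun x y => zone eta M (mid x y))).
- move=> x; have Kx : K (inl x) (pt x) by [].
  have [|s [_ _ H]] := @walk_close R eta M eta0 (K (inl x)) (pt x) (pt x) (ins (inl x)) Kx Kx.
    exact: ballxx.
  by apply: (zone_sub (piece_zone x (inl x) erefl)); apply: H; rewrite inE eqxx.
- by move=> x c; apply: zone_pos => //; apply: inStar.
- by move=> x y c _; apply: zone_pos => //; apply: (ins (inr ((x, y), o1))).
- move=> x y c /zone_piece[i xi zi] /zone_piece[j yj zj].
  have [p [Kp Kp']] := zdis i j c zi zj; apply: (@star_star x y p); [by exists i|by exists j].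
- move=> x y z c xy /zone_piece[i zi zzi] zm.
  have [p [Kp Kp']] := zdis i _ c zzi zm; apply: (@star_mid x y z p) => //; by exists i.
- move=> x y x' y' c xy xy' z1 z2; have [p [Kp Kp']] := zdis _ _ c z1 z2.
  exact: (mid_mid xy xy' Kp Kp').
move=> x y xy; have [_ G0 G1 _] := GP xy.
exists (cell eta M (G (x, y) (1 / 3))), (cell eta M (G (x, y) (2 / 3))).
have st0 : at_star x (inr ((x, y), o0)) by split=> //; left.
have st2 : at_star y (inr ((x, y), o2)) by split=> //; right.
split.
- have [s ws] := walkK (x, y) o0; exists s; move: ws; rewrite /= mul0r G0; apply: zwalk => c.
  by apply: zone_sub; apply: (piece_zone x _ st0).
- apply: rev; have [s ws] := walkK (x, y) o2; exists s; move: ws; rewrite /= divff ?G1 //.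
  by apply: zwalk => c; apply: zone_sub; apply: (piece_zone y _ st2).
- exact: walkK (x, y) o1.
Unshelve. all: by end_near. Qed.

End Drawing.

Theorem theorem19 (R : realType) (T : finType) (e : rel T) :
  simple_graph e ->
  planar R e ->
  (forall c : seq T, ucycle e c -> size c <> 3) ->
  (6 <= max_degree e)%N ->
  exists f : T -> 'I_(max_degree e), equitable_coloring e f.
Proof.
move=> [sym irr] [pt [edge draw]] no3 k6.
have tf : triangle_free e.
  move=> x y z exy eyz exz; apply: (no3 [:: x; y; z]) => //.
  have neq u v : e u v -> u != v by move=> euv; apply: contraTneq euv => ->; rewrite irr.
  by rewrite /ucycle /= exy eyz (sym z) exz !inE negb_or !neq.
have arc (xy : T * T) : exists g : R -> R * R,
    continuous (g : subspace `[0%R, 1%R]%classic -> R * R) /\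
    (oriented e xy.1 xy.2 -> [/\ {in `[0%R, 1%R]%classic &, injective g}, g 0%R = pt xy.1,
        g 1%R = pt xy.2 & (g @` `[0%R, 1%R])%classic = edge xy.1 xy.2]).
  case: xy => x y /=; case: (boolP (oriented e x y)) => [/andP[exy _]|_]; last first.
    (* Pairs that are not oriented edges get a constant arc, so that every piece is compact. *)
    by exists (cst (pt x)); split=> // t; apply: cst_continuous.
  have [_ D2 _ _ _] := draw; have [g [g1 g2 g3 g4 g5]] := D2 x y exy.
  by exists g.
have [G GP] := choice arc.
have sp : sparse e.
  by apply: (drawing_sparse sym irr draw (fun xy => (GP xy).1) (fun x y => (GP (x, y)).2)).
have tfg : tfgraph e by split=> //; apply: sparse_degenerate.
have degT v : deg e v [set: T]%SET = degree e v.
  by rewrite degE; apply: eq_card => y; rewrite !inE.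
have [|f [f1 f2 f3]] := @sparse_equitable T e [set: T]%SET (max_degree e) tfg sp k6.
  by move=> v _; rewrite degT; apply: (leq_bigmax v).
have fk x : f x < max_degree e by apply: f1; rewrite inE.
exists (fun x => Ordinal (fk x)); split.
  by move=> x y exy; rewrite -val_eqE; apply: f2; rewrite ?inE.
have cE (i : 'I_(max_degree e)) : #|color_class (fun x => Ordinal (fk x)) i| = #|cls f [set: T]%SET i|.
  by apply: eq_card => x; rewrite !inE.
move=> i j; rewrite !cE; have /andP[_ h1] := f3 i (ltn_ord i); have /andP[h2 _] := f3 j (ltn_ord j).
by apply: leq_trans h1 _; rewrite leq_add2r.
Qed.
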